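(* Let $\bm{X}^\star\in\mathbb{R}^{n\times n}$ have rank $r$ with thin SVD $\bm{X}^\star=\bm{U}_r\bm{\Sigma}_r\bm{V}_r^T$, where $\bm{U}_r,\bm{V}_r\in\mathbb{R}^{n\times r}$ have orthonormal columns and $\bm{\Sigma}_r\in\mathbb{R}^{r\times r}$. Let $\bm{\Phi}\in\mathbb{R}^{n\times n}$ and $\lambda\ge 0$, and set $$\alpha_1=\|\bm{U}_r\bm{V}_r^T-\lambda\mathcal{P}_{\mathcal{T}}(\bm{\Phi})\|_F,\quad \alpha_2=\|\lambda\mathcal{P}_{\mathcal{T}^\perp}(\bm{\Phi})\|,$$ $$\xi_1=\|\bm{U}_r\bm{V}_r^T-\lambda\mathcal{P}_{\mathcal{T}}(\bm{\Phi})\|_{\mu(\infty)},\quad \xi_2=\|\bm{U}_r\bm{V}_r^T-\lambda\mathcal{P}_{\mathcal{T}}(\bm{\Phi})\|_{\mu(\infty,2)}.$$ Suppose that for all $i,j=1,\dots,n$, $$1\ge p_{ij}\gtrsim \max\Big\{\log\Big(\frac{\alpha_1^2 n}{r\log n}\Big),1\Big\}\cdot\frac{(\mu_i+\nu_j)r\log n}{n}\cdot\max\{(2\xi_1+\xi_2)^2,1\},$$ and that $\alpha_2<\frac{15}{16}$. Let $\bm{Y}=\mathcal{R}_p(\bm{X}^\star)$. Then with high probability, $\bm{X}^\star$ is the unique solution of $$\min_{\bm{X}\in\mathbb{R}^{n\times n}}\ \|\bm{X}\|_*-\lambda\langle\bm{\Phi},\bm{X}\rangle\quad\text{s.t. }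 \bm{Y}=\mathcal{R}_p(\bm{X}),$$ i.e. this program exactly recovers $\bm{X}^\star$.
   Context: Notation: $\|\cdot\|_*$ is the nuclear norm, $\|\cdot\|$ the spectral norm, $\|\cdot\|_F$ the Frobenius norm, $\langle\bm{A},\bm{B}\rangle=\mathrm{tr}(\bm{A}^T\bm{B})$, and $\bm{e}_1,\dots,\bm{e}_n$ the standard basis of $\mathbb{R}^n$. Sampling: for probabilities $p_{ij}\in(0,1]$, let $\delta_{ij}$ ($i,j=1,\dots,n$) be independent Bernoulli random variables with $\Pr(\delta_{ij}=1)=p_{ij}$, and define the Bernoulli sampling operator $\mathcal{R}_p(\bm{X})=\sum_{i,j=1}^n\frac{\delta_{ij}}{p_{ij}}X_{ij}\,\bm{e}_i\bm{e}_j^T$. Tangent space: $\mathcal{P}_{\mathcal{T}}(\bm{X})=\bm{U}_r\bm{U}_r^T\bm{X}+\bm{X}\bm{V}_r\bm{V}_r^T-\bm{U}_r\bm{U}_r^T\bm{X}\bm{V}_r\bm{V}_r^T$ and $\mathcal{P}_{\mathcal{T}^\perp}(\bm{X})=\bm{X}-\mathcal{P}_{\mathcal{T}}(\bm{X})$. Leverage scores: $\mu_i=\frac{n}{r}\|\bm{U}_r^T\bm{e}_i\|_2^2$, $\nu_j=\frac{n}{r}\|\bm{V}_r^T\bm{e}_j\|_2^2$ (assumed positive so the following norms are defined). Weighted norms: $\|\bm{X}\|_{\mu(\infty)}=\max_{i,j}\sqrt{\frac{n}{\mu_i r}}\,|X_{ij}|\,\sqrt{\frac{n}{\nu_j r}}$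 and $\|\bm{X}\|_{\mu(\infty,2)}=\max\big\{\max_i\sqrt{\frac{n}{\mu_i r}}\|\bm{X}^T\bm{e}_i\|_2,\ \max_j\sqrt{\frac{n}{\nu_j r}}\|\bm{X}\bm{e}_j\|_2\big\}$. The symbol $f\gtrsim g$ means $f\ge Cg$ for a sufficiently large universal constant $C>0$; ''with high probability'' means with failure probability that is polynomially small in $n$. *)

(* Defs.v *)
From HB Require Import structures.
From mathcomp Require Import all_boot all_order all_algebra.
From mathcomp Require Import all_classical all_reals all_analysis.
Set Implicit Arguments. Unset Strict Implicit. Unset Printing Implicit Defensive.
Import Order.TTheory GRing.Theory Num.Theory.
Local Open Scope classical_set_scope.
Local Open Scope ring_scope.

Section Defs.
Variable R : realType.

Definition vnorm2 m (v : 'cV[R]_m) : R := Num.sqrt (\sum_i (v i 0) ^+ 2).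

Definition frob m k (X : 'M[R]_(m, k)) : R := Num.sqrt (\sum_i \sum_j (X i j) ^+ 2).

Definition spec_norm n (X : 'M[R]_n) : R :=
  sup [set vnorm2 (X *m v) | v in [set v : 'cV[R]_n | vnorm2 v = 1]].

(* Squared singular values of X: the roots (with multiplicity) of the
   characteristic polynomial of X^T X (chosen classically; the multiset is
   unique, so any choice gives the same sum below). *)
Definition sq_singvals_spec n (X : 'M[R]_n) (s : seq R) : Prop :=
  size s = n /\ char_poly (X^T *m X) = \prod_(a <- s) ('X - a%:P).

Definition sq_singvals n (X : 'M[R]_n) : seq R :=
  match pselect (exists s, sq_singvals_spec X s) with
  | left h => projT1 (cid h)
  | right _ => [::]
  end.

Definition nuc_norm n (X : 'M[R]_n) : R := \sum_(a <- sq_singvals X) Num.sqrt a.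

Definition inner n (A B : 'M[R]_n) : R := \tr (A^T *m B).

Definition PT n r (U V : 'M[R]_(n, r)) (X : 'M[R]_n) : 'M[R]_n :=
  U *m U^T *m X + X *m V *m V^T - U *m U^T *m X *m V *m V^T.
Definition PTperp n r (U V : 'M[R]_(n, r)) (X : 'M[R]_n) : 'M[R]_n :=
  X - PT U V X.

Definition lev n r (U : 'M[R]_(n, r)) (i : 'I_n) : R :=
  n%:R / r%:R * \sum_k (U i k) ^+ 2.

Definition mu_inf_norm n r (U V : 'M[R]_(n, r)) (X : 'M[R]_n) : R :=
  \big[Num.max/0]_(i < n) \big[Num.max/0]_(j < n)
    (Num.sqrt (n%:R / (lev U i * r%:R)) * `|X i j| *
     Num.sqrt (n%:R / (lev V j * r%:R))).

Definition mu_inf2_norm n r (U V : 'M[R]_(n, r)) (X : 'M[R]_n) : R :=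
  Num.max
    (\big[Num.max/0]_(i < n)
       (Num.sqrt (n%:R / (lev U i * r%:R)) * vnorm2 (col i X^T)))
    (\big[Num.max/0]_(j < n)
       (Num.sqrt (n%:R / (lev V j * r%:R)) * vnorm2 (col j X))).

Definition outcome n := {ffun 'I_n * 'I_n -> bool}.

Definition Rp n (p : 'I_n -> 'I_n -> R) (d : outcome n) (X : 'M[R]_n) : 'M[R]_n :=
  \matrix_(i, j) ((if d (i, j) then 1 else 0) / p i j * X i j).

Definition Prob n (p : 'I_n -> 'I_n -> R) (E : outcome n -> Prop) : R :=
  \sum_(d : outcome n | `[< E d >])
     \prod_(ij : 'I_n * 'I_n) (if d ij then p ij.1 ij.2 else 1 - p ij.1 ij.2).

Definition unique_solution n (lam : R) (Phi : 'M[R]_n)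
  (feasible : 'M[R]_n -> Prop) (Xs : 'M[R]_n) : Prop :=
  feasible Xs /\
  forall X, feasible X -> X <> Xs ->
    nuc_norm Xs - lam * inner Phi Xs < nuc_norm X - lam * inner Phi X.

End Defs.

(* Main.v *)
Require Import Defs.
From HB Require Import structures.
From mathcomp Require Import all_boot all_order all_algebra.
From mathcomp Require Import all_classical all_reals all_analysis.
From mathcomp Require Import complex.
From mathcomp Require Import ring lra zify.
Set Implicit Arguments. Unset Strict Implicit. Unset Printing Implicit Defensive.
Import Order.TTheory GRing.Theory Num.Theory.
Local Open Scope ring_scope.

(** Any competitor is X^* + Z with Z vanishing on the observed entries. The
    objective cannot decrease as soon as some matrix Y supported on the observed
    entries satisfies P_T(Y) = M := U V^T - lam P_T(Phi) and
    ||P_{T^perp}(Y)|| < 1 - alpha2, and X^* is the only minimizer if moreover no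
    nonzero element of T vanishes on the observed entries.

    Y is built by golfing on k + 1 independent subsamples whose union is the given
    sample. The number k of golfing steps is of order max(log(alpha1^2 n / (r log n)), 1),
    just enough to bring the Frobenius norm of the residual E below a small
    absolute constant, which leaves a single subsample of rate
    (mu_i + nu_j) r log n / n. On that last one the equation P_T R_q(F) = E is
    solved exactly, with F in T, and ||R_q(F)|| is bounded by a leave-one-out
    argument: switching off row (or column) i of the sample changes F by an amount
    proportional to the leverage of i, and the modified solution is independent of
    the discarded row.

    All concentration bounds reduce to one matrix Bernstein inequality, proved by
    the method of moments: resampling one coordinate at a time yields
    E tr X^{2q} <= 2q E tr(D X^{2q-2}), where D is itself a constant plus a centred
    sum of positive semidefinite matrices, to which the same recursion applies. *)

(** * Frobenius inner product and operator bounds *)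

(** P_T(Z) is bounded by P_{T^perp}(Z) only with a loss of powers of n, so a residual P_T(Y) - M of
    constant size cannot be tolerated in the duality argument. Golfing until it is polynomially
    small would take of order log n further subsamples, more than the sampling rate allows. Hence
    the equation is solved exactly at the end, with a right-hand side that is small in Frobenius
    norm and whose rows and columns are of leverage size.

    The obstacle is that this solution F inverts P_T R_q P_T and so depends on every sampled entry:
    concentration bounds do not apply to R_q(F) directly, and contraction in Frobenius norm says
    nothing about single rows and columns. Leave-one-out supplies what is missing, namely control of
    the rows of F V and the columns of U^T F, and of their squared norms summed with the sampling
    weights. A Schur-type test then bounds R_q(F).

    The slack 1 - 15/16 = 1/16 is spent on a geometric series of golfing errors with sum at most 2
    c, c = 10^-8, and on 1/32 for the last step. *)

Section Frobenius.
Variable R : realType.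
Implicit Types (m n k : nat).

Definition dot m n (A B : 'M[R]_(m, n)) : R := \sum_i \sum_j A i j * B i j.

Lemma dotE m n (A B : 'M[R]_(m, n)) : dot A B = \tr (A^T *m B).
Proof.
rewrite /dot exchange_big /mxtrace; apply: eq_bigr => j _.
by rewrite mxE; apply: eq_bigr => i _; rewrite mxE.
Qed.

Lemma dotC m n (A B : 'M[R]_(m, n)) : dot A B = dot B A.
Proof. by apply: eq_bigr => i _; apply: eq_bigr => j _; rewrite mulrC. Qed.

Lemma dotDl m n (A B C : 'M[R]_(m, n)) : dot (A + B) C = dot A C + dot B C.
Proof.
rewrite /dot -big_split; apply: eq_bigr => i _; rewrite -big_split.
by apply: eq_bigr => j _; rewrite mxE mulrDl.
Qed.

Lemma dotZl m n a (A B : 'M[R]_(m, n)) : dot (a *: A) B = a * dot A B.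
Proof.
rewrite /dot mulr_sumr; apply: eq_bigr => i _; rewrite mulr_sumr.
by apply: eq_bigr => j _; rewrite mxE mulrA.
Qed.

Lemma dotDr m n (A B C : 'M[R]_(m, n)) : dot A (B + C) = dot A B + dot A C.
Proof. by rewrite dotC dotDl !(dotC _ A). Qed.

Lemma dotZr m n a (A B : 'M[R]_(m, n)) : dot A (a *: B) = a * dot A B.
Proof. by rewrite dotC dotZl dotC. Qed.

Lemma dotNl m n (A B : 'M[R]_(m, n)) : dot (- A) B = - dot A B.
Proof. by rewrite -scaleN1r dotZl mulN1r. Qed.

Lemma dotNr m n (A B : 'M[R]_(m, n)) : dot A (- B) = - dot A B.
Proof. by rewrite dotC dotNl dotC. Qed.

Lemma dotBl m n (A B C : 'M[R]_(m, n)) : dot (A - B) C = dot A C - dot B C.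
Proof. by rewrite dotDl dotNl. Qed.

Lemma dotBr m n (A B C : 'M[R]_(m, n)) : dot A (B - C) = dot A B - dot A C.
Proof. by rewrite dotDr dotNr. Qed.

Lemma dot0l m n (A : 'M[R]_(m, n)) : dot 0 A = 0.
Proof. by rewrite -(scale0r 0) dotZl mul0r. Qed.

Lemma dot0r m n (A : 'M[R]_(m, n)) : dot A 0 = 0.
Proof. by rewrite dotC dot0l. Qed.

Lemma dot_tr m n (A B : 'M[R]_(m, n)) : dot A^T B^T = dot A B.
Proof.
rewrite /dot exchange_big; apply: eq_bigr => i _; apply: eq_bigr => j _.
by rewrite !mxE.
Qed.

Lemma dot_mull m n k (A : 'M[R]_(m, n)) (B : 'M[R]_(m, k)) (C : 'M[R]_(k, n)) :
  dot A (B *m C) = dot (B^T *m A) C.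
Proof. by rewrite !dotE trmx_mul trmxK mulmxA. Qed.

Lemma dot_mulr m n k (A : 'M[R]_(m, n)) (B : 'M[R]_(m, k)) (C : 'M[R]_(k, n)) :
  dot A (B *m C) = dot (A *m C^T) B.
Proof. by rewrite -dot_tr trmx_mul dot_mull -dot_tr trmx_mul !trmxK. Qed.

Lemma dot_ge0 m n (A : 'M[R]_(m, n)) : 0 <= dot A A.
Proof.
by apply: sumr_ge0 => i _; apply: sumr_ge0 => j _; rewrite -expr2 sqr_ge0.
Qed.

Lemma frobE m n (A : 'M[R]_(m, n)) : frob A = Num.sqrt (dot A A).
Proof.
by congr Num.sqrt; apply: eq_bigr => i _; apply: eq_bigr => j _; rewrite expr2.
Qed.

Lemma frob_ge0 m n (A : 'M[R]_(m, n)) : 0 <= frob A.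
Proof. by rewrite sqrtr_ge0. Qed.

Lemma frob_sqr m n (A : 'M[R]_(m, n)) : frob A ^+ 2 = dot A A.
Proof. by rewrite frobE sqr_sqrtr ?dot_ge0. Qed.

Lemma frob_sqrE m n (A : 'M[R]_(m, n)) : frob A ^+ 2 = \sum_i \sum_j A i j ^+ 2.
Proof.
by rewrite frob_sqr; apply: eq_bigr => i _; apply: eq_bigr => j _; rewrite expr2.
Qed.

Lemma frob_eq0 m n (A : 'M[R]_(m, n)) : frob A = 0 -> A = 0.
Proof.
move=> A0; apply/matrixP => i j; rewrite mxE.
have : frob A ^+ 2 == 0 by rewrite A0 expr0n.
rewrite frob_sqrE psumr_eq0; last by move=> *; apply: sumr_ge0 => *; rewrite sqr_ge0.
move=> /allP/(_ i); rewrite mem_index_enum => /(_ isT).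
rewrite psumr_eq0; last by move=> *; rewrite sqr_ge0.
move=> /allP/(_ j); rewrite mem_index_enum => /(_ isT).
by rewrite sqrf_eq0 => /eqP.
Qed.

Lemma frob0 m n : frob (0 : 'M[R]_(m, n)) = 0.
Proof. by rewrite frobE dot0l sqrtr0. Qed.

Lemma frobZ m n a (A : 'M[R]_(m, n)) : frob (a *: A) = `|a| * frob A.
Proof.
by rewrite !frobE dotZl dotZr mulrA -expr2 sqrtrM ?sqr_ge0// sqrtr_sqr.
Qed.

Lemma frobN m n (A : 'M[R]_(m, n)) : frob (- A) = frob A.
Proof. by rewrite -scaleN1r frobZ normrN1 mul1r. Qed.

Lemma frob_tr m n (A : 'M[R]_(m, n)) : frob A^T = frob A.
Proof. by rewrite !frobE dot_tr. Qed.

Lemma vnorm2E m (v : 'cV[R]_m) : vnorm2 v = frob v.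
Proof.
by congr Num.sqrt; apply: eq_bigr => i _; rewrite big_ord1.
Qed.

Lemma dot_frob m n (A B : 'M[R]_(m, n)) : dot A B <= frob A * frob B.
Proof.
have [A0|A0] := eqVneq (frob A) 0.
  by rewrite A0 mul0r (frob_eq0 A0) dot0l.
have A_gt0 : 0 < frob A by rewrite lt_neqAle eq_sym A0 frob_ge0.
have [B0|B0] := eqVneq (frob B) 0.
  by rewrite B0 mulr0 (frob_eq0 B0) dot0r.
have B_gt0 : 0 < frob B by rewrite lt_neqAle eq_sym B0 frob_ge0.
have := dot_ge0 (frob B *: A - frob A *: B).
rewrite dotBl !dotBr !dotZl !dotZr -!frob_sqr (dotC B A).
move=> h.
have {}h : 0 <= (frob A * frob B) * (frob A * frob B - dot A B) by nra.
by rewrite pmulr_rge0 ?subr_ge0 ?mulr_gt0 in h.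
Qed.

Lemma normr_dot m n (A B : 'M[R]_(m, n)) : `|dot A B| <= frob A * frob B.
Proof.
rewrite ler_norml dot_frob andbT lerNl -dotNl -(frobN A); exact: dot_frob.
Qed.

Lemma frobD m n (A B : 'M[R]_(m, n)) : frob (A + B) <= frob A + frob B.
Proof.
rewrite -ler_sqr ?nnegrE ?addr_ge0 ?frob_ge0//.
rewrite frob_sqr dotDl !dotDr sqrrD !frob_sqr (dotC B A).
by have := dot_frob A B; lra.
Qed.

Lemma frobB m n (A B : 'M[R]_(m, n)) : frob (A - B) <= frob A + frob B.
Proof. by rewrite -(frobN B) frobD. Qed.

Lemma frob_sqrD m n (A B : 'M[R]_(m, n)) :
  frob (A + B) ^+ 2 <= 2 * frob A ^+ 2 + 2 * frob B ^+ 2.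
Proof.
have := dot_ge0 (A - B); rewrite !frob_sqr !dotBl !dotBr !dotDl !dotDr (dotC B A).
by move=> h; lra.
Qed.

Lemma frob_col m n (A : 'M[R]_(m, n)) : frob A ^+ 2 = \sum_j frob (col j A) ^+ 2.
Proof.
rewrite frob_sqrE exchange_big; apply: eq_bigr => j _; rewrite frob_sqrE.
by apply: eq_bigr => i _; rewrite big_ord1 mxE.
Qed.

Lemma frob_row m n (A : 'M[R]_(m, n)) : frob A ^+ 2 = \sum_i frob (row i A) ^+ 2.
Proof.
rewrite frob_sqrE; apply: eq_bigr => j _; rewrite frob_sqrE.
by rewrite big_ord1; apply: eq_bigr => i _; rewrite mxE.
Qed.

Lemma frob_colE m n (A : 'M[R]_(m, n)) j : frob (col j A) ^+ 2 = \sum_i A i j ^+ 2.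
Proof.
by rewrite frob_sqrE; apply: eq_bigr => i _; rewrite big_ord1 mxE.
Qed.

Lemma frob_rowE m n (A : 'M[R]_(m, n)) i : frob (row i A) ^+ 2 = \sum_j A i j ^+ 2.
Proof.
by rewrite frob_sqrE big_ord1; apply: eq_bigr => j _; rewrite mxE.
Qed.

Lemma frob_col_le m n (A : 'M[R]_(m, n)) j : frob (col j A) <= frob A.
Proof.
rewrite -ler_sqr ?nnegrE ?frob_ge0// (frob_col A) (bigD1 j)//= lerDl.
by apply: sumr_ge0 => *; rewrite sqr_ge0.
Qed.

Lemma frob_row_le m n (A : 'M[R]_(m, n)) i : frob (row i A) <= frob A.
Proof. by rewrite -frob_tr tr_row -(frob_tr A) frob_col_le. Qed.

Lemma frobM m n k (A : 'M[R]_(m, n)) (B : 'M[R]_(n, k)) :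
  frob (A *m B) <= frob A * frob B.
Proof.
rewrite -ler_sqr ?nnegrE ?mulr_ge0 ?frob_ge0// exprMn.
rewrite frob_sqrE (frob_row A) mulr_suml; apply: ler_sum => i _.
rewrite (frob_col B) mulr_sumr; apply: ler_sum => j _.
have -> : (A *m B) i j = dot (row i A)^T (col j B).
  rewrite mxE /dot; apply: eq_bigr => l _.
  by rewrite big_ord1 !mxE.
rewrite -exprMn -(frob_tr (row i A)) -real_normK ?num_real//.
by rewrite ler_sqr ?nnegrE ?mulr_ge0 ?frob_ge0 ?normr_ge0// normr_dot.
Qed.

Lemma frob_orth m n k (Q : 'M[R]_(m, n)) (A : 'M[R]_(n, k)) :
  Q^T *m Q = 1%:M -> frob (Q *m A) = frob A.
Proof. by move=> QQ; rewrite !frobE dot_mull mulmxA QQ mul1mx. Qed.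

(* [t] bounds the operator norm of [X]. *)
Definition opb m n (X : 'M[R]_(m, n)) (t : R) :=
  forall v : 'cV[R]_n, frob (X *m v) <= t * frob v.

Lemma opb_le m n (X : 'M[R]_(m, n)) s t : s <= t -> opb X s -> opb X t.
Proof. by move=> st Xs v; apply: le_trans (Xs v) _; rewrite ler_wpM2r ?frob_ge0. Qed.

Lemma opbD m n (X Y : 'M[R]_(m, n)) s t : opb X s -> opb Y t -> opb (X + Y) (s + t).
Proof.
by move=> Xs Yt v; rewrite mulmxDl mulrDl; apply: le_trans (frobD _ _) (lerD _ _).
Qed.

Lemma opbN m n (X : 'M[R]_(m, n)) s : opb X s -> opb (- X) s.
Proof. by move=> Xs v; rewrite mulNmx frobN. Qed.

Lemma opbM m n k (X : 'M[R]_(m, n)) (Y : 'M[R]_(n, k)) s t :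
  0 <= s -> opb X s -> opb Y t -> opb (X *m Y) (s * t).
Proof.
move=> s0 Xs Yt v; rewrite -mulmxA -mulrA.
by apply: le_trans (Xs _) _; rewrite ler_wpM2l.
Qed.

Lemma opb_frob m n (X : 'M[R]_(m, n)) : opb X (frob X).
Proof. by move=> v; rewrite frobM. Qed.

Lemma opb_mulmx m n k (X : 'M[R]_(m, n)) (Y : 'M[R]_(n, k)) t :
  0 <= t -> opb X t -> frob (X *m Y) <= t * frob Y.
Proof.
move=> t0 Xt; rewrite -ler_sqr ?nnegrE ?mulr_ge0 ?frob_ge0// exprMn.
rewrite frob_col (frob_col Y) mulr_sumr; apply: ler_sum => j _.
rewrite -exprMn ler_sqr ?nnegrE ?mulr_ge0 ?frob_ge0//.
by rewrite colE -mulmxA -colE; apply: Xt.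
Qed.

Lemma opb_tr m n (X : 'M[R]_(m, n)) t : 0 <= t -> opb X t -> opb X^T t.
Proof.
move=> t0 Xt v; have [->|v0] := eqVneq (frob (X^T *m v)) 0.
  by rewrite mulr_ge0 ?frob_ge0.
have w0 : 0 < frob (X^T *m v) by rewrite lt_neqAle eq_sym v0 frob_ge0.
rewrite -(ler_pM2l w0) -expr2 frob_sqr dot_mull trmxK.
apply: le_trans (dot_frob _ _) _.
by rewrite mulrA (mulrC _ t) ler_wpM2r ?frob_ge0.
Qed.

End Frobenius.

(** * Spectral theorem and nuclear norm duality *)

Section Spectral.
Variable R : realType.

(** A complex eigenvector exists by algebraic closedness. Splitting it as v1 + i v2, symmetry of [A]
    gives Im a (|v1|^2 + |v2|^2) = 0, so the eigenvalue is real and whichever of v1, v2 is nonzero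
    is a real eigenvector. *)
Lemma sym_eigenvector n (A : 'M[R]_n.+1) : A^T = A ->
  exists a (v : 'rV[R]_n.+1), v != 0 /\ v *m A = a *: v.
Proof.
move=> symA; pose C := (complex.complex R : numClosedFieldType).
pose AC : 'M[C]_n.+1 := map_mx (complex.real_complex R) A.
have [//|a /eigenvalueP[v vA v0]] := eigenvalue_closed AC.
pose v1 := map_mx (@complex.Re R) v; pose v2 := map_mx (@complex.Im R) v.
have e1 : v1 *m A = complex.Re a *: v1 - complex.Im a *: v2.
  apply/rowP => j; move/rowP/(_ j): vA; rewrite !mxE.
  move=> /(congr1 (@complex.Re R)); rewrite raddf_sum/= => E.
  transitivity (\sum_i complex.Re (v 0 i * AC i j)).
    apply: eq_bigr => i _; rewrite !mxE; case: (v 0 i) => x y /=; ring.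
  by rewrite E; case: (a) => x y; case: (v 0 j).
have e2 : v2 *m A = complex.Re a *: v2 + complex.Im a *: v1.
  apply/rowP => j; move/rowP/(_ j): vA; rewrite !mxE.
  move=> /(congr1 (@complex.Im R)); rewrite raddf_sum/= => E.
  transitivity (\sum_i complex.Im (v 0 i * AC i j)).
    apply: eq_bigr => i _; rewrite !mxE; case: (v 0 i) => x y /=; ring.
  by rewrite E; case: (a) => x y; case: (v 0 j).
have v12 : v1 != 0 \/ v2 != 0.
  apply/orP; rewrite -negb_and; apply: contra v0 => /andP[/eqP v10 /eqP v20].
  apply/eqP/rowP => j; move/rowP/(_ j): v10; move/rowP/(_ j): v20; rewrite !mxE.
  by case: (v 0 j) => x y /= -> ->.
have E : dot (v1 *m A) v2 = dot v1 (v2 *m A).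
  by rewrite dot_mulr symA.
rewrite e1 e2 dotBl dotDr !dotZl !dotZr -!frob_sqr in E.
have ima0 : complex.Im a = 0.
  have h : complex.Im a * (frob v1 ^+ 2 + frob v2 ^+ 2) = 0 by lra.
  move/eqP: h; rewrite mulf_eq0 => /orP[/eqP //|].
  rewrite paddr_eq0 ?sqr_ge0// !sqrf_eq0 => /andP[/eqP/frob_eq0 h1 /eqP/frob_eq0 h2].
  by case: v12; rewrite ?h1 ?h2 eqxx.
rewrite ima0 !scale0r subr0 addr0 in e1 e2.
by case: v12 => ?; [exists (complex.Re a), v1|exists (complex.Re a), v2].
Qed.

(** H is the Householder reflection along v - e, which exchanges v and the first basis vector e; it
    degenerates for v = e, where the identity is taken. *)
Lemma orthogonal_first_row n (v : 'rV[R]_n.+1) : frob v = 1 ->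
  exists H : 'M[R]_n.+1, [/\ H^T = H, H *m H = 1%:M & row 0 H = v].
Proof.
move=> v1; pose e : 'rV[R]_n.+1 := delta_mx 0 0.
have e1 : dot e e = 1.
  rewrite /dot big_ord1 (bigD1 0)//= big1 ?addr0.
    by rewrite !mxE mulr1.
  by move=> i i0; rewrite !mxE (negPf i0) mul0r.
have dv : dot v v = 1 by rewrite -frob_sqr v1 expr1n.
have [->|ve] := eqVneq v e.
  exists 1%:M; rewrite trmx1 mulmx1; split => //.
  by rewrite row1.
pose w := v - e; pose c := dot w w.
have cE : c = 2 - 2 * dot v e by rewrite /c /w dotBl !dotBr e1 dv (dotC e); ring.
have c0 : c != 0.
  apply: contra ve => /eqP c0; rewrite -subr_eq0; apply/eqP/frob_eq0.
  by rewrite frobE -/w -/c c0 sqrtr0.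
have ww : w *m w^T = c%:M.
  apply/matrixP => i j; rewrite !ord1 !mxE /= /c /dot big_ord1 mulr1n.
  by apply: eq_bigr => k _; rewrite !mxE.
pose H : 'M[R]_n.+1 := 1%:M - (2 / c) *: (w^T *m w).
exists H; split.
- by rewrite /H linearB/= linearZ/= trmx1 trmx_mul trmxK.
- have PP : (w^T *m w) *m (w^T *m w) = c *: (w^T *m w).
    by rewrite mulmxA -(mulmxA _ w) ww mul_mx_scalar -scalemxAl.
  rewrite /H; move: (w^T *m w) PP => P PP.
  rewrite mulmxBl !mulmxBr !mul1mx !mulmx1 -!scalemxAl -!scalemxAr PP !scalerA.
  have -> : 2 / c * (2 / c) * c = 2 / c + 2 / c by field.
  by apply/matrixP => i j; rewrite !mxE; ring.
- rewrite rowE -/e /H mulmxBr mulmx1 -scalemxAr mulmxA.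
  have -> : e *m w^T = (dot v e - 1)%:M.
    apply/matrixP => i j; rewrite !ord1 !mxE /= mulr1n.
    rewrite (_ : dot v e - 1 = dot e w); last by rewrite /w dotBr e1 dotC.
    rewrite /dot big_ord1.
    by apply: eq_bigr => k _; rewrite !mxE.
  rewrite mul_scalar_mx scalerA.
  have -> : 2 / c * (dot v e - 1) = -1.
    have -> : dot v e - 1 = - c / 2 by rewrite cE; field.
    by field.
  by rewrite scaleN1r opprK /w addrCA subrr addr0.
Qed.

(** Deflation: reflecting a unit eigenvector to the first basis vector clears the first row of H A H
    off the diagonal, hence by symmetry the first column, and induction treats the lower right
    block. *)
Lemma sym_spectral n (A : 'M[R]_n) : A^T = A ->
  exists (Q : 'M[R]_n) (d : 'rV[R]_n),
    [/\ Q^T *m Q = 1%:M, Q *m Q^T = 1%:M & A = Q *m diag_mx d *m Q^T].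
Proof.
elim: n A => [|n IH] A symA.
  by exists 1%:M, 0; split; apply/matrixP => -[].
have [a [v [v0 vA]]] := sym_eigenvector symA.
have fv0 : frob v != 0 by apply: contra v0 => /eqP/frob_eq0 ->.
pose u := (frob v)^-1 *: v.
have u1 : frob u = 1.
  by rewrite /u frobZ ger0_norm ?invr_ge0 ?frob_ge0// mulVf.
have uA : u *m A = a *: u by rewrite /u -scalemxAl vA !scalerA mulrC.
have [H [symH HH rowH]] := orthogonal_first_row u1.
pose B : 'M[R]_(1 + n) := H *m A *m H.
have symB : B^T = B by rewrite /B !trmx_mul symH symA mulmxA.
have rowB : row 0 B = a *: row 0 1%:M.
  rewrite /B !row_mul rowH uA -scalemxAl -rowH rowE -mulmxA HH.
  by rewrite -rowE.
have B00 : ulsubmx B = a%:M.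
  apply/matrixP => i j; rewrite !ord1; move/rowP/(_ 0): rowB; rewrite !mxE /= mulr1.
  by rewrite mulr1n !lshift0.
have B01 : ursubmx B = 0.
  apply/matrixP => i j; rewrite !ord1; move/rowP/(_ (rshift 1 j)): rowB.
  rewrite !mxE /= mulr0 lshift0 //.
have B10 : dlsubmx B = 0.
  by rewrite -symB -[dlsubmx _]trmxK trmx_dlsub trmxK B01 trmx0.
have [Q' [d' [QQ1 QQ2 dE]]] := IH (drsubmx B) ltac:(by rewrite trmx_drsub symB).
pose Q0 : 'M[R]_(1 + n) := block_mx 1%:M 0 0 Q'.
have Q0T : Q0^T = block_mx 1%:M 0 0 Q'^T by rewrite tr_block_mx !trmx0 trmx1.
have BE : B = Q0 *m diag_mx (row_mx a%:M d') *m Q0^T.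
  rewrite -[LHS]submxK B00 B01 B10 dE Q0T diag_mx_row /Q0 !mulmx_block.
  rewrite !(mul0mx, mulmx0, mul1mx, mulmx1, addr0, add0r).
  congr block_mx; apply/matrixP => i j.
  by rewrite !ord1 !mxE.
have Q01 : Q0^T *m Q0 = 1%:M.
  rewrite Q0T /Q0 mulmx_block.
  by rewrite !(mul0mx, mulmx0, mul1mx, mulmx1, addr0, add0r) QQ1 -scalar_mx_block.
have Q02 : Q0 *m Q0^T = 1%:M.
  rewrite Q0T /Q0 mulmx_block.
  by rewrite !(mul0mx, mulmx0, mul1mx, mulmx1, addr0, add0r) QQ2 -scalar_mx_block.
exists (H *m Q0), (row_mx a%:M d'); split.
- by rewrite trmx_mul symH mulmxA -(mulmxA _ H H) HH mulmx1 Q01.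
- by rewrite trmx_mul symH mulmxA -(mulmxA H Q0) Q02 mulmx1.
- rewrite trmx_mul symH.
  have -> : A = H *m B *m H by rewrite /B !mulmxA HH mul1mx -mulmxA HH mulmx1.
  by rewrite BE !mulmxA.
Qed.

End Spectral.

(** * The nuclear norm as dual of the operator norm *)

Section Nuclear.
Variable R : realType.

Lemma dot_orth m n k (Q : 'M[R]_(n, k)) (A B : 'M[R]_(m, n)) :
  Q *m Q^T = 1%:M -> dot (A *m Q) (B *m Q) = dot A B.
Proof. by move=> QQ; rewrite dot_mulr -mulmxA QQ mulmx1. Qed.

Lemma dot_cols m n (A B : 'M[R]_(m, n)) :
  dot A B = \sum_j dot (col j A) (col j B).
Proof.
rewrite /dot exchange_big; apply: eq_bigr => j _; apply: eq_bigr => i _.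
by rewrite big_ord1 !mxE.
Qed.

Lemma orth_col_frob n (Q : 'M[R]_n) k : Q^T *m Q = 1%:M -> frob (col k Q) = 1.
Proof.
move=> QQ; apply/eqP; rewrite -(@eqrXn2 _ 2) ?frob_ge0// expr1n frob_colE.
move/matrixP/(_ k k): QQ; rewrite !mxE eqxx mulr1n => <-.
by apply/eqP; apply: eq_bigr => i _; rewrite mxE expr2.
Qed.

Lemma char_poly_orth n (Q A : 'M[R]_n) :
  Q *m Q^T = 1%:M -> char_poly (Q *m A *m Q^T) = char_poly A.
Proof.
move=> QQ; rewrite /char_poly.
have QQp : map_mx polyC Q *m map_mx polyC Q^T = 1%:M.
  by rewrite -map_mxM QQ map_mx1.
have -> : char_poly_mx (Q *m A *m Q^T) =
    map_mx polyC Q *m char_poly_mx A *m map_mx polyC Q^T.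
  rewrite /char_poly_mx mulmxBr mulmxBl !map_mxM; congr (_ - _).
  by rewrite mul_mx_scalar -scalemxAl QQp scalemx1.
by rewrite !det_mulmx mulrAC -det_mulmx QQp det1 mul1r.
Qed.

(** Diagonalizing X^T X by Q makes the columns of X Q orthogonal with the singular values as norms,
    so a sum of column norms replaces a full singular value decomposition. The sequence chosen in
    [sq_singvals] is a permutation of [d] because a product of linear factors determines its
    roots. *)
Lemma nuc_spec n (X : 'M[R]_n) : exists (Q : 'M[R]_n) (d : 'rV[R]_n),
  [/\ Q^T *m Q = 1%:M, Q *m Q^T = 1%:M, X^T *m X = Q *m diag_mx d *m Q^T,
      forall k, d 0 k = frob (col k (X *m Q)) ^+ 2 &
      nuc_norm X = \sum_k frob (col k (X *m Q))].
Proof.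
have [|Q [d [Q1 Q2 XX]]] := @sym_spectral R n (X^T *m X).
  by rewrite trmx_mul trmxK.
exists Q, d.
have dE k : d 0 k = frob (col k (X *m Q)) ^+ 2.
  have : (X *m Q)^T *m (X *m Q) = diag_mx d.
    rewrite trmx_mul mulmxA -(mulmxA _ _ X) XX !mulmxA Q1 mul1mx -mulmxA Q1.
    by rewrite mulmx1.
  move/matrixP/(_ k k); rewrite frob_colE !mxE eqxx mulr1n => <-.
  by apply: eq_bigr => i _; rewrite !mxE expr2.
split => //.
have spec : sq_singvals_spec X (codom (d 0)).
  split; first by rewrite size_codom card_ord.
  rewrite XX char_poly_orth// char_poly_trig; last first.
    apply/is_trig_mxP => i j ij; rewrite mxE; case: eqP => // e.
    by rewrite e ltnn in ij.
  rewrite codomE big_map big_enum /=; apply: eq_bigr => i _.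
  by rewrite mxE eqxx mulr1n.
rewrite /nuc_norm /sq_singvals; case: pselect => [h|[]]; last by exists (codom (d 0)).
have [_ hs] := projT2 (cid h); case: spec => _; rewrite hs => /prod_XsubC_eq hp.
rewrite (perm_big _ hp) /= codomE big_map big_enum /=; apply: eq_bigr => i _.
by rewrite dE sqrtr_sqr ger0_norm ?frob_ge0.
Qed.

Lemma nuc_norm_ge0 n (X : 'M[R]_n) : 0 <= nuc_norm X.
Proof.
have [Q [d [_ _ _ _ ->]]] := nuc_spec X.
by apply: sumr_ge0 => k _; rewrite frob_ge0.
Qed.

Lemma nuc_norm_eq0 n (X : 'M[R]_n) : nuc_norm X = 0 -> X = 0.
Proof.
have [Q [d [_ Q2 _ _ ->]]] := nuc_spec X.
move=> /eqP; rewrite psumr_eq0; last by move=> *; exact: frob_ge0.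
move=> /allP h; have XQ : X *m Q = 0.
  apply/matrixP => i k; have /(_ (mem_index_enum _))/eqP/frob_eq0 := h k.
  by move/colP/(_ i); rewrite !mxE.
by rewrite -[X]mulmx1 -Q2 mulmxA XQ mul0mx.
Qed.

Lemma dot_nuc_norm n (W X : 'M[R]_n) t : 0 <= t -> opb W t ->
  dot W X <= t * nuc_norm X.
Proof.
have [Q [d [Q1 Q2 _ _ ->]]] := nuc_spec X.
move=> t0 Wt; rewrite -(dot_orth _ _ Q2) dot_cols mulr_sumr; apply: ler_sum => k _.
apply: le_trans (dot_frob _ _) _; rewrite ler_wpM2r ?frob_ge0//.
rewrite colE -mulmxA -colE; apply: le_trans (Wt _) _.
by rewrite orth_col_frob// mulr1.
Qed.

(** W is the partial isometry in the polar decomposition of X. The last two clauses pass on to W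
    every left and right annihilator of X; applied to P_{T^perp}(Z) they give U^T W = 0 and W V = 0,
    as needed for a subgradient at X^*. *)
Lemma nuc_norm_attained n (X : 'M[R]_n) : exists W : 'M[R]_n,
  [/\ opb W 1, dot W X = nuc_norm X,
    forall m (P : 'M[R]_(m, n)), P *m X = 0 -> P *m W = 0 &
    forall m (P : 'M[R]_(n, m)), X *m P = 0 -> W *m P = 0].
Proof.
have [Q [d [Q1 Q2 XX dE ->]]] := nuc_spec X.
(* Zero singular values get coefficient 0, since the inverse of 0 is 0. *)
pose e : 'rV[R]_n := \row_k (frob (col k (X *m Q)))^-1.
exists (X *m Q *m diag_mx e *m Q^T); split.
- move=> v; rewrite mul1r -[leRHS](frob_orth _ (Q := Q^T)) ?trmxK//.
  rewrite -!mulmxA; move: (Q^T *m v) => z.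
  rewrite -ler_sqr ?nnegrE ?frob_ge0// frob_sqr dot_mull !mulmxA XX.
  rewrite -!mulmxA (dot_mull _ Q) (mulmxA Q^T Q) Q1 mul1mx (mulmxA Q^T Q) Q1 mul1mx.
  rewrite frob_sqrE /dot.
  apply: ler_sum => k _; rewrite !big_ord1.
  rewrite !mul_diag_mx !mxE dE.
  have [->|f0] := eqVneq (frob (col k (X *m Q))) 0.
    by rewrite expr0n /= mul0r mul0r sqr_ge0.
  by rewrite le_eqVlt; apply/orP; left; apply/eqP; field.
- rewrite dotC dot_mulr trmxK dot_cols.
  rewrite mul_mx_diag; apply: eq_bigr => k _.
  set c := col k (X *m Q).
  have -> : col k (\matrix_(i, j) ((X *m Q) i j * e 0 j)) = (frob c)^-1 *: c.
    by apply/colP => i; rewrite !mxE mulrC.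
  rewrite dotZr -frob_sqr.
  have [->|f0] := eqVneq (frob c) 0; first by rewrite expr0n /= mulr0.
  by field.
- by move=> m P PX; rewrite !mulmxA PX !mul0mx.
- move=> m P XP; rewrite -!mulmxA.
  suff -> : diag_mx e *m (Q^T *m P) = 0 by rewrite !mulmx0.
  have : diag_mx d *m (Q^T *m P) = 0.
    have : X^T *m X *m P = 0 by rewrite -mulmxA XP mulmx0.
    rewrite XX => /(congr1 (mulmx Q^T)); rewrite !mulmxA Q1 mul1mx mulmx0.
    by rewrite -mulmxA.
  rewrite !mul_diag_mx => h; apply/matrixP => i j; move/matrixP/(_ i j): h.
  rewrite !mxE dE => /eqP; rewrite mulf_eq0 sqrf_eq0 => /orP[/eqP->|/eqP->].
    by rewrite invr0 mul0r.
  by rewrite mulr0.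
Qed.

End Nuclear.

(** * Product Bernoulli measures *)

Section Bernoulli.
Variables (R : realType) (I : finType).
Implicit Types (p : I -> R) (d : {ffun I -> bool}).

Definition bern (x : R) (b : bool) : R := if b then x else 1 - x.

Definition Ex p (f : {ffun I -> bool} -> R) : R :=
  \sum_(d : {ffun I -> bool}) (\prod_i bern (p i) (d i)) * f d.

Definition Pr p (E : {ffun I -> bool} -> Prop) : R :=
  \sum_(d : {ffun I -> bool} | `[< E d >]) \prod_i bern (p i) (d i).

Definition isprob p := forall i, 0 <= p i <= 1.

Lemma sum_bern x : \sum_b bern x b = 1.
Proof. by rewrite big_bool /=; ring. Qed.

Lemma Ex_prod p (g : I -> bool -> R) :
  Ex p (fun d => \prod_i g i (d i)) = \prod_i \sum_b bern (p i) b * g i b.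
Proof.
by rewrite bigA_distr_bigA; apply: eq_bigr => d _; rewrite big_split.
Qed.

Lemma Ex_cst p c : Ex p (fun=> c) = c.
Proof.
rewrite /Ex -mulr_suml -(bigA_distr_bigA (fun i b => bern (p i) b)).
by rewrite big1 ?mul1r// => i _; rewrite sum_bern.
Qed.

Lemma ExD p f g : Ex p (fun d => f d + g d) = Ex p f + Ex p g.
Proof. by rewrite /Ex -big_split; apply: eq_bigr => d _; rewrite mulrDr. Qed.

Lemma ExZ p c f : Ex p (fun d => c * f d) = c * Ex p f.
Proof. by rewrite /Ex mulr_sumr; apply: eq_bigr => d _; rewrite mulrCA. Qed.

Lemma Ex_sum p (J : finType) (P : pred J) (f : J -> {ffun I -> bool} -> R) :
  Ex p (fun d => \sum_(j | P j) f j d) = \sum_(j | P j) Ex p (f j).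
Proof. by rewrite /Ex exchange_big; apply: eq_bigr => d _; rewrite mulr_sumr. Qed.

Lemma eq_Ex p f g : f =1 g -> Ex p f = Ex p g.
Proof. by move=> fg; apply: eq_bigr => d _; rewrite fg. Qed.

Lemma le_Ex p f g : isprob p -> (forall d, f d <= g d) -> Ex p f <= Ex p g.
Proof.
move=> pP fg; apply: ler_sum => d _; apply: ler_wpM2l => //.
by apply: prodr_ge0 => i _; rewrite /bern; have := pP i; case: ifP => _ /andP[]; lra.
Qed.

Lemma PrE p (E : {ffun I -> bool} -> Prop) :
  Pr p E = Ex p (fun d => (`[< E d >])%:R).
Proof.
rewrite /Pr big_mkcond; apply: eq_bigr => d _.
by case: ifP; rewrite ?mulr1 ?mulr0.
Qed.

Lemma le_Pr p (E F : {ffun I -> bool} -> Prop) : isprob p ->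
  (forall d, E d -> F d) -> Pr p E <= Pr p F.
Proof.
move=> pP EF; rewrite !PrE; apply: le_Ex => // d; rewrite ler_nat.
by case: asboolP => // /EF h; case: asboolP.
Qed.

Lemma Pr_le1 p (E : {ffun I -> bool} -> Prop) : isprob p -> Pr p E <= 1.
Proof.
move=> pP; rewrite PrE -[leRHS](Ex_cst p); apply: le_Ex => // d.
by case: asboolP => _; [exact: lexx|exact: ler01].
Qed.

Lemma Pr_or p (E F : {ffun I -> bool} -> Prop) : isprob p ->
  Pr p (fun d => E d \/ F d) <= Pr p E + Pr p F.
Proof.
move=> pP; rewrite !PrE -ExD; apply: le_Ex => // d.
by case: asboolP => [[h|h]|_]; rewrite ?addr_ge0 ?ler0n//;
  do ![case: asboolP => //= _]; rewrite ?addr0 ?add0r ?lexx ?lerDl.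
Qed.

Lemma Pr_exists p (J : finType) (E : J -> {ffun I -> bool} -> Prop) : isprob p ->
  Pr p (fun d => exists j, E j d) <= \sum_j Pr p (E j).
Proof.
move=> pP; rewrite PrE; under eq_bigr do rewrite PrE.
rewrite -Ex_sum; apply: le_Ex => // d.
case: asboolP => [[j h]|_]; last by apply: sumr_ge0 => *; rewrite ler0n.
by rewrite (bigD1 j)//= asboolT// lerDl; apply: sumr_ge0 => *; rewrite ler0n.
Qed.

Lemma Pr_markov p (E : {ffun I -> bool} -> Prop) f t : isprob p -> 0 < t ->
  (forall d, 0 <= f d) -> (forall d, E d -> t <= f d) -> Pr p E <= Ex p f / t.
Proof.
move=> pP t0 f0 Ef; rewrite ler_pdivlMr// mulrC PrE -ExZ; apply: le_Ex => // d.
by case: asboolP => [/Ef|_]; rewrite ?mulr1 ?mulr0.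
Qed.

Lemma Ex_coord p (k : I) (g : bool -> R) :
  Ex p (fun d => g (d k)) = p k * g true + (1 - p k) * g false.
Proof.
transitivity (Ex p (fun d => \prod_i (if i == k then g (d i) else 1))).
  apply: eq_Ex => d; rewrite (bigD1 k)//= eqxx big1 ?mulr1// => i /negPf -> //.
rewrite (Ex_prod p (fun i b => if i == k then g b else 1)) (bigD1 k)//= [X in _ * X]big1 ?mulr1.
  by rewrite eqxx big_bool.
by move=> i /negPf ->; under eq_bigr do rewrite mulr1; rewrite sum_bern.
Qed.

(* Independent samples combined coordinatewise give again an independent sample; used
   with disjunction (splitting a sample) and with selection (resampling a block). *)
Lemma Ex_comb p p1 p2 (c : I -> bool -> bool -> bool) f :
  (forall i b, bern (p i) b =
     \sum_b1 \sum_b2 (c i b1 b2 == b)%:R * (bern (p1 i) b1 * bern (p2 i) b2)) ->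
  Ex p f = Ex p1 (fun d1 => Ex p2 (fun d2 => f [ffun i => c i (d1 i) (d2 i)])).
Proof.
move=> hp; rewrite {1}/Ex.
transitivity (\sum_(d : {ffun I -> bool})
    \sum_(d1 : {ffun I -> bool}) \sum_(d2 : {ffun I -> bool})
    (\prod_i ((c i (d1 i) (d2 i) == d i)%:R *
    (bern (p1 i) (d1 i) * bern (p2 i) (d2 i)))) * f d).
  apply: eq_bigr => d _; under eq_bigr do rewrite hp.
  rewrite bigA_distr_bigA mulr_suml; apply: eq_bigr => d1 _.
  by rewrite bigA_distr_bigA mulr_suml.
rewrite exchange_big; apply: eq_bigr => d1 _.
rewrite exchange_big mulr_sumr; apply: eq_bigr => d2 _.
rewrite (bigD1 [ffun i => c i (d1 i) (d2 i)])//= [X in _ + X]big1 ?addr0.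
  rewrite [RHS]mulrA -big_split; congr (_ * _); apply: eq_bigr => i _.
  by rewrite ffunE eqxx mul1r.
move=> d dd; rewrite big_split /=.
have /existsP[i hi] : [exists i, c i (d1 i) (d2 i) != d i].
  rewrite -negb_forall; apply: contra dd => /forallP h.
  by apply/eqP/ffunP => i; rewrite ffunE; apply/esym/eqP.
by rewrite (bigD1 i)//= (negPf hi) !mul0r.
Qed.

Definition unionf d1 d2 : {ffun I -> bool} := [ffun i => d1 i || d2 i].

Lemma Ex_union p p1 p2 f : (forall i, 1 - p i = (1 - p1 i) * (1 - p2 i)) ->
  Ex p f = Ex p1 (fun d1 => Ex p2 (fun d2 => f (unionf d1 d2))).
Proof.
move=> hp; apply: (Ex_comb (c := fun _ => orb)) => i b.
by have := hp i; rewrite !big_bool /bern; case: b => /=; lra.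
Qed.

Definition mergef (S : pred I) d1 d2 : {ffun I -> bool} :=
  [ffun i => if S i then d2 i else d1 i].

Lemma Ex_merge p S f :
  Ex p f = Ex p (fun d1 => Ex p (fun d2 => f (mergef S d1 d2))).
Proof.
apply: (Ex_comb (c := fun i b1 b2 => if S i then b2 else b1)) => i b.
by rewrite !big_bool /bern; case: (S i); case: b => /=; lra.
Qed.

Definition setf d (k : I) (b : bool) : {ffun I -> bool} :=
  [ffun i => if i == k then b else d i].

(** The outer expectation still draws [d k], but the integrand on the right no longer reads it. *)
Lemma Ex_setf p k f :
  Ex p f = Ex p (fun d => p k * f (setf d k true) + (1 - p k) * f (setf d k false)).
Proof.
rewrite (Ex_merge _ (pred1 k)); apply: eq_Ex => d1.
rewrite -(Ex_coord p k (fun b => f (setf d1 k b))); apply: eq_Ex => d2; congr f.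
by apply/ffunP => i; rewrite !ffunE /=; case: eqP => // ->.
Qed.

(** [phi] reads only coordinates outside [S] and [B x] only those inside, so resampling [S] leaves
    [phi] fixed and the bound for a constant [x] applies. In use, [phi] is a leave-one-out solution
    and [S] the discarded row. *)
Lemma Pr_indep p (T : Type) (S : pred I) (phi : {ffun I -> bool} -> T)
    (B : T -> {ffun I -> bool} -> Prop) (c : R) : isprob p ->
  (forall d d', (forall i, ~~ S i -> d i = d' i) -> phi d = phi d') ->
  (forall x d d', (forall i, S i -> d i = d' i) -> B x d -> B x d') ->
  (forall x, Pr p (B x) <= c) ->
  Pr p (fun d => B (phi d) d) <= c.
Proof.
move=> pP hphi hB hc; rewrite PrE (Ex_merge _ S) -[leRHS](Ex_cst p).
apply: le_Ex => // d1; apply: le_trans (hc (phi d1)); rewrite PrE.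
apply: le_Ex => // d2; rewrite ler_nat.
have -> : phi (mergef S d1 d2) = phi d1.
  by apply: hphi => i /negPf Si; rewrite ffunE Si.
case: asboolP => // h; case: asboolP => // -[].
by apply: hB h => i Si; rewrite ffunE Si.
Qed.

(** This is the probabilistic shape of a golfing step: outside the bad event [A] the first subsample
    is frozen, and [E] becomes an event about the second one. *)
Lemma Pr_union p p1 p2 (A E : {ffun I -> bool} -> Prop) (c1 c2 : R) :
  isprob p1 -> isprob p2 -> 0 <= c2 ->
  (forall i, 1 - p i = (1 - p1 i) * (1 - p2 i)) ->
  Pr p1 A <= c1 ->
  (forall d1, ~ A d1 -> Pr p2 (fun d2 => E (unionf d1 d2)) <= c2) ->
  Pr p E <= c1 + c2.
Proof.
move=> p1P p2P c20 hp hA hE; rewrite PrE (Ex_union _ hp).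
apply: (@le_trans _ _ (Pr p1 A + c2)); last by rewrite lerD2r.
rewrite PrE -(Ex_cst p1 c2) -ExD; apply: le_Ex => // d1; rewrite -PrE.
case: (asboolP (A d1)) => [_|/hE]; last by rewrite add0r.
by apply: le_trans (Pr_le1 _ p2P) _; rewrite lerDl.
Qed.

End Bernoulli.

(** With the swap of the two indices as [h], probability bounds for rows become bounds for
    columns. *)
Lemma Pr_reindex (R : realType) (I J : finType) (h : J -> I) (p : I -> R)
    (E : {ffun J -> bool} -> Prop) : bijective h ->
  Pr p (fun d => E [ffun j => d (h j)]) = Pr (fun j => p (h j)) E.
Proof.
move=> [g hK gK]; rewrite /Pr.
have bij : bijective (fun d : {ffun I -> bool} => [ffun j => d (h j)]).
  exists (fun d : {ffun J -> bool} => [ffun i => d (g i)]) => d; apply/ffunP => i.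
    by rewrite !ffunE gK.
  by rewrite !ffunE hK.
rewrite [RHS](reindex _ (onW_bij _ bij)) /=; apply: eq_bigr => d _.
rewrite (reindex h) /=; last by exists g => i _; rewrite ?hK ?gK.
by apply: eq_bigr => j _; rewrite ffunE.
Qed.

(** * Matrix Bernstein inequality *)

Section TracePowers.
Variable R : realType.

Lemma expr_spectral n (Q : 'M[R]_n) (d : 'rV[R]_n) i : Q^T *m Q = 1%:M ->
  Q *m Q^T = 1%:M ->
  (Q *m diag_mx d *m Q^T) ^+ i = Q *m diag_mx (\row_k d 0 k ^+ i) *m Q^T.
Proof.
move=> Q1 Q2; elim: i => [|i IH].
  rewrite expr0 (_ : diag_mx _ = 1%:M) ?mulmx1 ?Q2//.
  by apply/matrixP => k l; rewrite !mxE expr0.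
rewrite exprS IH -mulmxE !mulmxA -(mulmxA _ Q^T Q) Q1 mulmx1; congr (_ *m _).
rewrite -mulmxA; congr (_ *m _); rewrite mul_diag_mx.
apply/matrixP => k l; rewrite !mxE; case: eqP => [->|_].
  by rewrite !mulr1n exprS.
by rewrite !mulr0n mulr0.
Qed.

(** The weights are the same for all exponents and nonnegative, so an inequality between linear
    combinations of such traces follows from the scalar inequality, although A and B need not
    commute. *)
Lemma trace_expr2 n (A B : 'M[R]_n) : A^T = A -> B^T = B ->
  exists (a b : 'I_n -> R) (w : 'I_n -> 'I_n -> R), (forall k l, 0 <= w k l) /\
  forall i j, \tr (A ^+ i *m B ^+ j) = \sum_k \sum_l w k l * (a k ^+ i * b l ^+ j).
Proof.
move=> /sym_spectral[P [a [P1 P2 ->]]] /sym_spectral[Q [b [Q1 Q2 ->]]].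
exists (a 0), (b 0), (fun k l => (P^T *m Q) k l ^+ 2); split.
  by move=> k l; rewrite sqr_ge0.
move=> i j; rewrite !expr_spectral//; set O := P^T *m Q.
have -> : P *m diag_mx (\row_k a 0 k ^+ i) *m P^T *m
    (Q *m diag_mx (\row_k b 0 k ^+ j) *m Q^T) =
    P *m (diag_mx (\row_k a 0 k ^+ i) *m O *m diag_mx (\row_k b 0 k ^+ j) *m Q^T).
  by rewrite /O !mulmxA.
rewrite mxtrace_mulC -(mulmxA _ Q^T P) (_ : Q^T *m P = O^T); last by rewrite trmx_mul trmxK.
apply: eq_bigr => k _; rewrite mxE; apply: eq_bigr => l _.
by rewrite mul_mx_diag mul_diag_mx !mxE; ring.
Qed.

Lemma ler_exp_mul (x y : R) q i : (i <= q.*2)%N ->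
  x ^+ (q.*2 - i) * y ^+ i <= x ^+ q.*2 + y ^+ q.*2.
Proof.
move=> iq; apply: le_trans (ler_norm _) _; rewrite normrM !normrX.
have xE (z : R) : z ^+ q.*2 = `|z| ^+ q.*2 by rewrite -normrX ger0_norm// exprn_even_ge0// odd_double.
rewrite (xE x) (xE y); move: `|x| `|y| (normr_ge0 x) (normr_ge0 y) => a b a0 b0.
have [ab|/ltW ba] := leP a b.
  apply: le_trans (_ : b ^+ (q.*2 - i) * b ^+ i <= _).
    by rewrite ler_wpM2r ?exprn_ge0// lerXn2r.
  by rewrite -exprD subnK// lerDr exprn_ge0.
apply: le_trans (_ : a ^+ (q.*2 - i) * a ^+ i <= _).
  by rewrite ler_wpM2l ?exprn_ge0// lerXn2r.
by rewrite -exprD subnK// lerDl exprn_ge0.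
Qed.

Lemma mean_value_expr (x y : R) q :
  (x - y) * (x ^+ q.*2.+1 - y ^+ q.*2.+1) <=
  q.*2.+1%:R * ((x - y) ^+ 2 * (x ^+ q.*2 + y ^+ q.*2)).
Proof.
rewrite subrXX [leLHS]mulrA -[X in X * _]expr2 [leRHS]mulrCA ler_wpM2l ?sqr_ge0//.
apply: le_trans (_ : \sum_(i < q.*2.+1) (x ^+ q.*2 + y ^+ q.*2) <= _).
  by apply: ler_sum => i _; rewrite /= ?subSS ler_exp_mul// -ltnS.
by rewrite sumr_const card_ord mulr_natl.
Qed.

(* In eigenbases of [A] and [B] this is the scalar [mean_value_expr], weighted by
   squared inner products of eigenvectors. *)
Lemma mean_value_trace n (A B : 'M[R]_n) q : A^T = A -> B^T = B ->
  \tr ((A - B) *m (A ^+ q.*2.+1 - B ^+ q.*2.+1)) <=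
  q.*2.+1%:R * (\tr ((A - B) *m (A - B) *m A ^+ q.*2) +
                \tr ((A - B) *m (A - B) *m B ^+ q.*2)).
Proof.
move=> sA sB; have [a [b [w [w0 wE]]]] := trace_expr2 sA sB.
set m := q.*2.
have AX i : A *m A ^+ i = A ^+ i.+1 by rewrite mulmxE -exprS.
have XA i : A ^+ i *m A = A ^+ i.+1 by rewrite mulmxE -exprSr.
have BX i : B *m B ^+ i = B ^+ i.+1 by rewrite mulmxE -exprS.
have XB i : B ^+ i *m B = B ^+ i.+1 by rewrite mulmxE -exprSr.
have e1 : \tr ((A - B) *m (A ^+ m.+1 - B ^+ m.+1)) =
    \tr (A ^+ m.+2 *m B ^+ 0) - \tr (A ^+ 1 *m B ^+ m.+1)
    - \tr (A ^+ m.+1 *m B ^+ 1) + \tr (A ^+ 0 *m B ^+ m.+2).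
  rewrite mulmxBl !mulmxBr !raddfB /= AX BX (mxtrace_mulC B).
  by rewrite !expr0 !expr1 mulmx1 mul1mx; ring.
have e2 : \tr ((A - B) *m (A - B) *m A ^+ m) =
    \tr (A ^+ m.+2 *m B ^+ 0) - \tr (A ^+ m.+1 *m B ^+ 1) *+ 2
    + \tr (A ^+ m *m B ^+ 2).
  rewrite !mulmxBl !mulmxBr !mulmxBl !raddfB /= -!mulmxA !AX (mxtrace_mulC A (B *m _)).
  rewrite (mxtrace_mulC B (A ^+ _)) -mulmxA XA (mxtrace_mulC B (A ^+ _)).
  rewrite (mxtrace_mulC B (B *m _)) -mulmxA (mxtrace_mulC B) -mulmxA.
  by rewrite (expr0 B) mulmx1 (expr1 B) (_ : B ^+ 2 = B *m B) ?mulmxE ?expr2//; ring.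
have e3 : \tr ((A - B) *m (A - B) *m B ^+ m) =
    \tr (A ^+ 2 *m B ^+ m) - \tr (A ^+ 1 *m B ^+ m.+1) *+ 2
    + \tr (A ^+ 0 *m B ^+ m.+2).
  rewrite !mulmxBl !mulmxBr !mulmxBl !raddfB /= -!mulmxA !BX.
  rewrite (mxtrace_mulC B (A *m _)) -mulmxA XB.
  by rewrite (expr0 A) mul1mx (expr1 A); ring.
pose S (F : 'I_n -> 'I_n -> R) := \sum_k \sum_l w k l * F k l.
have SD F G : S F + S G = S (fun k l => F k l + G k l).
  rewrite /S -big_split; apply: eq_bigr => k _; rewrite -big_split.
  by apply: eq_bigr => l _; rewrite mulrDr.
have SZ c F : c * S F = S (fun k l => c * F k l).
  rewrite /S mulr_sumr; apply: eq_bigr => k _; rewrite mulr_sumr.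
  by apply: eq_bigr => l _; rewrite mulrCA.
have SN F : - S F = S (fun k l => - F k l).
  by rewrite -mulN1r SZ; apply: eq_bigr => k _; apply: eq_bigr => l _; rewrite mulN1r.
have wS i j : \tr (A ^+ i *m B ^+ j) = S (fun k l => a k ^+ i * b l ^+ j) by rewrite wE.
rewrite e1 e2 e3 !wS !mulr2n !(SD, SN, SZ).
apply: ler_sum => k _; apply: ler_sum => l _; rewrite ler_wpM2l//.
have := mean_value_expr (a k) (b l) q; rewrite -/m !exprS !expr0; lra.
Qed.

End TracePowers.

Section BernoulliSeries.
Variables (R : realType) (I : finType) (p : I -> R).
Hypothesis p01 : forall k, 0 < p k <= 1.

Lemma p01_isprob : isprob p.
Proof. by move=> k; have /andP[/ltW -> ->] := p01 k. Qed.

Definition bsum m n (H : I -> 'M[R]_(m, n)) (d : {ffun I -> bool}) : 'M[R]_(m, n) :=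
  \sum_k ((d k)%:R / p k - 1) *: H k.

Variables (n : nat) (H : I -> 'M[R]_n).
Hypothesis symH : forall k, (H k)^T = H k.

Lemma tr_expr (A : 'M[R]_n) i : A^T = A -> (A ^+ i)^T = A ^+ i.
Proof.
move=> sA; elim: i => [|i IH]; first by rewrite expr0 trmx1.
by rewrite exprS -mulmxE trmx_mul sA IH !mulmxE -exprSr exprS.
Qed.

Lemma bsum_sym (H' : I -> 'M[R]_n) d : (forall k, (H' k)^T = H' k) -> (bsum H' d)^T = bsum H' d.
Proof.
by move=> sH; rewrite /bsum raddf_sum; apply: eq_bigr => k _; rewrite /= linearZ /= sH.
Qed.

Lemma trace_frob_expr (A S : 'M[R]_n) q : A^T = A -> S^T = S ->
  \tr (A *m A *m S ^+ q.*2) = frob (A *m S ^+ q) ^+ 2.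
Proof.
move=> sA sS; rewrite frob_sqr dotE trmx_mul tr_expr// sA -addnn exprD -mulmxE.
by rewrite !mulmxA mxtrace_mulC !mulmxA.
Qed.

Lemma bsum_setf d k : bsum H (setf d k true) - bsum H (setf d k false) = (p k)^-1 *: H k.
Proof.
rewrite /bsum (bigD1 k)//= [X in _ - X](bigD1 k)//= !ffunE eqxx.
rewrite (eq_bigr (fun i => ((setf d k false i)%:R / p i - 1) *: H i)); last first.
  by move=> i /negPf ik; rewrite !ffunE ik.
by rewrite opprD addrACA subrr addr0 -scalerBl; congr (_ *: _); rewrite mul0r mul1r; ring.
Qed.

(* Averaging over coordinate [k] replaces [X^(2q+1)] by the difference of its values at
   [d k = 1] and [d k = 0], which [mean_value_trace] bounds by even powers. *)
Lemma moment_step q :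
  Ex p (fun d => \tr (bsum H d ^+ q.*2.+2)) <=
  q.*2.+1%:R * Ex p (fun d => \sum_k ((d k)%:R / p k ^+ 2 + (p k)^-1)
    * frob (H k *m bsum H d ^+ q) ^+ 2).
Proof.
rewrite (@eq_Ex _ _ _ _ (fun d => \sum_k ((d k)%:R / p k - 1)
    * \tr (H k *m bsum H d ^+ q.*2.+1))); last first.
  move=> d; rewrite exprS -mulmxE {1}/bsum mulmx_suml raddf_sum /=.
  by apply: eq_bigr => k _; rewrite -scalemxAl linearZ.
rewrite !Ex_sum mulr_sumr; apply: ler_sum => k _.
rewrite -ExZ (Ex_setf _ k) [leRHS](Ex_setf _ k); apply: le_Ex => [|d]; first exact: p01_isprob.
rewrite !ffunE eqxx.
have sS b : (bsum H (setf d k b))^T = bsum H (setf d k b) by exact: bsum_sym.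
have := mean_value_trace q (sS true) (sS false).
rewrite bsum_setf -!scalemxAl -!scalemxAr -!scalemxAl !scalerA !mxtraceZ.
rewrite mulmxBr raddfB /= !trace_frob_expr//.
move: (bsum H _) (bsum H _) => SM SP.
move: (\tr _) (\tr _) => b a; set T1 := frob _ ^+ 2; set T2 := frob _ ^+ 2.
have T10 : 0 <= T1 by rewrite sqr_ge0.
have /andP[p0 p1] := p01 k; have pN0 : p k != 0 by rewrite gt_eqF.
set m : R := q.*2.+1%:R; have m0 : 0 <= m by rewrite ler0n.
move=> h.
have {}h : a - b <= m * ((p k)^-1 * (T1 + T2)).
  rewrite -(ler_pM2l (x := (p k)^-1)) ?invr_gt0//; apply: le_trans h _.
  by rewrite le_eqVlt; apply/orP; left; apply/eqP; ring.
rewrite -subr_ge0.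
(* The left side averages to (1 - p k) (a - b). The surplus 2 m T1 is there because the weight 1/p^2
   + 1/p at [d k = 1] exceeds the sufficient 1/p^2 - 1/p; the larger weight makes [variance_split]
   simple. *)
rewrite [leRHS](_ : _ = (1 - p k) * (m * ((p k)^-1 * (T1 + T2)) - (a - b)) + 2 * (m * T1)).
  by apply: addr_ge0; apply: mulr_ge0; rewrite ?subr_ge0 ?ler0n//; exact: mulr_ge0.
by rewrite mul1r mul0r; field.
Qed.

Let H2 k := (p k)^-1 *: (H k *m H k).

Lemma symH2 k : (H2 k)^T = H2 k.
Proof. by rewrite /H2 linearZ /= trmx_mul symH. Qed.

(** The weight is d/p^2 + 1/p = ((d/p - 1) + 2) / p: a centred part, which is a series of the same
    kind with the matrices [H2], and a constant part. *)
Lemma variance_split (d : {ffun I -> bool}) (Y : 'M[R]_n) :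
  \sum_k ((d k)%:R / p k ^+ 2 + (p k)^-1) * frob (H k *m Y) ^+ 2 =
  \tr (bsum H2 d *m (Y *m Y^T)) + 2 * \sum_k frob (H k *m Y) ^+ 2 / p k.
Proof.
rewrite /bsum mulmx_suml raddf_sum /= mulr_sumr -big_split; apply: eq_bigr => k _ /=.
have /andP[p0 _] := p01 k; have pN0 : p k != 0 by rewrite gt_eqF.
rewrite -scalemxAl mxtraceZ /H2 -scalemxAl mxtraceZ.
have -> : \tr (H k *m H k *m (Y *m Y^T)) = frob (H k *m Y) ^+ 2.
  by rewrite frob_sqr dotE trmx_mul symH !mulmxA mxtrace_mulC !mulmxA.
by field.
Qed.

End BernoulliSeries.

(** * Scalar inequalities that absorb lower moments into the top one *)

Section ScalarInequalities.
Variable R : realType.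
Implicit Types (x y c m : R).

(** If 4 c <= x^2 the first term on the right suffices, otherwise the second does. The factor 1/4
    lets two such terms be absorbed by half of the top moment. *)
Lemma young_even c x q : 0 <= c ->
  c * x ^+ q.*2 <= 1/4 * x ^+ q.*2.+2 + 1/4 * (4 * c) ^+ q.+1.
Proof.
move=> c0; have -> : x ^+ q.*2.+2 = x ^+ 2 * x ^+ q.*2 by rewrite -exprD.
have xE : x ^+ q.*2 = (x ^+ 2) ^+ q by rewrite -exprM mul2n.
rewrite xE; move: (x ^+ 2) (sqr_ge0 x) => z z0.
have zq : 0 <= z ^+ q by rewrite exprn_ge0.
have [cz|zc] := leP (4 * c) z.
  have : 0 <= (4 * c) ^+ q.+1 by rewrite exprn_ge0// mulr_ge0.
  have : (4 * c) * z ^+ q <= z * z ^+ q by rewrite ler_wpM2r.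
  by lra.
have : z ^+ q <= (4 * c) ^+ q by rewrite lerXn2r ?nnegrE ?mulr_ge0// ltW.
have : 0 <= z * z ^+ q by rewrite mulr_ge0.
move=> h1 h2; have h3 : c * z ^+ q <= c * (4 * c) ^+ q by rewrite ler_wpM2l.
rewrite exprS; lra.
Qed.

Lemma young_odd c x q : 0 <= c ->
  c * x ^+ q.*2.+1 <= 1/4 * x ^+ q.*2.+2 + 1/4 * (4 * c) ^+ q.*2.+2.
Proof.
move=> c0; have -> : x ^+ q.*2.+2 = `|x| * `|x| ^+ q.*2.+1.
  by rewrite -exprS -normrX ger0_norm// exprn_even_ge0//= odd_double.
have [xc|cx] := leP (4 * c) `|x|.
  have : 0 <= (4 * c) ^+ q.*2.+2 by rewrite exprn_ge0// mulr_ge0.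
  have : (4 * c) * `|x| ^+ q.*2.+1 <= `|x| * `|x| ^+ q.*2.+1 by rewrite ler_wpM2r ?exprn_ge0.
  have : c * x ^+ q.*2.+1 <= c * `|x| ^+ q.*2.+1 by rewrite ler_wpM2l// -normrX ler_norm.
  by lra.
have : c * x ^+ q.*2.+1 <= c * `|x| ^+ q.*2.+1 by rewrite ler_wpM2l// -normrX ler_norm.
have h : `|x| ^+ q.*2.+1 <= (4 * c) ^+ q.*2.+1 by rewrite lerXn2r ?nnegrE ?mulr_ge0// ltW.
have : c * `|x| ^+ q.*2.+1 <= c * (4 * c) ^+ q.*2.+1 by rewrite ler_wpM2l.
have : 0 <= `|x| * `|x| ^+ q.*2.+1 by rewrite -exprS exprn_ge0.
by rewrite (exprS (4 * c) q.*2.+1); lra.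
Qed.

(** Arithmetic-geometric mean at scale m. It replaces a power of |y| of either parity by an even
    power, which is what a trace moment controls. *)
Lemma normr_exp_split m y s : 0 < m ->
  `|y| ^+ s <= 1/2 * m ^+ s + 1/2 * (y ^+ s.*2 / m ^+ s).
Proof.
move=> m0; have -> : y ^+ s.*2 = `|y| ^+ s * `|y| ^+ s.
  by rewrite -exprD addnn -normrX ger0_norm// exprn_even_ge0// odd_double.
have M0 : 0 < m ^+ s by rewrite exprn_gt0.
move: (`|y| ^+ s) => a; rewrite -(ler_pM2r M0).
rewrite [leRHS](_ : _ = 1/2 * (m ^+ s * m ^+ s) + 1/2 * (a * a)); last first.
  by field; rewrite gt_eqF.
by have := sqr_ge0 (a - m ^+ s); rewrite expr2; lra.
Qed.

Lemma exprD_ge (x y : R) s : 0 <= x -> 0 <= y -> x ^+ s.+1 + y ^+ s.+1 <= (x + y) ^+ s.+1.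
Proof.
move=> x0 y0; rewrite !exprS [leRHS]mulrDl; apply: lerD; rewrite ler_wpM2l//.
  by rewrite lerXn2r ?nnegrE ?addr_ge0// lerDl.
by rewrite lerXn2r ?nnegrE ?addr_ge0// lerDr.
Qed.

End ScalarInequalities.

Ltac nonneg := repeat first
  [ done | exact: ler0n | exact: sqr_ge0 | exact: frob_ge0 | exact: sqrtr_ge0
  | exact: normr_ge0 | apply: ltW; done | rewrite invr_ge0 | apply: exprn_ge0
  | apply: addr_ge0 | apply: mulr_ge0 ].

(** * Trace moments of a centred matrix series *)

Section Moments.
Variables (R : realType) (I : finType) (p : I -> R).
Hypothesis p01 : forall k, 0 < p k <= 1.
Variables (n : nat) (H : I -> 'M[R]_n) (B s2 : R).
Hypothesis symH : forall k, (H k)^T = H k.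
Hypothesis B_gt0 : 0 < B.
Hypothesis s2_ge0 : 0 <= s2.
Hypothesis boundH : forall k, opb (H k) (B * p k).
Hypothesis varH : forall v : 'cV[R]_n, \sum_k frob (H k *m v) ^+ 2 / p k <= s2 * frob v ^+ 2.

Let H2 k := (p k)^-1 *: (H k *m H k).
Let X2 := bsum p H2.
Let X := bsum p H.

Let p0 k : 0 < p k. Proof. by have /andP[] := p01 k. Qed.
Let pP := p01_isprob p01.

Let symX2 d : (X2 d)^T = X2 d.
Proof. by apply: bsum_sym => k; apply: symH2. Qed.

Let symX d : (X d)^T = X d.
Proof. exact: bsum_sym. Qed.

Lemma var_mx m (Y : 'M[R]_(n, m)) : \sum_k frob (H k *m Y) ^+ 2 / p k <= s2 * frob Y ^+ 2.
Proof.
rewrite (eq_bigr (fun k => \sum_j frob (H k *m col j Y) ^+ 2 / p k)); last first.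
  move=> k _; rewrite frob_col mulr_suml; apply: eq_bigr => j _.
  by rewrite !colE mulmxA.
by rewrite exchange_big (frob_col Y) mulr_sumr; apply: ler_sum => j _; apply: varH.
Qed.

(** One of the two factors [H k] costs B p, and this p cancels the normalization 1/p of [H2 k]. *)
Lemma square_step m (Y : 'M[R]_(n, m)) k : frob (H2 k *m Y) ^+ 2 <= B ^+ 2 * frob (H k *m Y) ^+ 2.
Proof.
have pN0 : p k != 0 by rewrite gt_eqF.
rewrite -exprMn ler_sqr ?nnegrE ?mulr_ge0 ?frob_ge0 ?(ltW B_gt0)//.
rewrite /H2 -scalemxAl -mulmxA frobZ ger0_norm ?invr_ge0 ?(ltW (p0 _))//.
rewrite mulrC ler_pdivrMr// mulrAC; apply: opb_mulmx => //.
by rewrite mulr_ge0// ltW.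
Qed.

Lemma variance_le (d : {ffun I -> bool}) (Y : 'M[R]_n) : Y^T = Y ->
  \sum_k ((d k)%:R / p k ^+ 2 + (p k)^-1) * frob (H k *m Y) ^+ 2 <=
  \tr (X2 d *m (Y *m Y)) + 2 * s2 * frob Y ^+ 2.
Proof.
move=> sY; rewrite variance_split// sY lerD2l -mulrA ler_wpM2l ?ler0n//.
exact: var_mx.
Qed.

Lemma trace_expr (A : 'M[R]_n) : A^T = A -> exists (a : 'I_n -> R) (w : 'I_n -> R),
  (forall k, 0 <= w k) /\ forall i, \tr (A ^+ i) = \sum_k w k * a k ^+ i.
Proof.
move=> sA; have [a [b [w [w0 wE]]]] := trace_expr2 sA sA.
exists a, (fun k => \sum_l w k l); split; first by move=> k; apply: sumr_ge0.
move=> i; have := wE i 0%N; rewrite expr0 mulmx1 => ->; apply: eq_bigr => k _.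
by rewrite mulr_suml; apply: eq_bigr => l _; rewrite expr0 mulr1.
Qed.

Lemma trace_young (A : 'M[R]_n) c c' q : A^T = A -> 0 <= c -> 0 <= c' ->
  c * \tr (A ^+ q.*2.+1) + c' * \tr (A ^+ q.*2) <=
  1/2 * \tr (A ^+ q.*2.+2) + 1/4 * n%:R * ((4 * c) ^+ q.*2.+2 + (4 * c') ^+ q.+1).
Proof.
move=> sA c0 c'0; have [a [w [w0 wE]]] := trace_expr sA.
have -> : n%:R = \sum_k w k * a k ^+ 0 :> R by rewrite -wE expr0 mxtrace1.
rewrite !wE (mulrC (1/4)) -(mulrA _ (1/4)) mulr_suml !mulr_sumr -!big_split /=.
apply: ler_sum => k _.
have := young_odd (a k) q c0; have := young_even (a k) q c'0.
have := w0 k; rewrite expr0 mulr1.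
set x1 := a k ^+ q.*2.+1; set x2 := a k ^+ q.*2; set x3 := a k ^+ q.*2.+2.
set x4 := (4 * c) ^+ _; set x5 := (4 * c') ^+ _ => h1 h2 h3.
have : 0 <= w k * (1 / 2 * x3 + 1 / 4 * (x4 + x5) - c' * x2 - c * x1).
  by rewrite mulr_ge0//; lra.
lra.
Qed.

(* [H2 k] is positive semidefinite with norm at most [B ^+ 2], so the quadratic term of
   [moment_step] for [X2] is bounded by [X2] itself and the recursion closes. *)
Lemma psd_moment q : Ex p (fun d => \tr (X2 d ^+ q.*2.+2)) <=
  n%:R * (8 * q.+1%:R * B ^+ 2 + s2) ^+ q.*2.+2.
Proof.
have := moment_step p01 (fun k => symH2 p symH k) q; rewrite -/H2 -/X2.
set M := Ex p _; set m : R := q.*2.+1%:R => h.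
have m0 : 0 <= m by rewrite ler0n.
have mq : m <= 2 * q.+1%:R by rewrite -natrM ler_nat; lia.
have B20 : 0 <= B ^+ 2 by rewrite sqr_ge0.
set c := m * B ^+ 2; have c0 : 0 <= c by rewrite mulr_ge0.
have {}h : M <= Ex p (fun d => c * \tr (X2 d ^+ q.*2.+1) + (c * (2 * s2)) * \tr (X2 d ^+ q.*2)).
  apply: le_trans h _; rewrite -ExZ; apply: le_Ex => // d.
  rewrite -!(mulrA m) -mulrDr ler_wpM2l//.
  apply: le_trans (_ : B ^+ 2 * (\sum_k ((d k)%:R / p k ^+ 2 + (p k)^-1)
     * frob (H k *m X2 d ^+ q) ^+ 2) <= _).
    rewrite mulr_sumr; apply: ler_sum => k _; rewrite [leRHS]mulrCA ler_wpM2l ?square_step//.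
    by rewrite addr_ge0 ?invr_ge0 ?(ltW (p0 k))// divr_ge0 ?ler0n ?sqr_ge0.
  rewrite -(mulrA (B ^+ 2)) -mulrDr ler_wpM2l//; apply: le_trans (variance_le _ _) _.
    exact: tr_expr.
  rewrite frob_sqr dotE tr_expr// !mulmxE -exprD addnn -exprS; lra.
have {}h : M <= 1/2 * M + 1/4 * n%:R * ((4 * c) ^+ q.*2.+2 + (4 * (c * (2 * s2))) ^+ q.+1).
  apply: le_trans h _; rewrite /M -ExZ -[X in _ + X](Ex_cst p) -ExD.
  apply: le_Ex => // d; apply: trace_young => //.
  by rewrite mulr_ge0// mulr_ge0.
set Z := 8 * q.+1%:R * B ^+ 2 + s2.
have cZ : 4 * c <= 8 * q.+1%:R * B ^+ 2 by rewrite /c; have := ler_wpM2r B20 mq; lra.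
have Z0 : 0 <= Z by rewrite addr_ge0// mulr_ge0// mulr_ge0// ler0n.
have h1 : (4 * c) ^+ q.*2.+2 <= Z ^+ q.*2.+2.
  have cZ' : 4 * c <= Z by apply: le_trans cZ _; rewrite lerDl.
  by rewrite lerXn2r ?nnegrE// mulr_ge0.
have h2 : (4 * (c * (2 * s2))) ^+ q.+1 <= Z ^+ q.*2.+2.
  have -> : Z ^+ q.*2.+2 = (Z ^+ 2) ^+ q.+1 by rewrite -exprM mul2n.
  have c20 : 0 <= 4 * (c * (2 * s2)) by do 3![apply: mulr_ge0 => //].
  rewrite lerXn2r ?nnegrE ?sqr_ge0//.
  apply: (@le_trans _ _ (2 * s2 * (8 * q.+1%:R * B ^+ 2))).
    by have := ler_wpM2l s2_ge0 cZ; lra.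
  by rewrite /Z; have := sqr_ge0 (8 * q.+1%:R * B ^+ 2 - s2);
    have := sqr_ge0 s2; have := sqr_ge0 (8 * q.+1%:R * B ^+ 2); rewrite !expr2; lra.
have : n%:R * ((4 * c) ^+ q.*2.+2 + (4 * (c * (2 * s2))) ^+ q.+1) <= n%:R * (Z ^+ q.*2.+2 + Z ^+ q.*2.+2).
  by rewrite ler_wpM2l ?ler0n// lerD.
lra.
Qed.

(** The recursion leaves tr(X2 X^(2q)). In eigenbases of X2 and X, Young's inequality splits off
    X^(2q+2), and the remaining power |a|^(q+1) of an eigenvalue of X2 is turned by
    [normr_exp_split] at scale Z into a^(2q+2), whose mean [psd_moment] bounds. The two summands of
    the result are the two regimes of Bernstein's inequality. *)
Lemma moment_bound q : Ex p (fun d => \tr (X d ^+ q.*2.+2)) <=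
  n%:R * (64 * (q.+1%:R ^+ 2 * B ^+ 2 + q.+1%:R * s2)) ^+ q.+1.
Proof.
have := moment_step p01 symH q; rewrite -/X.
set M := Ex p _; set m : R := q.*2.+1%:R => h.
have m0 : 0 < m by rewrite ltr0n.
have mq : m <= 2 * q.+1%:R by rewrite -natrM ler_nat; lia.
have B20 : 0 < B ^+ 2 by rewrite exprn_gt0.
set Z := 8 * q.+1%:R * B ^+ 2 + s2.
have Z0 : 0 < Z by rewrite ltr_wpDr// !mulr_gt0 ?ltr0n.
pose D := fun d => 1/2 * \tr (X d ^+ q.*2.+2) + 1/8 * (4 * m) ^+ q.+1 *
    (n%:R * Z ^+ q.+1 + \tr (X2 d ^+ q.*2.+2) / Z ^+ q.+1) + 1/4 * n%:R * (4 * (m * (2 * s2))) ^+ q.+1.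
have {}h : M <= Ex p D.
  apply: le_trans h _; rewrite -ExZ; apply: le_Ex => // d.
  apply: le_trans (_ : m * (\tr (X2 d *m X d ^+ q.*2) + 2 * s2 * \tr (X d ^+ q.*2)) <= _).
    rewrite ler_wpM2l ?(ltW m0)//; apply: le_trans (variance_le _ _) _.
      exact: tr_expr.
    have -> : X d ^+ q *m X d ^+ q = X d ^+ q.*2 by rewrite mulmxE -exprD addnn.
    have -> // : frob (X d ^+ q) ^+ 2 = \tr (X d ^+ q.*2).
    by rewrite frob_sqr dotE tr_expr// mulmxE -exprD addnn.
  have [a [b [w [w0 wE]]]] := trace_expr2 (symX2 d) (symX d).
  have nE : n%:R = \sum_k \sum_l w k l * (a k ^+ 0 * b l ^+ 0).
    by rewrite -wE !expr0 mulmx1 mxtrace1.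
  have aE i : \tr (X2 d ^+ i) = \sum_k \sum_l w k l * (a k ^+ i * b l ^+ 0).
    by rewrite -wE expr0 mulmx1.
  have bE i : \tr (X d ^+ i) = \sum_k \sum_l w k l * (a k ^+ 0 * b l ^+ i).
    by rewrite -wE expr0 mul1mx.
  have abE : \tr (X2 d *m X d ^+ q.*2) = \sum_k \sum_l w k l * (a k ^+ 1 * b l ^+ q.*2).
    by rewrite -wE expr1.
  rewrite /D nE aE !bE abE.
  pose S (F : 'I_n -> 'I_n -> R) := \sum_k \sum_l w k l * F k l.
  have SD F G : S F + S G = S (fun k l => F k l + G k l).
    rewrite /S -big_split; apply: eq_bigr => k _; rewrite -big_split.
    by apply: eq_bigr => l _; rewrite mulrDr.
  have SZ c F : c * S F = S (fun k l => c * F k l).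
    rewrite /S mulr_sumr; apply: eq_bigr => k _; rewrite mulr_sumr.
    by apply: eq_bigr => l _; rewrite mulrCA.
  rewrite (mulrC _ (Z ^+ q.+1)) (mulrC _ (Z ^+ q.+1)^-1) (mulrC (1/4)) -(mulrA _ (1/4)).
  rewrite (mulrC _ (1/4 * _)).
  rewrite -!/(S (fun _ _ => _)) !(SD, SZ).
  apply: ler_sum => k _; apply: ler_sum => l _; rewrite ler_wpM2l// !expr0 expr1 !mulr1 !mul1r.
  have e1 := young_even (b l) q (mulr_ge0 (ltW m0) (normr_ge0 (a k))).
  have e2 := young_even (b l) q (mulr_ge0 (ltW m0) (mulr_ge0 (ler0n R 2) s2_ge0)).
  have e3 := normr_exp_split (a k) q.+1 Z0.
  have e4 : m * (a k * b l ^+ q.*2) <= m * `|a k| * b l ^+ q.*2.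
    rewrite -mulrA ler_wpM2l ?(ltW m0)// ler_wpM2r ?ler_norm//.
    by rewrite exprn_even_ge0// odd_double.
  have e5 : (4 * (m * `|a k|)) ^+ q.+1 = (4 * m) ^+ q.+1 * `|a k| ^+ q.+1.
    by rewrite mulrA exprMn.
  rewrite e5 in e1.
  have {}e3 := ler_wpM2l (exprn_ge0 q.+1 (mulr_ge0 (ler0n R 4) (ltW m0))) e3.
  rewrite doubleS in e3.
  set x5 := (Z ^+ q.+1)^-1 in e3 *.
  lra.
have {}h : M <= 1/2 * M + 1/4 * n%:R * ((4 * m * Z) ^+ q.+1 + (4 * (m * (2 * s2))) ^+ q.+1).
  apply: le_trans h _; rewrite /D !ExD ExZ -/M Ex_cst ExZ ExD Ex_cst.
  rewrite (@eq_Ex _ _ _ (fun d => _ / _) (fun d => (Z ^+ q.+1)^-1 * \tr (X2 d ^+ q.*2.+2))); last first.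
    by move=> d; rewrite mulrC.
  rewrite ExZ; have := psd_moment q; rewrite -/Z; set M2 := Ex p _ => h2.
  have Zq : 0 < Z ^+ q.+1 by rewrite exprn_gt0.
  have {}h2 : (Z ^+ q.+1)^-1 * M2 <= n%:R * Z ^+ q.+1.
    rewrite mulrC ler_pdivrMr//; apply: le_trans h2 _.
    by rewrite -doubleS -addnn exprD mulrA.
  have h3 : 0 <= (4 * m) ^+ q.+1 by rewrite exprn_ge0// mulr_ge0// ltW.
  have := ler_wpM2l h3 h2; rewrite (exprMn _ (4 * m) Z).
  set x5 := (Z ^+ q.+1)^-1; lra.
have {}h : M <= n%:R * (4 * m * Z + 4 * (m * (2 * s2))) ^+ q.+1.
  have := @exprD_ge R (4 * m * Z) (4 * (m * (2 * s2))) q.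
  rewrite !mulr_ge0 ?(ltW m0) ?(ltW Z0) ?mulr_ge0// => /(_ isT isT) h2.
  have h3 : 0 <= (4 * m * Z + 4 * (m * (2 * s2))) ^+ q.+1.
    by rewrite exprn_ge0// addr_ge0// !mulr_ge0 ?(ltW m0) ?(ltW Z0) ?mulr_ge0.
  have := ler_wpM2l (ler0n R n) h2; have := mulr_ge0 (ler0n R n) h3.
  lra.
apply: le_trans h _; rewrite ler_wpM2l ?ler0n// lerXn2r ?nnegrE//.
- by rewrite addr_ge0// !mulr_ge0 ?(ltW m0) ?(ltW Z0) ?mulr_ge0.
- by nonneg.
have h1 : m * (Z + 2 * s2) <= 2 * q.+1%:R * (Z + 2 * s2).
  by rewrite ler_wpM2r// addr_ge0 ?(ltW Z0)// mulr_ge0.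
have h2 : 0 <= q.+1%:R * s2 by rewrite mulr_ge0.
by rewrite /Z in h1 *; rewrite expr2; lra.
Qed.

(** Markov's inequality for the trace of X^(2q+2), which dominates this power of each eigenvalue.
    The constant 128 is twice the 64 of [moment_bound], whence the factor 2^-(q+1). *)
Lemma bernstein_sym q (t : R) : 0 < t ->
  128 * (q.+1%:R ^+ 2 * B ^+ 2 + q.+1%:R * s2) <= t ^+ 2 ->
  Pr p (fun d => ~ opb (X d) t) <= n%:R * 2 ^- q.+1.
Proof.
move=> t0 ht; have t20 : 0 < t ^+ 2 by rewrite exprn_gt0.
apply: le_trans (@Pr_markov _ _ _ _ (fun d => \tr (X d ^+ q.*2.+2)) ((t ^+ 2) ^+ q.+1) _ _ _ _) _ => //.
- by rewrite exprn_gt0.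
- move=> d; have [a [w [w0 ->]]] := trace_expr (symX d).
  apply: sumr_ge0 => k _; rewrite mulr_ge0// exprn_even_ge0//=.
  by rewrite odd_double.
- move=> d Xd; have [Q [a [Q1 Q2 XE]]] := sym_spectral (symX d).
  have [k ak] : exists k, t ^+ 2 < a 0 k ^+ 2.
    apply: contrapT => h; apply: Xd => v.
    have {}h k : a 0 k ^+ 2 <= t ^+ 2 by rewrite leNgt; apply/negP => ?; apply: h; exists k.
    rewrite XE -!mulmxA frob_orth// -[frob v](@frob_orth _ _ _ _ Q^T) ?trmxK//.
    move: (Q^T *m v) => z; rewrite -ler_sqr ?nnegrE ?mulr_ge0 ?frob_ge0 ?(ltW t0)//.
    rewrite exprMn !frob_sqrE mulr_sumr; apply: ler_sum => k _; rewrite !big_ord1.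
    by rewrite mul_diag_mx mxE exprMn ler_wpM2r ?sqr_ge0.
  have -> : \tr (X d ^+ q.*2.+2) = \sum_k a 0 k ^+ q.*2.+2.
    rewrite {1}XE expr_spectral// mxtrace_mulC mulmxA Q1 mul1mx mxtrace_diag.
    by apply: eq_bigr => i _; rewrite mxE.
  rewrite (bigD1 k)//= -[leLHS]addr0; apply: lerD.
    rewrite -doubleS -mul2n exprM lerXn2r ?nnegrE ?sqr_ge0 //; exact: ltW.
  by apply: sumr_ge0 => i _; rewrite exprn_even_ge0//= odd_double.
rewrite ler_pdivrMr ?exprn_gt0//; apply: le_trans (moment_bound q) _.
rewrite -[leRHS]mulrA ler_wpM2l ?ler0n// -exprVn -[leRHS]exprMn.
have hle : 64 * (q.+1%:R ^+ 2 * B ^+ 2 + q.+1%:R * s2) <= 2^-1 * t ^+ 2 by lra.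
by rewrite lerXn2r ?nnegrE//; nonneg.
Qed.

End Moments.

(** * Rectangular, vector and operator forms of the Bernstein inequality *)

Section Bernstein.
Variables (R : realType) (I : finType) (p : I -> R).
Hypothesis p01 : forall k, 0 < p k <= 1.

Lemma frob_col_mx m n k (a : 'M[R]_(m, k)) (b : 'M[R]_(n, k)) :
  frob (col_mx a b) ^+ 2 = frob a ^+ 2 + frob b ^+ 2.
Proof.
rewrite !frob_sqrE big_split_ord; congr (_ + _); apply: eq_bigr => i _;
  by apply: eq_bigr => j _; rewrite ?col_mxEu ?col_mxEd.
Qed.

(** Symmetric dilation: X is placed off the diagonal of a symmetric block matrix, whose action on
    vectors (0, v) is that of X. *)
Lemma bernstein m n (X : I -> 'M[R]_(m, n)) (B s2 : R) q (t : R) :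
  0 < B -> 0 <= s2 -> (forall k, opb (X k) (B * p k)) ->
  (forall v : 'cV_n, \sum_k frob (X k *m v) ^+ 2 / p k <= s2 * frob v ^+ 2) ->
  (forall v : 'cV_m, \sum_k frob ((X k)^T *m v) ^+ 2 / p k <= s2 * frob v ^+ 2) ->
  0 < t -> 128 * (q.+1%:R ^+ 2 * B ^+ 2 + q.+1%:R * s2) <= t ^+ 2 ->
  Pr p (fun d => ~ opb (bsum p X d) t) <= (m + n)%:R * 2 ^- q.+1.
Proof.
move=> B0 s20 hB hv hvt t0 ht.
pose H k : 'M[R]_(m + n) := block_mx 0 (X k) (X k)^T 0.
have HE k (a : 'cV_m) (b : 'cV_n) : H k *m col_mx a b = col_mx (X k *m b) ((X k)^T *m a).
  by rewrite mul_block_col !mul0mx addr0 add0r.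
have Bp k : 0 <= B * p k by rewrite mulr_ge0 ?(ltW B0)//; have /andP[/ltW] := p01 k.
have symH k : (H k)^T = H k by rewrite tr_block_mx !trmx0 trmxK.
have hH k : opb (H k) (B * p k).
  move=> v; rewrite -[v]vsubmxK HE -ler_sqr ?nnegrE ?frob_ge0//; last first.
    by rewrite mulr_ge0// frob_ge0.
  rewrite exprMn !frob_col_mx addrC mulrDr -!exprMn; apply: lerD.
    rewrite ler_sqr ?nnegrE ?(mulr_ge0 (Bp _)) ?frob_ge0//.
    exact: (opb_tr (Bp k) (hB k)).
  by rewrite ler_sqr ?nnegrE ?(mulr_ge0 (Bp _)) ?frob_ge0//; apply: hB.
have hs (v : 'cV_(m + n)) : \sum_k frob (H k *m v) ^+ 2 / p k <= s2 * frob v ^+ 2.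
  rewrite -[v]vsubmxK frob_col_mx mulrDr addrC.
  under eq_bigr do rewrite HE frob_col_mx mulrDl.
  by rewrite big_split lerD.
apply: le_trans (bernstein_sym p01 symH B0 s20 hH hs t0 ht).
apply: le_Pr => [|d hd hH']; first exact: p01_isprob.
apply: hd => v; have := hH' (col_mx 0 v).
have -> : bsum p H d *m col_mx 0 v = col_mx (bsum p X d *m v) 0.
  rewrite /bsum !mulmx_suml.
  transitivity (\sum_k col_mx ((((d k)%:R / p k - 1) *: X k) *m v) (0 : 'cV[R]_n)).
    by apply: eq_bigr => k _; rewrite -!scalemxAl HE mulmx0 scale_col_mx scaler0.
  elim/big_rec2: _ => [|k x y _ ->]; first by rewrite col_mx0.
  by rewrite add_col_mx addr0.
have E0 k (a : 'M[R]_(k, 1)) : a = 0 -> frob a ^+ 2 = 0 by move=> ->; rewrite frob0 expr0n.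
rewrite -ler_sqr ?nnegrE ?frob_ge0//; last by rewrite mulr_ge0 ?frob_ge0// ltW.
rewrite exprMn !frob_col_mx (E0 _ 0)// (E0 _ 0)// addr0 add0r -exprMn ler_sqr ?nnegrE ?frob_ge0//.
by rewrite mulr_ge0 ?frob_ge0// ltW.
Qed.

Lemma opb_cV m (x : 'cV[R]_m) : opb x (frob x).
Proof. exact: opb_frob. Qed.

Lemma bernstein_vec m (x : I -> 'cV[R]_m) (B s2 : R) q (t : R) :
  0 < B -> (forall k, frob (x k) <= B * p k) ->
  \sum_k frob (x k) ^+ 2 / p k <= s2 ->
  0 < t -> 128 * (q.+1%:R ^+ 2 * B ^+ 2 + q.+1%:R * s2) <= t ^+ 2 ->
  Pr p (fun d => ~ (frob (bsum p x d) <= t)) <= m.+1%:R * 2 ^- q.+1.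
Proof.
move=> B0 hB hs t0 ht.
have p0 k : 0 < p k by have /andP[] := p01 k.
have s20 : 0 <= s2.
  by apply: le_trans hs; apply: sumr_ge0 => k _; rewrite divr_ge0 ?sqr_ge0// ltW.
have hM k a b (Y : 'M[R]_(a, b)) (v : 'cV_b) : frob Y = frob (x k) ->
    frob (Y *m v) ^+ 2 / p k <= frob (x k) ^+ 2 / p k * frob v ^+ 2.
  move=> e; rewrite [leRHS]mulrAC ler_wpM2r ?invr_ge0 ?(ltW (p0 k))// -exprMn.
  by rewrite ler_sqr ?nnegrE ?mulr_ge0 ?frob_ge0// -e frobM.
have := @bernstein m 1 x B s2 q t B0 s20.
rewrite addn1 => h; apply: le_trans (h _ _ _ _ _) => //.
- apply: le_Pr => [|d hd ho]; first exact: p01_isprob.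
  apply: hd; have := ho 1%:M; rewrite mulmx1.
  have -> : frob (1%:M : 'M[R]_1) = 1 by rewrite frobE /dot !big_ord1 !mxE eqxx mulr1 sqrtr1.
  by rewrite mulr1.
- by move=> k; apply: opb_le (hB k) (opb_cV _).
- move=> v; apply: le_trans (_ : (\sum_k frob (x k) ^+ 2 / p k) * frob v ^+ 2 <= _).
    by rewrite mulr_suml; apply: ler_sum => k _; apply: hM.
  by rewrite ler_wpM2r ?sqr_ge0.
- move=> v; apply: le_trans (_ : (\sum_k frob (x k) ^+ 2 / p k) * frob v ^+ 2 <= _).
    by rewrite mulr_suml; apply: ler_sum => k _; apply: hM; rewrite frob_tr.
  by rewrite ler_wpM2r ?sqr_ge0.
Qed.

Lemma dot_cV m (x y : 'cV[R]_m) : x^T *m y = (dot x y)%:M.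
Proof.
apply/matrixP => i j; rewrite !ord1 !mxE mulr1n; apply: eq_bigr => k _.
by rewrite big_ord1 mxE.
Qed.

(** For y y^T the variance is the sum of |y|^2 <y, v>^2 / p, at most B times the sum of <y, v>^2, so
    B serves as size and as variance. *)
Lemma bernstein_rank1 m (y : I -> 'cV[R]_m) (B : R) q (t : R) :
  0 < B -> (forall k, frob (y k) ^+ 2 <= B * p k) ->
  (forall v, \sum_k dot (y k) v ^+ 2 <= frob v ^+ 2) ->
  0 < t -> 128 * (q.+1%:R ^+ 2 * B ^+ 2 + q.+1%:R * B) <= t ^+ 2 ->
  Pr p (fun d => ~ opb (bsum p (fun k => y k *m (y k)^T) d) t) <= m%:R * 2 ^- q.+1.
Proof.
move=> B0 hB hs t0 ht; apply: (bernstein_sym p01 _ B0 (ltW B0) _ _ t0 ht).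
- by move=> k; rewrite trmx_mul trmxK.
- move=> k; apply: opb_le (hB k) _ => v; rewrite expr2 -(frob_tr (y k)).
  rewrite {1}frob_tr; apply: (opbM (frob_ge0 _)); exact: opb_frob.
- move=> v; apply: le_trans (_ : B * \sum_k dot (y k) v ^+ 2 <= _); last first.
    by rewrite ler_wpM2l ?(ltW B0).
  rewrite mulr_sumr; apply: ler_sum => k _.
  have /andP[p0 _] := p01 k.
  rewrite ler_pdivrMr// mulrAC -mulmxA dot_cV mul_mx_scalar frobZ exprMn.
  by rewrite real_normK ?num_real// mulrC ler_wpM2r ?sqr_ge0.
Qed.

Lemma dot_mxvec m n (A B : 'M[R]_(m, n)) : dot (mxvec A) (mxvec B) = dot A B.
Proof.
rewrite /dot big_ord1 pair_bigA /= (reindex _ (curry_mxvec_bij m n)) /=.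
by apply: eq_bigr => -[i j] _; rewrite !mxvecE.
Qed.

Lemma frob_mxvec m n (A : 'M[R]_(m, n)) : frob (mxvec A) = frob A.
Proof. by rewrite !frobE dot_mxvec. Qed.

(** Vectorization turns the operators Z -> <y, Z> y on matrices into rank-one matrices. *)
Lemma bernstein_op m n (y : I -> 'M[R]_(m, n)) (B : R) q (t : R) :
  0 < B -> (forall k, frob (y k) ^+ 2 <= B * p k) ->
  (forall Z, \sum_k dot (y k) Z ^+ 2 <= frob Z ^+ 2) ->
  0 < t -> 128 * (q.+1%:R ^+ 2 * B ^+ 2 + q.+1%:R * B) <= t ^+ 2 ->
  Pr p (fun d => ~ forall Z, frob (\sum_k (((d k)%:R / p k - 1) * dot (y k) Z) *: y k)
                             <= t * frob Z) <= (m * n)%:R * 2 ^- q.+1.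
Proof.
move=> B0 hB hs t0 ht.
have hs' (v : 'cV_(m * n)) : \sum_k dot (mxvec (y k))^T v ^+ 2 <= frob v ^+ 2.
  rewrite -(frob_tr v) -(vec_mxK v^T) frob_mxvec; apply: le_trans (hs _).
  by apply: ler_sum => k _; rewrite -[in leRHS]dot_mxvec vec_mxK -[in leRHS]dot_tr trmxK.
have hB' k : frob (mxvec (y k))^T ^+ 2 <= B * p k by rewrite frob_tr frob_mxvec.
apply: le_trans (bernstein_rank1 B0 hB' hs' t0 ht).
apply: le_Pr => [|d hd ho]; first exact: p01_isprob.
apply: hd => Z; have := ho (mxvec Z)^T; rewrite frob_tr frob_mxvec; apply: le_trans.
rewrite -frob_mxvec -frob_tr /bsum mulmx_suml raddf_sum raddf_sum /=.
rewrite le_eqVlt; apply/orP; left; apply/eqP; congr frob; apply: eq_bigr => k _.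
rewrite trmxK -scalemxAl -mulmxA -[X in X *m (mxvec Z)^T]trmxK dot_cV dot_tr dot_mxvec.
by rewrite mul_mx_scalar scalerA !linearZ.
Qed.

End Bernstein.

(** * The tangent space *)

Section TangentLinear.
Variables (R : realType) (n r : nat).
Implicit Types (U V : 'M[R]_(n, r)).

Lemma PT_is_linear U V : linear (PT U V).
Proof.
move=> a X Y; rewrite /PT !(mulmxDl, mulmxDr, =^~ scalemxAl, =^~ scalemxAr).
move: (U *m U^T *m X) (X *m V *m V^T) (U *m U^T *m X *m V *m V^T) => A B C.
move: (U *m U^T *m Y) (Y *m V *m V^T) (U *m U^T *m Y *m V *m V^T) => D E F.
by apply/matrixP => i j; rewrite !mxE; ring.
Qed.

HB.instance Definition _ U V :=
  GRing.isLinear.Build R _ _ _ (PT U V) (PT_is_linear U V).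

Lemma PT_tr U V X : PT V U X^T = (PT U V X)^T.
Proof.
have trD (A B : 'M[R]_n) : (A + B)^T = A^T + B^T by apply/matrixP => i j; rewrite !mxE.
have trB (A B : 'M[R]_n) : (A - B)^T = A^T - B^T by apply/matrixP => i j; rewrite !mxE.
rewrite /PT trB trD !trmx_mul !trmxK !mulmxA.
by rewrite [X in X - _]addrC.
Qed.

End TangentLinear.

Section Tangent.
Variables (R : realType) (n r : nat) (U V : 'M[R]_(n, r)).
Hypothesis UU : U^T *m U = 1%:M.
Hypothesis VV : V^T *m V = 1%:M.
Implicit Types (X Y Z : 'M[R]_n).

Let PU := U *m U^T.
Let PV := V *m V^T.

Lemma proj_sym m (W : 'M[R]_(m, r)) : (W *m W^T)^T = W *m W^T.
Proof. by rewrite trmx_mul trmxK. Qed.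

Lemma proj_idem m (W : 'M[R]_(m, r)) : W^T *m W = 1%:M -> W *m W^T *m (W *m W^T) = W *m W^T.
Proof. by move=> WW; rewrite mulmxA -(mulmxA W) WW mulmx1. Qed.

Lemma proj_compl_idem m (W : 'M[R]_(m, r)) : W^T *m W = 1%:M ->
  (1%:M - W *m W^T) *m (1%:M - W *m W^T) = 1%:M - W *m W^T.
Proof.
by move=> WW; rewrite mulmxBl mul1mx mulmxBr mulmx1 proj_idem// subrr subr0.
Qed.

Lemma opb_orthproj m (P : 'M[R]_m) : P^T = P -> P *m P = P -> opb P 1.
Proof.
move=> sP iP v; rewrite mul1r.
have h : frob (P *m v) ^+ 2 <= frob (P *m v) * frob v.
  by rewrite frob_sqr {1}dot_mull sP mulmxA iP dot_frob.
have [->|v0] := eqVneq (frob (P *m v)) 0; first exact: frob_ge0.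
have v1 : 0 < frob (P *m v) by rewrite lt_neqAle eq_sym v0 frob_ge0.
by rewrite expr2 ler_pM2l in h.
Qed.

Lemma opb_proj m (W : 'M[R]_(m, r)) : W^T *m W = 1%:M -> opb (W *m W^T) 1.
Proof. by move=> WW; apply: opb_orthproj; [exact: proj_sym|exact: proj_idem]. Qed.

Lemma opb_proj_compl m (W : 'M[R]_(m, r)) : W^T *m W = 1%:M -> opb (1%:M - W *m W^T) 1.
Proof.
move=> WW; apply: opb_orthproj; last exact: proj_compl_idem.
by rewrite linearB /= trmx1 proj_sym.
Qed.

Lemma opb_trmx m (W : 'M[R]_(m, r)) : W^T *m W = 1%:M -> opb W^T 1.
Proof. by move=> WW; apply: opb_tr => // v; rewrite frob_orth// mul1r. Qed.

Lemma PTE X : PT U V X = PU *m X + (1%:M - PU) *m X *m PV.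
Proof.
rewrite /PT /PU /PV !mulmxBl !mul1mx !mulmxA addrA; congr (_ + _ - _).
Qed.

Lemma PTperpE X : PTperp U V X = (1%:M - PU) *m X *m (1%:M - PV).
Proof.
rewrite /PTperp PTE mulmxBr mulmx1 opprD addrA; congr (_ - _).
by rewrite mulmxBl mul1mx.
Qed.

Lemma UPT X : U^T *m PT U V X = U^T *m X.
Proof.
rewrite PTE mulmxDr !mulmxA UU mul1mx (_ : U^T *m (1%:M - PU) = 0) ?mul0mx ?addr0//.
by rewrite mulmxBr mulmx1 mulmxA UU mul1mx subrr.
Qed.

Lemma PTV X : PT U V X *m V = X *m V.
Proof.
have e : PV *m V = V by rewrite -mulmxA VV mulmx1.
by rewrite PTE mulmxDl -(mulmxA _ PV V) e -!mulmxDl [PU + _]addrC subrK mul1mx.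
Qed.

Lemma PT_idem X : PT U V (PT U V X) = PT U V X.
Proof.
rewrite {1}/PT -(mulmxA U) UPT PTV /PT.
by rewrite !mulmxA.
Qed.

Lemma dot_PT X Y : dot (PT U V X) Y = dot X (PT U V Y).
Proof.
rewrite !PTE dotDl dotDr; congr (_ + _).
  by rewrite dot_mull proj_sym.
rewrite dot_mulr dot_mull proj_sym linearB /= trmx1 proj_sym.
by rewrite mulmxA.
Qed.

Lemma frob_PT_le X : frob (PT U V X) <= frob X.
Proof.
have [->|X0] := eqVneq (frob (PT U V X)) 0; first exact: frob_ge0.
have X1 : 0 < frob (PT U V X) by rewrite lt_neqAle eq_sym X0 frob_ge0.
by rewrite -(ler_pM2l X1) -expr2 frob_sqr dot_PT PT_idem dotC dot_frob.
Qed.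

Lemma opb_PTperp X t : 0 <= t -> opb X t -> opb (PTperp U V X) t.
Proof.
move=> t0 Xt; rewrite PTperpE -[t]mulr1; apply: opbM => //; last exact: opb_proj_compl.
by rewrite -[t]mul1r; apply: opbM => //; exact: opb_proj_compl.
Qed.

Lemma dot_delta X i j : dot (delta_mx i j) X = X i j.
Proof.
rewrite /dot (bigD1 i)//= (bigD1 j)//= big1 ?addr0.
  rewrite big1 ?addr0 => [|k ki]; first by rewrite !mxE !eqxx mul1r.
  by rewrite big1// => l _; rewrite mxE (negPf ki) mul0r.
by move=> l lj; rewrite mxE (negPf lj) andbF mul0r.
Qed.

Lemma deltaE i j : (delta_mx i j : 'M[R]_n) = delta_mx i (0 : 'I_1) *m delta_mx 0 j.
Proof. by rewrite mul_delta_mx. Qed.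

Lemma frob_delta_row m j : frob (delta_mx 0 j : 'M[R]_(1, m)) = 1.
Proof.
apply/eqP; rewrite -(@eqrXn2 _ 2) ?frob_ge0// expr1n frob_sqrE big_ord1 (bigD1 j)//=.
rewrite big1 ?addr0; first by rewrite !mxE !eqxx expr1n.
by move=> k kj; rewrite mxE (negPf kj) andbF expr0n.
Qed.

Lemma frob_mul_row m (x : 'M[R]_(m, 1)) (y : 'M[R]_(1, n)) :
  frob (x *m y) = frob x * frob y.
Proof.
apply/eqP; rewrite -(@eqrXn2 _ 2) ?mulr_ge0 ?frob_ge0// exprMn !frob_sqrE.
apply/eqP; rewrite big_ord1 mulr_suml; apply: eq_bigr => i _; rewrite big_ord1.
by rewrite mulr_sumr; apply: eq_bigr => j _; rewrite mxE big_ord1 exprMn.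
Qed.

Lemma frob_proj_col m (W : 'M[R]_(m, r)) i : W^T *m W = 1%:M ->
  frob (W *m W^T *m delta_mx i (0 : 'I_1)) = frob (row i W).
Proof.
by move=> WW; rewrite -mulmxA frob_orth// -frob_tr trmx_mul trmxK trmx_delta -rowE.
Qed.

Lemma frob_PU_delta i j : frob (PU *m (delta_mx i j : 'M[R]_n)) = frob (row i U).
Proof. by rewrite deltaE mulmxA frob_mul_row frob_delta_row mulr1 frob_proj_col. Qed.

Lemma frob_delta_PV i j : frob ((delta_mx i j : 'M[R]_n) *m PV) = frob (row j V).
Proof.
rewrite -frob_tr trmx_mul trmx_delta proj_sym deltaE mulmxA frob_mul_row.
by rewrite frob_delta_row mulr1 frob_proj_col.
Qed.

(** The two summands of [PTE] have orthogonal column spaces, so Pythagoras applies; their norms are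
    governed by row i of U and row j of V. *)
Lemma frob_PT_delta i j : frob (PT U V (delta_mx i j)) ^+ 2 <=
  frob (row i U) ^+ 2 + frob (row j V) ^+ 2.
Proof.
rewrite PTE; set A := PU *m _; set B := _ *m PV.
have AB : dot A B = 0.
  rewrite /A dotC dot_mull proj_sym /B !mulmxA mulmxBr mulmx1 proj_idem// subrr.
  by rewrite !mul0mx dot0l.
rewrite frob_sqr dotDl !dotDr (dotC B A) AB addr0 add0r -!frob_sqr.
rewrite /A frob_PU_delta lerD2l ler_sqr ?nnegrE ?frob_ge0// -(frob_delta_PV i).
rewrite /B -mulmxA; have := @opb_mulmx _ _ _ _ (1%:M - PU) (delta_mx i j *m PV) 1 ler01.
by rewrite mul1r; apply; apply: opb_proj_compl.
Qed.

Lemma projE m (W : 'M[R]_(m, r)) i j : (W *m W^T) i j = dot (row i W) (row j W).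
Proof.
by rewrite mxE /dot big_ord1; apply: eq_bigr => k _; rewrite !mxE.
Qed.

Lemma proj_entry_le m (W : 'M[R]_(m, r)) i j :
  `|(W *m W^T) i j| <= frob (row i W) * frob (row j W).
Proof. by rewrite projE normr_dot. Qed.

Lemma proj_entry_sum m (W : 'M[R]_(m, r)) j : W^T *m W = 1%:M ->
  \sum_i (W *m W^T) i j ^+ 2 = frob (row j W) ^+ 2.
Proof.
move=> WW; rewrite -frob_proj_col// frob_sqrE; apply: eq_bigr => i _.
by rewrite big_ord1 -colE [in RHS]mxE.
Qed.

Lemma frob_row_le1 m (W : 'M[R]_(m, r)) i : W^T *m W = 1%:M -> frob (row i W) <= 1.
Proof.
move=> WW; rewrite -frob_proj_col//; apply: le_trans (opb_proj WW _) _.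
by rewrite mul1r -frob_tr trmx_delta frob_delta_row.
Qed.

Lemma sum_frob_row m (W : 'M[R]_(m, r)) : W^T *m W = 1%:M ->
  \sum_i frob (row i W) ^+ 2 = r%:R.
Proof. by move=> WW; rewrite -frob_row frob_sqr dotE WW mxtrace1. Qed.

Lemma PT_delta_entry a b i j : PT U V (delta_mx a b) i j =
  PU i a * (b == j)%:R + (a == i)%:R * PV b j - PU i a * PV b j.
Proof.
have dE k l : (delta_mx a b : 'M[R]_n) k l = ((k == a) && (l == b))%:R by rewrite mxE.
have e2 m (X : 'M[R]_(m, n)) k l : (X *m delta_mx a b) k l = X k a * (l == b)%:R.
  rewrite mxE (bigD1 a)//= big1 ?addr0 => [|o oa]; first by rewrite dE eqxx.
  by rewrite dE (negPf oa) mulr0.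
have e3 m (X : 'M[R]_(m, n)) k : (X *m delta_mx a b *m PV) k j = X k a * PV b j.
  rewrite mxE (bigD1 b)//= big1 ?addr0 => [|l lb]; first by rewrite e2 eqxx mulr1.
  by rewrite e2 (negPf lb) mulr0 mul0r.
rewrite PTE mxE e2 e3 [(1%:M - PU) i a]mxE [1%:M i a]mxE [(- PU) i a]mxE mulrBl addrA.
by rewrite (eq_sym b) (eq_sym a).
Qed.

(** The U part of P_T(e_a e_b^T) lives in column b only, while the other part spreads over the
    columns with the coefficients of row b of V V^T. *)
Lemma frob_col_PT_delta a b j : frob (col j (PT U V (delta_mx a b))) <=
  (b == j)%:R * frob (row a U) + `|PV b j|.
Proof.
rewrite PTE linearD /=; apply: le_trans (frobD _ _) _; apply: lerD.
  rewrite colE deltaE -!mulmxA mul_delta_mx_cond mulr_natl.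
  case: eqP => _; last by rewrite mulr0n !mulmx0 frob0.
  by rewrite mulr1n -(frob_proj_col a UU) -!mulmxA (_ : delta_mx 0 0 = 1%:M) ?mulmx1//;
    apply/matrixP => k l; rewrite !ord1 !mxE.
rewrite colE -!mulmxA; apply: le_trans (opb_proj_compl UU _) _; rewrite mul1r.
rewrite (mulmxA V) -colE.
have -> : delta_mx a b *m col j PV = PV b j *: delta_mx a (0 : 'I_1).
  apply/matrixP => k l; rewrite !ord1 mxE (bigD1 b)//= big1 ?addr0 => [|m mb].
    by rewrite !mxE eqxx !andbT mulrC.
  by rewrite mxE (negPf mb) andbF mul0r.
by rewrite frobZ -(frob_tr (delta_mx _ _)) trmx_delta frob_delta_row mulr1.
Qed.

End Tangent.

(** * Concentration of the sampling operator *)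

Section Sampling.
Variables (R : realType) (n r : nat) (U V : 'M[R]_(n, r)).
Hypothesis UU : U^T *m U = 1%:M.
Hypothesis VV : V^T *m V = 1%:M.
Notation I := ('I_n * 'I_n)%type.
Variable q : I -> R.
Hypothesis q01 : forall k, 0 < q k <= 1.
Implicit Types (X Y Z W : 'M[R]_n) (d : {ffun I -> bool}).

Definition had X Y : 'M[R]_n := \matrix_(i, j) (X i j * Y i j).
Definition xi d : 'M[R]_n := \matrix_(i, j) ((d (i, j))%:R / q (i, j) - 1).
Definition maskmx (S : pred I) X : 'M[R]_n := \matrix_(i, j) (if S (i, j) then X i j else 0).

Lemma sum_pair (M : nmodType) (f : I -> M) : \sum_k f k = \sum_i \sum_j f (i, j).
Proof. by rewrite pair_bigA; apply: eq_bigr => -[]. Qed.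

Lemma had_sum X Y : had X Y = \sum_k (X k.1 k.2 * Y k.1 k.2) *: delta_mx k.1 k.2.
Proof.
rewrite [LHS]matrix_sum_delta pair_bigA /=.
by apply: eq_bigr => k _; rewrite mxE.
Qed.

Lemma linear_had (W : lmodType R) (L : {linear 'M[R]_n -> W}) X Y :
  L (had X Y) = \sum_k (X k.1 k.2 * Y k.1 k.2) *: L (delta_mx k.1 k.2).
Proof. by rewrite had_sum raddf_sum; apply: eq_bigr => k _; rewrite /= linearZ. Qed.

Lemma linear_had_xi a b (L : {linear 'M[R]_n -> 'M[R]_(a, b)}) d W :
  L (had (xi d) W) = bsum q (fun k => W k.1 k.2 *: L (delta_mx k.1 k.2)) d.
Proof.
rewrite linear_had; apply: eq_bigr => -[i j] _ /=.
by rewrite scalerA mxE.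
Qed.

Lemma bernstein_frob a b (x : I -> 'M[R]_(a, b)) (B s2 : R) s (t : R) :
  0 < B -> (forall k, frob (x k) <= B * q k) ->
  \sum_k frob (x k) ^+ 2 / q k <= s2 ->
  0 < t -> 128 * (s.+1%:R ^+ 2 * B ^+ 2 + s.+1%:R * s2) <= t ^+ 2 ->
  Pr q (fun d => ~ (frob (bsum q x d) <= t)) <= (a * b).+1%:R * 2 ^- s.+1.
Proof.
move=> B0 hB hs t0 ht.
have fE k : frob (mxvec (x k))^T = frob (x k) by rewrite frob_tr frob_mxvec.
apply: le_trans (@bernstein_vec _ _ _ q01 _ (fun k => (mxvec (x k))^T) B s2 s t B0 _ _ t0 ht).
- apply: le_Pr => [|d hd ho]; first exact: p01_isprob.
  apply: hd; apply: le_trans ho; rewrite -frob_mxvec -frob_tr /bsum !raddf_sum /=.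
  rewrite le_eqVlt; apply/orP; left; apply/eqP; congr frob.
  by apply: eq_bigr => k _; rewrite !linearZ.
- by move=> k; rewrite fE.
- by under eq_bigr do rewrite fE.
Qed.

(** [G] is the oversampling factor: by [qG] every squared leverage quantity divided by the rate is
    at most 1/G, which is the source of all powers of 1/G below. *)
Variable G : R.
Hypothesis G_gt0 : 0 < G.
Hypothesis qG : forall i j, G * (frob (row i U) ^+ 2 + frob (row j V) ^+ 2) <= q (i, j).

Let u i := frob (row i U).
Let v j := frob (row j V).
Let PU := U *m U^T.
Let PV := V *m V^T.

Let q0 k : 0 < q k. Proof. by have /andP[] := q01 k. Qed.
Let u0 i : 0 <= u i. Proof. exact: frob_ge0. Qed.
Let v0 j : 0 <= v j. Proof. exact: frob_ge0. Qed.

Lemma lev_le_q i j : u i ^+ 2 + v j ^+ 2 <= G^-1 * q (i, j).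
Proof. by rewrite mulrC ler_pdivlMr// mulrC qG. Qed.

Lemma lev_mul_le_q i j : u i * v j <= G^-1 * q (i, j).
Proof.
apply: le_trans (lev_le_q i j).
have := sqr_ge0 (u i - v j); have := sqr_ge0 (u i); have := sqr_ge0 (v j).
by rewrite !expr2; lra.
Qed.

Lemma leU_div_q i j : u i ^+ 2 / q (i, j) <= G^-1.
Proof.
rewrite ler_pdivrMr//; apply: le_trans (lev_le_q i j).
by rewrite lerDl sqr_ge0.
Qed.

Lemma leV_div_q i j : v j ^+ 2 / q (i, j) <= G^-1.
Proof.
rewrite ler_pdivrMr//; apply: le_trans (lev_le_q i j).
by rewrite lerDr sqr_ge0.
Qed.

(** On T the operator is a centred sum of rank-one operators built from y = P_T(e_i e_j^T), and the
    squares <y, Z>^2 add up to |P_T(Z)|^2. The mask [S] covers the full sample and the sample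
    without one row by one bound. *)
Lemma PT_isometry_prob (S : pred I) s t : 0 < t ->
  128 * (s.+1%:R ^+ 2 * G^-1 ^+ 2 + s.+1%:R * G^-1) <= t ^+ 2 ->
  Pr q (fun d => ~ forall Z, frob (PT U V (had (maskmx S (xi d)) (PT U V Z))) <= t * frob Z)
    <= (n * n)%:R * 2 ^- s.+1.
Proof.
move=> t0 ht.
pose y (k : I) : 'M[R]_n := if S k then PT U V (delta_mx k.1 k.2) else 0.
have Gi0 : 0 < G^-1 by rewrite invr_gt0.
have hB k : frob (y k) ^+ 2 <= G^-1 * q k.
  rewrite /y; case: ifP => _; last by rewrite frob0 expr0n mulr_ge0 ?ltW.
  apply: le_trans (frob_PT_delta UU VV _ _) _; case: k => i j; exact: lev_le_q.
have hs Z : \sum_k dot (y k) Z ^+ 2 <= frob Z ^+ 2.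
  apply: le_trans (_ : frob (PT U V Z) ^+ 2 <= _); last first.
    by rewrite ler_sqr ?nnegrE ?frob_ge0// frob_PT_le.
  rewrite frob_sqrE pair_bigA /=; apply: ler_sum => -[i j] _; rewrite /y.
  case: ifP => _ /=; last by rewrite dot0l expr0n sqr_ge0.
  by rewrite dot_PT dot_delta.
apply: le_trans (bernstein_op q01 Gi0 hB hs t0 ht).
apply: le_Pr => [|d hd ho]; first exact: p01_isprob.
apply: hd => Z; apply: le_trans (ho Z).
rewrite le_eqVlt; apply/orP; left; apply/eqP; congr frob.
rewrite linear_had; apply: eq_bigr => -[i j] _ /=; rewrite /y /= [maskmx _ _ _ _]mxE.
case: ifP => _; last by rewrite mul0r scale0r scaler0.
by rewrite [xi _ _ _]mxE dot_PT dot_delta.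
Qed.

Section FixedMatrix.
Variables (W : 'M[R]_n) (kap : R).
Hypothesis kap0 : 0 < kap.
Hypothesis Wentry : forall i j, `|W i j| <= kap * (u i * v j).
Hypothesis Wcol : forall j, frob (col j W) <= kap * v j.

Let sqr_le_norm (x y : R) : `|x| <= y -> x ^+ 2 <= y ^+ 2.
Proof.
move=> xy; rewrite -real_normK ?num_real// ler_sqr ?nnegrE//.
exact: le_trans (normr_ge0 _) xy.
Qed.

Let Gi0 : 0 < G^-1. Proof. by rewrite invr_gt0. Qed.

Let GK : 0 <= G^-1 * kap ^+ 2.
Proof. by apply: mulr_ge0; rewrite ?sqr_ge0 ?ltW. Qed.

Lemma col_var j : \sum_i W i j ^+ 2 / q (i, j) <= G^-1 * kap ^+ 2.
Proof.
(* The main case divides by v_j^2; if v_j = 0, the entry bound kills column j. *)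
have [vj|vj] := eqVneq (v j) 0.
  rewrite big1 // => i _.
  have := Wentry i j; rewrite vj !mulr0 normr_le0 => /eqP ->.
  by rewrite expr0n mul0r.
have vj2 : 0 < v j ^+ 2 by rewrite exprn_even_gt0.
rewrite -(ler_pM2r vj2) mulr_suml.
apply: le_trans (_ : \sum_i W i j ^+ 2 * G^-1 <= _).
  apply: ler_sum => i _; rewrite -mulrA ler_wpM2l ?sqr_ge0//.
  by rewrite mulrC leV_div_q.
rewrite -mulr_suml mulrC -mulrA ler_wpM2l ?(ltW Gi0)//.
rewrite -frob_colE -exprMn ler_sqr ?nnegrE ?frob_ge0//.
by rewrite mulr_ge0 ?(ltW kap0).
Qed.

(** The row variance is a hypothesis because it is [col_var] for the transposed data, a different
    instance of this section. *)
Lemma spectral_prob s t :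
  (forall i, frob (row i W) <= kap * u i) -> 0 < t ->
  128 * (s.+1%:R ^+ 2 * (kap * G^-1) ^+ 2 + s.+1%:R * (G^-1 * kap ^+ 2)) <= t ^+ 2 ->
  (forall i, \sum_j W i j ^+ 2 / q (i, j) <= G^-1 * kap ^+ 2) ->
  Pr q (fun d => ~ opb (had (xi d) W) t) <= (n + n)%:R * 2 ^- s.+1.
Proof.
move=> Wrow t0 ht row_var.
have f1 (w : 'cV[R]_n) i : (w i 0) ^+ 2 <= frob w ^+ 2.
  by rewrite frob_sqrE (bigD1 i)//= big_ord1 lerDl sumr_ge0// => *;
    rewrite big_ord1 sqr_ge0.
have fD (w : 'cV[R]_n) i j : frob (delta_mx i j *m w) ^+ 2 = w j 0 ^+ 2.
  rewrite frob_sqrE (bigD1 i)//= [X in _ + X]big1 ?addr0.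
    rewrite big_ord1 mxE (bigD1 j)//= [X in _ + X]big1 ?addr0.
      by rewrite mxE !eqxx mul1r.
    by move=> k kj; rewrite mxE (negPf kj) andbF mul0r.
  move=> k ki; rewrite big_ord1 mxE big1 ?expr0n// => l _.
  by rewrite mxE (negPf ki) mul0r.
apply: le_trans (bernstein q01 (X := fun k => W k.1 k.2 *: delta_mx k.1 k.2)
  (mulr_gt0 kap0 Gi0) GK _ _ _ t0 ht).
- apply: le_Pr => [|d hd ho]; first exact: p01_isprob.
  by apply: hd; rewrite -[had _ _]/(idfun (had _ _)) linear_had_xi.
- move=> -[i j] w /=.
  have Bq : 0 <= kap * G^-1 * q (i, j) * frob w.
    by rewrite mulr_ge0 ?frob_ge0// ltW// !mulr_gt0.
  rewrite -ler_sqr ?nnegrE ?frob_ge0//.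
  rewrite -scalemxAl frobZ [leLHS]exprMn real_normK ?num_real// fD [leRHS]exprMn.
  apply: ler_pM; rewrite ?sqr_ge0 ?f1//; apply: sqr_le_norm.
  apply: le_trans (Wentry _ _) _; rewrite -mulrA ler_wpM2l ?(ltW kap0)//.
  exact: lev_mul_le_q.
- move=> w; rewrite sum_pair exchange_big /= frob_sqrE mulr_sumr; apply: ler_sum => j _.
  rewrite big_ord1; apply: le_trans (_ : \sum_i (W i j ^+ 2 / q (i, j)) * w j 0 ^+ 2 <= _).
    apply: ler_sum => i _; rewrite -scalemxAl frobZ exprMn real_normK ?num_real// fD.
    by rewrite mulrAC.
  by rewrite -mulr_suml ler_wpM2r ?sqr_ge0// col_var.
- move=> w; rewrite sum_pair frob_sqrE mulr_sumr; apply: ler_sum => i _.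
  rewrite big_ord1; apply: le_trans (_ : \sum_j (W i j ^+ 2 / q (i, j)) * w i 0 ^+ 2 <= _).
    apply: ler_sum => j _; rewrite linearZ /= trmx_delta -scalemxAl frobZ exprMn.
    by rewrite real_normK ?num_real// fD mulrAC.
  by rewrite -mulr_suml ler_wpM2r ?sqr_ge0.
Qed.

(** The 4 is 2 + 2, one half for each part in [frob_col_PT_delta]: entries of column j itself,
    through the column norm of W, and all entries weighted by (V V^T)_{bj}^2, through [col_var] and
    the fact that these squares sum to v_j^2. *)
Lemma col_prob j s t : 0 < t -> 0 < v j ->
  128 * (s.+1%:R ^+ 2 * (kap * v j * G^-1) ^+ 2 + s.+1%:R * (4 * (G^-1 * kap ^+ 2) * v j ^+ 2)) <= t ^+ 2 ->
  Pr q (fun d => ~ (frob (col j (PT U V (had (xi d) W))) <= t)) <= (n * 1).+1%:R * 2 ^- s.+1.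
Proof.
move=> t0 vj ht; pose y (k : I) := W k.1 k.2 *: col j (PT U V (delta_mx k.1 k.2)).
have v1 b : v b <= 1 by exact: frob_row_le1.
apply: le_trans (@bernstein_frob _ _ y _ _ _ _ (mulr_gt0 (mulr_gt0 kap0 vj) Gi0) _ _ t0 ht).
- apply: le_Pr => [|d hd ho]; first exact: p01_isprob.
  apply: hd; apply: le_trans ho.
  by rewrite -[col j _]/((col j \o PT U V) _) linear_had_xi.
- move=> -[a b]; rewrite /y /= frobZ.
  apply: le_trans (ler_pM (normr_ge0 _) (frob_ge0 _) (Wentry a b) (frob_col_PT_delta V UU a b j)) _.
  rewrite -!mulrA ler_wpM2l ?(ltW kap0)//.
  have hPV := proj_entry_le V b j; rewrite -/(v b) -/(v j) -/PV in hPV *.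
  have hq := lev_le_q a b.
  apply: le_trans (_ : v j * (u a ^+ 2 + v b ^+ 2) <= _); last by rewrite ler_wpM2l// ltW.
  have ua := u0 a; have vb := v0 b; rewrite -/(u a).
  have h1 : u a * (v b * `|PV b j|) <= v j * (u a * (v b * v b)).
    apply: le_trans (_ : u a * (v b * (v b * v j)) <= _).
      by rewrite !ler_wpM2l.
    by rewrite le_eqVlt; apply/orP; left; apply/eqP; ring.
  have u1 : u a <= 1 by exact: frob_row_le1.
  have h2 : v j * (u a * (v b * v b)) <= v j * (1 * (v b * v b)).
    by rewrite ler_wpM2l ?(ltW vj)// ler_wpM2r// mulr_ge0.
  have h3 : u a * (v b * ((b == j)%:R * u a)) <= v j * u a ^+ 2.
    case: eqP => [->|_]; last by rewrite mul0r !mulr0 mulr_ge0 ?sqr_ge0// ltW.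
    by rewrite mul1r le_eqVlt; apply/orP; left; apply/eqP; ring.
  by rewrite !mulrDr expr2 in h3 *; lra.
- rewrite sum_pair /=.
  apply: le_trans (_ : \sum_a \sum_b ((W a b ^+ 2 / q (a, b)) * (2 * ((b == j)%:R * u a ^+ 2)) +
     (W a b ^+ 2 / q (a, b)) * (2 * PV b j ^+ 2)) <= _).
    apply: ler_sum => a _; apply: ler_sum => b _.
    rewrite /y /= frobZ exprMn real_normK ?num_real// mulrAC -mulrDr.
    rewrite ler_wpM2l// ?divr_ge0 ?sqr_ge0 ?(ltW (q0 _))//.
    have := frob_col_PT_delta V UU a b j; rewrite -/(u a) -/PV => h.
    have e : frob (col j (PT U V (delta_mx a b))) ^+ 2 <= ((b == j)%:R * u a + `|PV b j|) ^+ 2.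
      rewrite ler_sqr ?nnegrE ?frob_ge0//; apply: le_trans h; exact: frob_ge0.
    apply: le_trans e _; rewrite -(real_normK (num_real (PV b j))).
    move: `|PV b j| => x; have := sqr_ge0 ((b == j)%:R * u a - x).
    by case: (b == j); rewrite ?mul1r ?mul0r !expr2; lra.
  rewrite (eq_bigr (fun a => (W a j ^+ 2 / q (a, j)) * (2 * u a ^+ 2) +
     \sum_b (W a b ^+ 2 / q (a, b)) * (2 * PV b j ^+ 2))); last first.
    move=> a _; rewrite big_split /= (bigD1 j)//= eqxx mul1r [X in _ + X + _]big1 ?addr0//.
    by move=> b /negPf ->; rewrite mul0r !mulr0.
  rewrite big_split /= [4](_ : _ = 2 + 2); last by rewrite -natrD.
  rewrite !mulrDl; apply: lerD.
    apply: le_trans (_ : \sum_a W a j ^+ 2 * (2 * G^-1) <= _).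
      apply: ler_sum => a _; rewrite -mulrA ler_wpM2l ?sqr_ge0// mulrCA ler_wpM2l ?ler0n//.
      by rewrite mulrC leU_div_q.
    rewrite -mulr_suml -frob_colE.
    have hc : frob (col j W) ^+ 2 <= kap ^+ 2 * v j ^+ 2.
      by rewrite -exprMn ler_sqr ?nnegrE ?frob_ge0// mulr_ge0 ?(ltW kap0).
    by have := ler_wpM2l (ltW Gi0) hc; lra.
  rewrite exchange_big /=.
  apply: le_trans (_ : \sum_b (G^-1 * kap ^+ 2) * (2 * PV b j ^+ 2) <= _).
    by apply: ler_sum => b _; rewrite -mulr_suml ler_wpM2r ?col_var// mulr_ge0 ?sqr_ge0.
  rewrite -mulr_sumr -mulr_sumr proj_entry_sum// -/(v j).
  by rewrite le_eqVlt; apply/orP; left; apply/eqP; ring.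
Qed.

(** Entry (i, j) of P_T(e_a e_b^T) has three terms. Squaring their sum costs a factor 3, and each of
    the three resulting sums contributes 3 (kap u_i v_j)^2 / G, hence the 9. *)
Lemma entry_prob i j s t : 0 < t -> 0 < u i -> 0 < v j ->
  128 * (s.+1%:R ^+ 2 * (2 * (kap * (u i * v j)) * G^-1) ^+ 2 +
         s.+1%:R * (9 * (G^-1 * (kap * (u i * v j)) ^+ 2))) <= t ^+ 2 ->
  Pr q (fun d => ~ (`|PT U V (had (xi d) W) i j| <= t)) <= 2 * 2 ^- s.+1.
Proof.
move=> t0 ui vj ht.
(* The entry is packed as a linear map into 1 by 1 matrices so that [linear_had_xi] and
   [bernstein_frob] apply. *)
pose L (X : 'M[R]_n) : 'M[R]_1 := (PT U V X i j)%:M.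
have L_lin : linear L.
  by move=> a X Y; rewrite /L linearP /= !mxE raddfD /= -scale_scalar_mx.
pose HL := GRing.isLinear.Build R _ _ _ L L_lin.
pose LL : {linear 'M[R]_n -> 'M[R]_1} := HB.pack L HL.
have LE X : frob (L X) = `|PT U V X i j|.
  by rewrite frobE /dot !big_ord1 !mxE mulr1n -expr2 sqrtr_sqr.
pose y (k : I) := W k.1 k.2 *: LL (delta_mx k.1 k.2).
have B0 : 0 < 2 * (kap * (u i * v j)) * G^-1 by rewrite !mulr_gt0.
have v1 b : v b <= 1 by exact: frob_row_le1.
have u1 b : u b <= 1 by exact: frob_row_le1.
apply: le_trans (@bernstein_frob _ _ y _ _ _ _ B0 _ _ t0 ht).
- apply: le_Pr => [|d hd ho]; first exact: p01_isprob.
  apply: hd; apply: le_trans ho.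
  by rewrite -LE -[L _]/(LL _) linear_had_xi.
- move=> -[a b]; rewrite /y /= frobZ LE PT_delta_entry -/PU -/PV.
  have hPU := proj_entry_le U i a; have hPV := proj_entry_le V b j.
  rewrite -/(u i) -/(u a) -/(v b) -/(v j) -/PU -/PV in hPU hPV.
  have ua := u0 a; have vb := v0 b; have ui0 := u0 i; have vj0 := v0 j.
  apply: le_trans (_ : kap * (u a * v b) * (`|PU i a| * (b == j)%:R + (a == i)%:R * `|PV b j|
     + `|PU i a| * `|PV b j|) <= _).
    apply: ler_pM => //; apply: le_trans (ler_normB _ _) _; rewrite normrM lerD2r.
    by apply: le_trans (ler_normD _ _) _; rewrite !normrM !normr_nat.
  apply: (@le_trans _ _ (kap * (u i * (v j * (2 * (u a ^+ 2 + v b ^+ 2)))))); last first.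
    rewrite [leRHS](_ : _ = kap * (u i * (v j * (2 * (G^-1 * q (a, b)))))); last by ring.
    by rewrite !ler_wpM2l ?ler0n ?lev_le_q// ltW.
  rewrite -!mulrA ler_wpM2l ?(ltW kap0)//.
  have h1 : u a * (v b * (`|PU i a| * (b == j)%:R)) <= u i * (v j * u a ^+ 2).
    case: eqP => [->|_]; last by rewrite !mulr0 !mulr_ge0 ?sqr_ge0.
    rewrite mulr1; apply: le_trans (_ : u a * (v j * (u i * u a)) <= _).
      by rewrite !ler_wpM2l.
    by rewrite le_eqVlt; apply/orP; left; apply/eqP; ring.
  have h2 : u a * (v b * ((a == i)%:R * `|PV b j|)) <= u i * (v j * v b ^+ 2).
    case: eqP => [->|_]; last by rewrite mul0r !mulr0 !mulr_ge0 ?sqr_ge0.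
    rewrite mul1r; apply: le_trans (_ : u i * (v b * (v b * v j)) <= _).
      by rewrite !ler_wpM2l.
    by rewrite le_eqVlt; apply/orP; left; apply/eqP; ring.
  have h3 : u a * (v b * (`|PU i a| * `|PV b j|)) <= u i * (v j * u a ^+ 2).
    apply: le_trans (_ : u a * (v b * ((u i * u a) * (v b * v j))) <= _).
      by rewrite !ler_wpM2l// ler_pM.
    rewrite [leLHS](_ : _ = u i * (v j * (u a ^+ 2 * (v b ^+ 2)))); last by ring.
    by rewrite !ler_wpM2l// ler_piMr ?sqr_ge0// expr_le1.
  have h4 : 0 <= u i * (v j * v b ^+ 2) by rewrite !mulr_ge0 ?sqr_ge0.
  by rewrite !mulrDr; lra.
- rewrite sum_pair /=.
  have ua := u0; have vb := v0.
  pose K := G^-1 * (kap * (u i * v j)) ^+ 2.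
  have WU a b : W a b ^+ 2 / q (a, b) <= kap ^+ 2 * v b ^+ 2 * G^-1.
    apply: le_trans (_ : (kap * (u a * v b)) ^+ 2 / q (a, b) <= _).
      by rewrite ler_wpM2r ?invr_ge0 ?(ltW (q0 _))// sqr_le_norm.
    rewrite [leLHS](_ : _ = kap ^+ 2 * v b ^+ 2 * (u a ^+ 2 / q (a, b))); last by ring.
    by rewrite ler_wpM2l ?leU_div_q// -exprMn sqr_ge0.
  have WV a b : W a b ^+ 2 / q (a, b) <= kap ^+ 2 * u a ^+ 2 * G^-1.
    apply: le_trans (_ : (kap * (u a * v b)) ^+ 2 / q (a, b) <= _).
      by rewrite ler_wpM2r ?invr_ge0 ?(ltW (q0 _))// sqr_le_norm.
    rewrite [leLHS](_ : _ = kap ^+ 2 * u a ^+ 2 * (v b ^+ 2 / q (a, b))); last by ring.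
    by rewrite ler_wpM2l ?leV_div_q// -exprMn sqr_ge0.
  apply: le_trans (_ : \sum_a \sum_b (
      3 * (b == j)%:R * (kap ^+ 2 * v b ^+ 2 * G^-1 * PU i a ^+ 2) +
      3 * (a == i)%:R * (kap ^+ 2 * u a ^+ 2 * G^-1 * PV b j ^+ 2) +
      3 * (kap ^+ 2 * G^-1) * (PU i a ^+ 2 * PV b j ^+ 2)) <= _).
    apply: ler_sum => a _; apply: ler_sum => b _.
    rewrite /y /= frobZ LE exprMn !real_normK ?num_real// PT_delta_entry -/PU -/PV mulrAC.
    have w0 : 0 <= W a b ^+ 2 / q (a, b) by rewrite divr_ge0 ?sqr_ge0 ?(ltW (q0 _)).
    have hU := ler_wpM2r (sqr_ge0 (PU i a)) (WU a b).
    have hV := ler_wpM2r (sqr_ge0 (PV b j)) (WV a b).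
    have hUV : W a b ^+ 2 / q (a, b) * (PU i a ^+ 2 * PV b j ^+ 2) <=
        kap ^+ 2 * G^-1 * (PU i a ^+ 2 * PV b j ^+ 2).
      rewrite ler_wpM2r//; first by rewrite -exprMn sqr_ge0.
      apply: le_trans (WU a b) _; rewrite mulrAC ler_piMr ?expr_le1//.
      by apply: mulr_ge0; rewrite ?sqr_ge0 ?ltW.
    move: w0 hU hV hUV; move: (W a b ^+ 2 / q (a, b)) => w w0 hU hV hUV.
    apply: le_trans (_ : w * (3 * (PU i a * (b == j)%:R) ^+ 2 + 3 * ((a == i)%:R * PV b j) ^+ 2 +
       3 * (PU i a * PV b j) ^+ 2) <= _).
      rewrite ler_wpM2l//.
      have sq3 (x z t' : R) : (x + z - t') ^+ 2 <= 3 * x ^+ 2 + 3 * z ^+ 2 + 3 * t' ^+ 2.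
        have := sqr_ge0 (x - z); have := sqr_ge0 (x + t'); have := sqr_ge0 (z + t').
        by rewrite !expr2; lra.
      exact: sq3.
    have b2 (c : bool) : (c%:R : R) ^+ 2 = c%:R by case: c; rewrite ?expr1n ?expr0n.
    rewrite !exprMn !b2.
    rewrite -subr_ge0 in hU; rewrite -subr_ge0 in hV.
    have h1 := mulr_ge0 (ler0n R (b == j)) hU.
    have h2 := mulr_ge0 (ler0n R (a == i)) hV.
    by lra.
  rewrite (eq_bigr (fun a => 3 * (kap ^+ 2 * v j ^+ 2 * G^-1 * PU i a ^+ 2) +
     3 * (a == i)%:R * (kap ^+ 2 * u a ^+ 2 * G^-1 * v j ^+ 2) +
     3 * (kap ^+ 2 * G^-1) * (PU i a ^+ 2 * v j ^+ 2))); last first.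
    move=> a _; rewrite !big_split /= -!mulr_sumr proj_entry_sum// -/(v j); congr (_ + _ + _).
    rewrite (bigD1 j)//= eqxx mulr1 [X in _ + X]big1 ?addr0//.
    by move=> b /negPf ->; rewrite mulr0 mul0r.
  rewrite !big_split /= -!mulr_sumr -mulr_suml.
  have -> : \sum_a PU i a ^+ 2 = u i ^+ 2.
    rewrite -(proj_entry_sum i UU); apply: eq_bigr => a _.
    by rewrite -[in RHS](proj_sym U) [in RHS]mxE.
  have -> : \sum_(a < n) 3 * (a == i)%:R * (kap ^+ 2 * u a ^+ 2 * G^-1 * v j ^+ 2) =
      3 * (kap ^+ 2 * u i ^+ 2 * G^-1 * v j ^+ 2).
    rewrite (bigD1 i)//= eqxx mulr1 [X in _ + X]big1 ?addr0//.
    by move=> b /negPf ->; rewrite mulr0 mul0r.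
  by rewrite le_eqVlt; apply/orP; left; apply/eqP; ring.
Qed.

End FixedMatrix.

End Sampling.

(** * Leave-one-out analysis of the last step *)

Section LeaveOneOut.
Variable R : realType.

Lemma linear_inj_surj m n (L : {linear 'M[R]_(m, n) -> 'M[R]_(m, n)}) :
  (forall Z, L Z = 0 -> Z = 0) -> forall E, exists F, L F = E.
Proof.
move=> inj E; have hM : lin_mx L \in unitmx.
  rewrite -row_free_unit; apply: inj_row_free => w hw.
  have : L (vec_mx w) = 0.
    by apply: (can_inj mxvecK); rewrite -mul_vec_lin vec_mxK hw linear0.
  by move=> /inj h; rewrite -[w]vec_mxK h linear0.
exists (vec_mx (mxvec E *m invmx (lin_mx L))).
by apply: (can_inj mxvecK); rewrite -mul_vec_lin vec_mxK mulmxKV.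
Qed.

Variables (n r : nat).
Implicit Types (U V : 'M[R]_(n, r)) (A B E F Z : 'M[R]_n).

Lemma had_is_linear A : linear (had A).
Proof. by move=> a X Y; apply/matrixP => i j; rewrite !mxE; ring. Qed.

HB.instance Definition _ A :=
  GRing.isLinear.Build R _ _ _ (had A) (had_is_linear A).

Lemma hadDl A B F : had (A + B) F = had A F + had B F.
Proof. by apply/matrixP => i j; rewrite !mxE mulrDl. Qed.

Lemma had_tr A B : had A^T B^T = (had A B)^T.
Proof. by apply/matrixP => i j; rewrite !mxE. Qed.

(* [A] stands for the centred sampling weights [d / q - 1]; entrywise multiplication by
   [A] is [R_q - id]. *)
Definition contr U V A :=
  forall Z, frob (PT U V (had A (PT U V Z))) <= 1/2 * frob Z.

Definition solves U V E A F := F + PT U V (had A F) = E.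

(** A choice function, so that the solution depends on the weights [A] alone; after masking a row it
    is then independent of that row. The default 0 is taken only when there is no solution. *)
Definition sol U V E A : 'M[R]_n := xget 0 [set F | solves U V E A F]%classic.

Lemma contr_tr U V A : contr U V A -> contr V U A^T.
Proof.
move=> h Z; have := h Z^T; rewrite frob_tr -(frob_tr (PT _ _ _)) -PT_tr -had_tr.
by rewrite -PT_tr trmxK.
Qed.

Lemma solves_tr U V E A F : solves U V E A F -> solves V U E^T A^T F^T.
Proof.
by rewrite /solves => <-; rewrite had_tr PT_tr; apply/matrixP => i j; rewrite !mxE.
Qed.

Section Orthonormal.
Variables (U V : 'M[R]_(n, r)).
Hypothesis UU : U^T *m U = 1%:M.
Hypothesis VV : V^T *m V = 1%:M.
Notation P := (PT U V).

Lemma solves_PT E A F : P E = E -> solves U V E A F -> P F = F.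
Proof.
by move=> EE sF; rewrite -{1}(addrK (P (had A F)) F) sF raddfB /= EE PT_idem// -sF addrK.
Qed.

Lemma sol_solves E A : P E = E -> contr U V A -> solves U V E A (sol U V E A).
Proof.
move=> EE cA; rewrite /sol; case: xgetP => // h.
(* The inner P makes [contr] give injectivity on all matrices, not only on T; the preimage of E lies
   in T afterwards because E does. *)
pose L Z := Z + P (had A (P Z)).
have L_lin : linear L.
  by move=> a X Y; rewrite /L !linearP scalerDr addrACA.
pose HL := GRing.isLinear.Build R _ _ _ L L_lin.
pose LL : {linear 'M[R]_n -> 'M[R]_n} := HB.pack L HL.
have inj Z : LL Z = 0 -> Z = 0.
  move=> /eqP; rewrite /= /L addr_eq0 => /eqP e.
  have := cA Z; rewrite -(frobN (P _)) -e => h'.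
  by apply: frob_eq0; have := frob_ge0 Z; lra.
have [F hF] := linear_inj_surj inj E.
exfalso; apply: (h F); rewrite /= /solves.
have PF : P F = F.
  have e : F = E - P (had A (P F)) by rewrite -hF /= /L addrK.
  by rewrite e raddfB /= EE PT_idem.
by rewrite -[RHS]hF /= /L PF.
Qed.

Lemma contr_bound A Z X : contr U V A -> P Z = Z -> Z + P (had A Z) = X ->
  frob Z <= 2 * frob X.
Proof.
move=> cA ZZ e; have := cA Z; rewrite ZZ => h.
have : frob Z <= frob X + frob (P (had A Z)).
  by apply: le_trans (frobB _ _); rewrite -e addrK.
by lra.
Qed.

Lemma frob_mulV m (x : 'M[R]_(m, n)) : frob (x *m V) <= frob x.
Proof.
rewrite -frob_tr -(frob_tr x) trmx_mul -[leRHS]mul1r.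
by apply: opb_mulmx => //; apply: opb_trmx.
Qed.

Lemma frob_UTmul m (x : 'M[R]_(n, m)) : frob (U^T *m x) <= frob x.
Proof. by rewrite -[leRHS]mul1r; apply: opb_mulmx => //; apply: opb_trmx. Qed.

Lemma frob_row_mul m l k (X : 'M[R]_(m, l)) (Y : 'M[R]_(l, k)) i :
  frob (row i (X *m Y)) <= frob (row i X) * frob Y.
Proof. by rewrite row_mul frobM. Qed.

Lemma PT3 F : P F = F -> F = U *m (U^T *m F) + F *m V *m V^T - U *m (U^T *m F *m V) *m V^T.
Proof. by move=> FF; rewrite -{1}FF /PT !mulmxA. Qed.

Lemma frob_row_mulVt m (x : 'M[R]_(m, r)) : frob (x *m V^T) = frob x.
Proof. by rewrite -frob_tr trmx_mul trmxK frob_orth// frob_tr. Qed.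

(** In F = U U^T F + F V V^T - U U^T F V V^T the first and last terms carry row i of U, so their
    rows have leverage size for free. Only row i of F V needs an argument, and it is the one that
    [loo_row] identifies. *)
Lemma tangent_row F i : P F = F ->
  frob (row i F) <= 2 * frob (row i U) * frob F + frob (row i (F *m V)).
Proof.
move=> FF; rewrite {1}(PT3 FF).
have -> : row i (U *m (U^T *m F) + F *m V *m V^T - U *m (U^T *m F *m V) *m V^T) =
  row i (U *m (U^T *m F)) + row i (F *m V) *m V^T - row i (U *m (U^T *m F *m V)) *m V^T.
  by rewrite -!row_mul; apply/rowP => j; rewrite !mxE.
apply: le_trans (frobB _ _) _; apply: le_trans (lerD (frobD _ _) (lexx _)) _.
rewrite !frob_row_mulVt.
have h1 : frob (row i (U *m (U^T *m F))) <= frob (row i U) * frob F.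
  by apply: le_trans (frob_row_mul _ _ _) _; rewrite ler_wpM2l ?frob_ge0 ?frob_UTmul.
have h2 : frob (row i (U *m (U^T *m F *m V))) <= frob (row i U) * frob F.
  apply: le_trans (frob_row_mul _ _ _) _; rewrite ler_wpM2l ?frob_ge0//.
  by apply: le_trans (frob_mulV _) (frob_UTmul _).
by lra.
Qed.

Lemma normr_mx11 (x : 'M[R]_1) : `|x 0 0| = frob x.
Proof. by rewrite frobE /dot !big_ord1 -expr2 sqrtr_sqr. Qed.

Lemma entry_mul m (X : 'M[R]_(n, m)) (Y : 'M[R]_(m, n)) i j :
  `|(X *m Y) i j| <= frob (row i X) * frob (col j Y).
Proof.
have -> : (X *m Y) i j = (row i X *m col j Y) 0 0.
  by rewrite -row_mul colE mulmxA -colE !mxE.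
by rewrite normr_mx11 frobM.
Qed.

Lemma tangent_entry F i j : P F = F ->
  `|F i j| <= frob (row i U) * frob (U^T *m col j F) +
    frob (row i (F *m V)) * frob (row j V) + frob (row i U) * frob F * frob (row j V).
Proof.
move=> FF; rewrite {1}(PT3 FF).
have -> : (U *m (U^T *m F) + F *m V *m V^T - U *m (U^T *m F *m V) *m V^T) i j =
  (U *m (U^T *m F)) i j + (F *m V *m V^T) i j - (U *m (U^T *m F *m V) *m V^T) i j.
  by rewrite [LHS]mxE [X in X + _]mxE [X in _ + X]mxE.
apply: le_trans (ler_normB _ _) _; apply: lerD.
  apply: le_trans (ler_normD _ _) _; apply: lerD.
    by apply: le_trans (entry_mul _ _ _ _) _; rewrite !colE -mulmxA.
  by apply: le_trans (entry_mul _ _ _ _) _; rewrite -tr_row frob_tr.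
apply: le_trans (entry_mul _ _ _ _) _; rewrite -tr_row frob_tr.
rewrite ler_wpM2r ?frob_ge0//; apply: le_trans (frob_row_mul _ _ _) _.
rewrite ler_wpM2l ?frob_ge0//; exact: le_trans (frob_mulV _) (frob_UTmul _).
Qed.

Definition cmask i A := maskmx (fun k => k.1 != i) A.
Definition rmask i A := maskmx (fun k => k.1 == i) A.

Lemma maskmx_split i A : A = cmask i A + rmask i A.
Proof.
by apply/matrixP => k l; rewrite !mxE /=; case: (k == i); rewrite ?addr0 ?add0r.
Qed.

(* Row [i] of the sample is switched off, so row [i] of the equation is noiseless. *)
Lemma loo_row E A F i : solves U V E (cmask i A) F ->
  row i (F *m V) = row i (E *m V).
Proof.
rewrite /solves => <-; rewrite mulmxDl PTV// [in RHS]linearD /=.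
have -> : row i (had (cmask i A) F *m V) = 0; last by rewrite addr0.
rewrite row_mul (_ : row i _ = 0) ?mul0mx//.
by apply/rowP => j; rewrite !mxE eqxx mul0r.
Qed.

(** F - Fi solves the equation with weights A and right-hand side minus the noise of row i applied
    to Fi. That Fi and not F appears there is what makes the noise independent of its argument. *)
Lemma loo_diff E A F Fi i : P E = E -> contr U V A -> solves U V E A F ->
  solves U V E (cmask i A) Fi ->
  frob (F - Fi) <= 2 * frob (P (had (rmask i A) Fi)).
Proof.
move=> EE cA sF sFi; rewrite -(frobN (P _)); apply: (contr_bound cA).
  by rewrite raddfB /= (solves_PT EE sF) (solves_PT EE sFi).
have -> : P (had A (F - Fi)) = P (had A F) - P (had A Fi) by rewrite !raddfB.
have -> : P (had A Fi) = P (had (cmask i A) Fi) + P (had (rmask i A) Fi).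
  by rewrite -raddfD -hadDl -maskmx_split.
move: sF sFi; rewrite /solves; move: (P (had (rmask i A) Fi)) => c.
move: (P (had A F)) (P (had (cmask i A) Fi)) => a b sF sFi.
rewrite -[F](addrK a) sF -[Fi](addrK b) sFi.
by apply/matrixP => k l; rewrite !mxE; ring.
Qed.

End Orthonormal.

End LeaveOneOut.

(** * Rows and columns of the solution, through the leave-one-out solutions *)

Section LooBounds.
Variables (R : realType) (n r : nat).
Implicit Types (U V : 'M[R]_(n, r)) (A B E F Z : 'M[R]_n).

Definition pairlev U V i j : R := Num.sqrt (frob (row i U) ^+ 2 + frob (row j V) ^+ 2).

(* Leverage-normalized sizes of [F]; the padding by [K] keeps them positive. *)
Definition hent U V (K : R) i F : R := K +
  \big[Num.max/0]_j (`|F i j| / (frob (row i U) * pairlev U V i j)) +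
  frob (row i F) / frob (row i U).

Definition hcol U V (K : R) i F : R := K + K * frob F +
  \big[Num.max/0]_j (frob (U^T *m col j F) / pairlev U V i j).

(** The first clause involves only the other rows. The other two test row i of the sample against
    Fi, which does not depend on it; [A i j + 1] is the sampling weight d / q. *)
Definition loo_good U V E A (K c : R) i :=
  let Fi := sol U V E (cmask i A) in
  [/\ contr U V (cmask i A),
      frob (PT U V (had (rmask i A) Fi)) <= c / K * hent U V K i Fi * frob (row i U) &
      \sum_j (A i j + 1) * frob (U^T *m col j Fi) ^+ 2 <=
        frob Fi ^+ 2 + c * (hcol U V K i Fi / K) ^+ 2].

Lemma leU_pairlev U V i j : frob (row i U) <= pairlev U V i j.
Proof.
by rewrite -[leLHS]ger0_norm ?frob_ge0// -sqrtr_sqr ler_wsqrtr// lerDl sqr_ge0.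
Qed.

Lemma leV_pairlev U V i j : frob (row j V) <= pairlev U V i j.
Proof.
by rewrite -[leLHS]ger0_norm ?frob_ge0// -sqrtr_sqr ler_wsqrtr// lerDr sqr_ge0.
Qed.

Section OneSide.
Variables (U V : 'M[R]_(n, r)).
Hypothesis UU : U^T *m U = 1%:M.
Hypothesis VV : V^T *m V = 1%:M.
Hypothesis U_gt0 : forall i, 0 < frob (row i U).
Hypothesis V_gt0 : forall j, 0 < frob (row j V).
Variables (E A F : 'M[R]_n) (K c phi T : R).
Hypothesis EE : PT U V E = E.
Hypothesis K1 : 1 <= K.
Hypothesis c0 : 0 < c.
Hypothesis Erow : forall i, frob (row i E) <= K * frob (row i U).
Hypothesis Ephi : 2 * frob E <= phi.
Hypothesis phi1 : phi <= 1/1000.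
Hypothesis T0 : 0 <= T.
Hypothesis cA : contr U V A.
Hypothesis sF : solves U V E A F.
Hypothesis FU : forall j, frob (U^T *m col j F) <= (K + T) * frob (row j V).
Variable i : 'I_n.
Let Fi := sol U V E (cmask i A).
Hypothesis FiT : frob (F - Fi) <= T * frob (row i U).
Hypothesis good : loo_good U V E A K c i.
Notation u := (frob (row i U)).
Notation w j := (pairlev U V i j).

Let sFi : solves U V E (cmask i A) Fi.
Proof. by have [cAi _ _] := good; exact: (sol_solves UU VV EE cAi). Qed.

Let PFi : PT U V Fi = Fi.
Proof. exact: (solves_PT UU VV EE sFi). Qed.

Let w_gt0 j : 0 < w j.
Proof. exact: lt_le_trans (U_gt0 i) (leU_pairlev _ _ _ _). Qed.

Let Fi_phi : frob Fi <= phi.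
Proof.
have [cAi _ _] := good.
exact: le_trans (contr_bound cAi PFi sFi) Ephi.
Qed.

Let Fi_V : frob (row i (Fi *m V)) <= K * u.
Proof.
by rewrite (loo_row VV sFi) row_mul; apply: le_trans (frob_mulV VV _) (Erow i).
Qed.

(** The detour goes through F: its columns are bounded by [FU], which stems from leaving out
    columns, and Fi is within T u of it. Here row and column estimates feed each other. *)
Lemma loo_colU j : frob (U^T *m col j Fi) <= (K + 2 * T) * w j.
Proof.
have -> : U^T *m col j Fi = U^T *m col j F - U^T *m col j (F - Fi).
  by rewrite -mulmxBr; congr (_ *m _); apply/colP => k; rewrite !mxE; ring.
apply: le_trans (frobB _ _) _.
have h1 : frob (U^T *m col j (F - Fi)) <= T * w j.
  apply: le_trans (frob_UTmul UU _) _; apply: le_trans (frob_col_le _ _) _.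
  by apply: le_trans FiT _; rewrite ler_wpM2l// leU_pairlev.
have h2 : (K + T) * frob (row j V) <= (K + T) * w j.
  by rewrite ler_wpM2l ?leV_pairlev// addr_ge0// (le_trans ler01).
by have := FU j; lra.
Qed.

Lemma hent_bound : hent U V K i Fi <= 4 * K + 2 * T + 3 * phi.
Proof.
have K0 : 0 < K by exact: lt_le_trans K1.
have phi0 : 0 <= phi by exact: le_trans (frob_ge0 _) Fi_phi.
have u0 := U_gt0 i.
have h1 : frob (row i Fi) / u <= 2 * phi + K.
  rewrite ler_pdivrMr//; apply: le_trans (tangent_row UU VV i PFi) _.
  have := ler_wpM2l (ltW u0) Fi_phi; have := Fi_V; lra.
have h2 : \big[Num.max/0]_j (`|Fi i j| / (u * w j)) <= 2 * K + 2 * T + phi.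
  have M0 : 0 <= 2 * K + 2 * T + phi by rewrite !addr_ge0 ?mulr_ge0 ?ler0n// ltW.
  apply: bigmax_le => [//|j _].
  rewrite ler_pdivrMr ?mulr_gt0//; apply: le_trans (tangent_entry UU VV i j PFi) _.
  have w0 := w_gt0 j; have vw := leV_pairlev U V i j; have v0 := V_gt0 j.
  have e1 := ler_wpM2l (ltW u0) (loo_colU j).
  have e2 : frob (row i (Fi *m V)) * frob (row j V) <= K * u * w j.
    by apply: ler_pM; rewrite ?frob_ge0.
  have e3 : u * frob Fi * frob (row j V) <= u * phi * w j.
    by apply: ler_pM; rewrite ?mulr_ge0 ?frob_ge0// ler_wpM2l// ltW.
  by lra.
by rewrite /hent; lra.
Qed.

Lemma hcol_bound : hcol U V K i Fi <= 2 * K + 2 * T + K * phi.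
Proof.
have K0 : 0 < K by exact: lt_le_trans K1.
have h2 : \big[Num.max/0]_j (frob (U^T *m col j Fi) / w j) <= K + 2 * T.
  apply: bigmax_le => [|j _]; first by rewrite addr_ge0 ?mulr_ge0// ltW.
  by rewrite ler_pdivrMr// loo_colU.
have := ler_wpM2l (ltW K0) Fi_phi.
by rewrite /hcol; lra.
Qed.

(** The assumed bound T on |F - Fi| / u returns with a coefficient of order c / K, which closes the
    loop in [loo_certificate]. *)
Lemma loo_contract : frob (F - Fi) / u <= 2 * (c / K) * (4 * K + 2 * T + 3 * phi).
Proof.
have [_ hd _] := good; have K0 : 0 < K by exact: lt_le_trans K1.
rewrite ler_pdivrMr//; apply: le_trans (loo_diff UU VV EE cA sF sFi) _.
rewrite -[2 * (c / K) * _]mulrA -[leRHS]mulrA ler_wpM2l ?ler0n//; apply: le_trans hd _.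
by rewrite ler_wpM2r ?frob_ge0// ler_wpM2l ?hent_bound// divr_ge0 ?(ltW K0) ?(ltW c0).
Qed.

(** F is compared with Fi, whose weighted sum [loo_good] controls; the difference costs 2 T^2
    because each weight is at most 1 / u^2. The constant 50 is twice the square of the bound 5 on
    [hcol] / K. *)
Lemma loo_rowsum : T <= K -> (forall j, 0 <= A i j + 1) ->
  (forall j, (A i j + 1) * u ^+ 2 <= 1) ->
  \sum_j (A i j + 1) * frob (U^T *m col j F) ^+ 2 <=
    2 * phi ^+ 2 + 50 * c + 2 * T ^+ 2.
Proof.
move=> TK A0 A1; have [_ _ hs] := good; have K0 : 0 < K by exact: lt_le_trans K1.
have u0 := U_gt0 i.
have phi0 : 0 <= phi by exact: le_trans (frob_ge0 _) Fi_phi.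
have hK : hcol U V K i Fi / K <= 5.
  rewrite ler_pdivrMr//; apply: le_trans hcol_bound _.
  have : K * phi <= K * (1/1000) by rewrite ler_wpM2l// ltW.
  by lra.
have h0 : 0 <= hcol U V K i Fi / K.
  rewrite divr_ge0 ?(ltW K0)// /hcol !addr_ge0 ?mulr_ge0 ?frob_ge0 ?(ltW K0)//.
  exact: bigmax_ge_id.
have hKs : (hcol U V K i Fi / K) ^+ 2 <= 25.
  have : (hcol U V K i Fi / K) ^+ 2 <= 5 ^+ 2 by rewrite lerXn2r ?nnegrE.
  by rewrite !expr2; lra.
have hs2 : frob Fi ^+ 2 <= phi ^+ 2 by rewrite lerXn2r ?nnegrE ?frob_ge0.
have hc := ler_wpM2l (ltW c0) hKs.
have hD : \sum_j (A i j + 1) * frob (col j (F - Fi)) ^+ 2 <= T ^+ 2.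
  have uN0 : u != 0 by rewrite gt_eqF.
  have hu : 0 < u ^+ 2 by rewrite exprn_gt0.
  rewrite -(ler_pM2r hu) mulr_suml.
  apply: le_trans (_ : \sum_j frob (col j (F - Fi)) ^+ 2 <= _).
    apply: ler_sum => j _; rewrite mulrAC -[leRHS]mul1r ler_wpM2r ?sqr_ge0//.
  rewrite -frob_col -exprMn lerXn2r ?nnegrE ?frob_ge0//.
  by rewrite mulr_ge0 ?frob_ge0.
apply: le_trans (_ : \sum_j (2 * ((A i j + 1) * frob (U^T *m col j Fi) ^+ 2) +
    2 * ((A i j + 1) * frob (col j (F - Fi)) ^+ 2)) <= _).
  apply: ler_sum => j _; rewrite [X in _ <= X + _]mulrCA [X in _ <= _ + X]mulrCA -mulrDr.
  rewrite ler_wpM2l//.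
  have -> : U^T *m col j F = U^T *m col j Fi + U^T *m col j (F - Fi).
    by rewrite -mulmxDr; congr (_ *m _); apply/colP => k; rewrite !mxE; ring.
  apply: le_trans (frob_sqrD _ _) _; rewrite lerD2l ler_wpM2l ?ler0n//.
  by rewrite ler_sqr ?nnegrE ?frob_ge0// frob_UTmul.
rewrite big_split /= -!mulr_sumr; lra.
Qed.

End OneSide.

(* Transposing exchanges rows and columns: with column [j] switched off, the [j]-th
   column of [U^T F] is that of [U^T E]. *)
Lemma loo_transfer U V E A F (K t : R) j : U^T *m U = 1%:M -> V^T *m V = 1%:M ->
  solves V U E^T (cmask j A^T) (sol V U E^T (cmask j A^T)) ->
  frob (col j E) <= K * frob (row j V) ->
  frob (F^T - sol V U E^T (cmask j A^T)) <= t * frob (row j V) ->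
  frob (U^T *m col j F) <= (K + t) * frob (row j V).
Proof.
move=> UU VV sFj hE ht; set Fj := sol _ _ _ _ in sFj ht.
have -> : U^T *m col j F = (row j (E^T *m U) + row j ((F^T - Fj) *m U))^T.
  rewrite -(loo_row UU sFj) -linearD /= -mulmxDl addrC subrK.
  by rewrite tr_row trmx_mul trmxK !colE mulmxA.
rewrite frob_tr mulrDl; apply: le_trans (frobD _ _) _; apply: lerD.
  by rewrite row_mul; apply: le_trans (frob_mulV UU _) _; rewrite -tr_col frob_tr.
apply: le_trans ht; rewrite row_mul.
by apply: le_trans (frob_mulV UU _) _; exact: frob_row_le.
Qed.

End LooBounds.

(** * From weighted row and column sums to the operator norm *)

Section Certificate.
Variables (R : realType) (n r : nat).
Implicit Types (U V : 'M[R]_(n, r)) (A E F Z : 'M[R]_n).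

Lemma cauchy_weighted m (b x y : 'I_m -> R) : (forall j, 0 <= b j) ->
  (\sum_j b j * (x j * y j)) ^+ 2 <= (\sum_j b j * x j ^+ 2) * (\sum_j b j * y j ^+ 2).
Proof.
move=> b0; pose X := \row_j (Num.sqrt (b j) * x j); pose Y := \row_j (Num.sqrt (b j) * y j).
have E (z : 'I_m -> R) : \sum_j b j * z j ^+ 2 = frob (\row_j (Num.sqrt (b j) * z j)) ^+ 2.
  rewrite frob_sqrE big_ord1; apply: eq_bigr => j _.
  by rewrite mxE exprMn sqr_sqrtr.
have -> : \sum_j b j * (x j * y j) = dot X Y.
  rewrite /dot big_ord1; apply: eq_bigr => j _; rewrite !mxE mulrACA -expr2.
  by rewrite sqr_sqrtr.
rewrite !E -exprMn -real_normK ?num_real// ler_sqr ?nnegrE ?mulr_ge0 ?frob_ge0//.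
exact: normr_dot.
Qed.

(** The matrix (U x) e_j^T lies in T, and pairing it with its noise image gives at most |x|^2 / 2 by
    contraction. *)
Lemma contr_colsum U V A j (x : 'cV[R]_r) : U^T *m U = 1%:M -> V^T *m V = 1%:M ->
  contr U V A -> \sum_i (A i j + 1) * (U *m x) i 0 ^+ 2 <= 2 * frob x ^+ 2.
Proof.
move=> UU VV cA; pose Z := U *m x *m delta_mx (0 : 'I_1) j.
have ZE i k : Z i k = (U *m x) i 0 * (k == j)%:R.
  by rewrite mxE big_ord1 [delta_mx _ _ _ _]mxE eqxx.
have PUZ : U *m U^T *m Z = Z by rewrite /Z !mulmxA -(mulmxA U) UU mulmx1.
have PZ : PT U V Z = Z by rewrite PTE mulmxBl mul1mx PUZ subrr mul0mx addr0.
have fZ : frob Z = frob x by rewrite frob_mul_row frob_delta_row mulr1 frob_orth.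
have h : dot Z (had A Z) <= 1/2 * frob x ^+ 2.
  rewrite -{1}PZ dot_PT; apply: le_trans (dot_frob _ _) _.
  have := cA Z; rewrite PZ fZ => h.
  by have := ler_wpM2l (frob_ge0 x) h; rewrite expr2; lra.
have e : dot Z (had A Z) = \sum_i A i j * (U *m x) i 0 ^+ 2.
  apply: eq_bigr => i _; rewrite (bigD1 j)//= [X in _ + X]big1 ?addr0.
    by rewrite [had _ _ _ _]mxE !ZE eqxx !mulr1 mulrCA -expr2.
  by move=> k /negPf kj; rewrite ZE kj mulr0 mul0r.
have e2 : \sum_i (U *m x) i 0 ^+ 2 = frob x ^+ 2.
  rewrite -(frob_orth x UU) frob_sqrE; apply: eq_bigr => i _.
  by rewrite big_ord1.
under eq_bigr do rewrite mulrDl mul1r.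
rewrite big_split /= -e e2; have := sqr_ge0 (frob x); lra.
Qed.

(** A Schur-type test. Row j of C is its norm times a vector x_j that is unit or zero.
    Cauchy-Schwarz with weights A + 1 separates |C_j|^2, summed over j by [hC], from <U_i, x_j>^2
    y_j^2, summed over i by [contr_colsum]. *)
Lemma opb_factored U V A (C : 'M[R]_(n, r)) rho : U^T *m U = 1%:M -> V^T *m V = 1%:M ->
  contr U V A -> (forall i j, 0 <= A i j + 1) -> 0 <= rho ->
  (forall i, \sum_j (A i j + 1) * frob (row j C) ^+ 2 <= rho ^+ 2) ->
  opb (U *m C^T + had A (U *m C^T)) (2 * rho).
Proof.
move=> UU VV cA A0 rho0 hC y.
rewrite -ler_sqr ?nnegrE ?mulr_ge0 ?frob_ge0// frob_sqrE.
pose x j : 'cV[R]_r := (frob (row j C))^-1 *: (row j C)^T.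
have xC j : (row j C)^T = frob (row j C) *: x j.
  rewrite /x scalerA; have [e|e] := eqVneq (frob (row j C)) 0.
    by rewrite e mul0r scale0r (frob_eq0 e) trmx0.
  by rewrite mulfV// scale1r.
have x1 j : frob (x j) ^+ 2 <= 1.
  rewrite /x frobZ frob_tr; have [->|e] := eqVneq (frob (row j C)) 0.
    by rewrite mulr0 expr0n ler01.
  by rewrite ger0_norm ?invr_ge0 ?frob_ge0// mulVf// expr1n.
pose t i j := (U *m x j) i 0.
have UC i j : (U *m C^T) i j = frob (row j C) * t i j.
  rewrite /t; have -> : (U *m C^T) i j = (U *m (row j C)^T) i 0.
    by rewrite !mxE; apply: eq_bigr => k _; rewrite !mxE.
  by rewrite xC -scalemxAr mxE.
apply: le_trans (_ : \sum_i rho ^+ 2 * (\sum_j (A i j + 1) * (t i j * y j 0) ^+ 2) <= _).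
  apply: ler_sum => i _; rewrite big_ord1.
  have -> : ((U *m C^T + had A (U *m C^T)) *m y) i 0 =
      \sum_j (A i j + 1) * (frob (row j C) * (t i j * y j 0)).
    rewrite mxE; apply: eq_bigr => j _; rewrite mxE [had _ _ _ _]mxE UC; ring.
  apply: le_trans (cauchy_weighted _ _ (A0 i)) _.
  rewrite ler_wpM2r//; apply: sumr_ge0 => j _; by rewrite mulr_ge0 ?sqr_ge0.
rewrite -mulr_sumr exchange_big /=.
have -> : (2 * rho * frob y) ^+ 2 = rho ^+ 2 * (4 * frob y ^+ 2) by ring.
rewrite ler_wpM2l ?sqr_ge0// frob_sqrE mulr_sumr; apply: ler_sum => j _.
rewrite big_ord1; apply: le_trans (_ : (\sum_i (A i j + 1) * t i j ^+ 2) * y j 0 ^+ 2 <= _).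
  by rewrite mulr_suml; apply: ler_sum => i _; rewrite exprMn mulrA.
rewrite ler_wpM2r ?sqr_ge0//; apply: le_trans (contr_colsum _ _ UU VV cA) _.
by have := x1 j; lra.
Qed.

Lemma frob_row_trmul U F j : frob (row j (F^T *m U)) = frob (U^T *m col j F).
Proof. by rewrite -frob_tr tr_row trmx_mul trmxK !colE mulmxA. Qed.

(** [PT3] splits F into a U part, a V part and a core U (U^T F V) V^T. The first two use [hU] and
    [hV]; for the core the weighted sums follow from [contr_colsum] and the Frobenius norm of F
    alone. *)
Lemma opb_full U V A F rho phi : U^T *m U = 1%:M -> V^T *m V = 1%:M ->
  contr U V A -> (forall i j, 0 <= A i j + 1) -> PT U V F = F -> 0 <= rho ->
  (forall i, \sum_j (A i j + 1) * frob (U^T *m col j F) ^+ 2 <= rho ^+ 2) ->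
  (forall j, \sum_i (A i j + 1) * frob (row i (F *m V)) ^+ 2 <= rho ^+ 2) ->
  frob F <= phi ->
  opb (F + had A F) (4 * rho + 4 * phi).
Proof.
move=> UU VV cA A0 PF rho0 hU hV Fphi.
have phi0 : 0 <= phi by exact: le_trans (frob_ge0 _) Fphi.
pose S X := X + had A X.
have SD X Y : S (X + Y) = S X + S Y by rewrite /S raddfD addrACA.
have SN X : S (- X) = - S X by rewrite /S raddfN opprD.
have {1}-> : F + had A F = S F by [].
have -> : F = U *m (F^T *m U)^T + (V *m (F *m V)^T)^T - U *m (V *m (U^T *m F *m V)^T)^T.
  by rewrite {1}(PT3 PF) !trmx_mul !trmxK !mulmxA.
rewrite !SD SN.
have -> : 4 * rho + 4 * phi = 2 * rho + 2 * rho + 2 * (2 * phi) by ring.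
apply: opbD; first apply: opbD.
- apply: (opb_factored UU VV cA A0 rho0) => i; apply: le_trans (hU i).
  by apply: ler_sum => j _; rewrite frob_row_trmul.
- have -> : S (V *m (F *m V)^T)^T = (V *m (F *m V)^T + had A^T (V *m (F *m V)^T))^T.
    by rewrite [RHS]linearD /= -had_tr trmxK.
  apply: opb_tr; first by rewrite mulr_ge0.
  apply: (opb_factored VV UU (contr_tr cA)) => // [i j|j]; first by rewrite mxE.
  by apply: le_trans (hV j); apply: ler_sum => i _; rewrite mxE.
apply: opbN; apply: (opb_factored UU VV cA A0) => [|i]; first by rewrite mulr_ge0.
set T := U^T *m F *m V.
have cAt := contr_tr cA.
apply: le_trans (_ : \sum_k \sum_j (A i j + 1) * (V *m col k T^T) j 0 ^+ 2 <= _).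
  rewrite exchange_big /=; apply: ler_sum => j _; rewrite -mulr_sumr ler_wpM2l//.
  rewrite frob_rowE; apply: ler_sum => k _.
  by rewrite le_eqVlt; apply/orP; left; apply/eqP; rewrite !mxE; congr (_ ^+ 2);
    apply: eq_bigr => l _; rewrite !mxE.
apply: le_trans (_ : \sum_k 2 * frob (col k T^T) ^+ 2 <= _).
  apply: ler_sum => k _; have := contr_colsum i (col k T^T) VV UU cAt.
  by under eq_bigr do rewrite mxE.
rewrite -mulr_sumr -frob_col frob_tr.
have : frob T <= frob F by apply: le_trans (frob_mulV VV _) (frob_UTmul UU _).
move=> /le_trans/(_ Fphi) h.
have : frob T ^+ 2 <= phi ^+ 2 by rewrite lerXn2r ?nnegrE ?frob_ge0.
have := sqr_ge0 phi; rewrite exprMn (expr2 2); lra.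
Qed.

Lemma loo_certificate U V E A (K c : R) : U^T *m U = 1%:M -> V^T *m V = 1%:M ->
  (forall i, 0 < frob (row i U)) -> (forall j, 0 < frob (row j V)) ->
  PT U V E = E -> 1 <= K -> 0 < c <= (1/100) ^+ 4 ->
  (forall i, frob (row i E) <= K * frob (row i U)) ->
  (forall j, frob (col j E) <= K * frob (row j V)) ->
  2 * frob E <= 1/1000 -> contr U V A ->
  (forall i, loo_good U V E A K c i) -> (forall j, loo_good V U E^T A^T K c j) ->
  (forall i j, 0 <= A i j + 1) ->
  (forall i j, (A i j + 1) * (frob (row i U) ^+ 2 + frob (row j V) ^+ 2) <= 1) ->
  exists F, [/\ PT U V F = F, solves U V E A F & opb (F + had A F) (1/32)].
Proof.
move=> UU VV U0 V0 EE K1 /andP[c0 c7] Er Ec Ephi cA gU gV A0 A1.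
set phi : R := 1/1000 in Ephi.
have phi0 : 0 <= phi by rewrite /phi; lra.
have K0 : 0 < K by exact: lt_le_trans K1.
have sF := sol_solves UU VV EE cA; set F := sol U V E A in sF.
have PF := solves_PT UU VV EE sF.
have EEt : PT V U E^T = E^T by rewrite PT_tr EE.
have cAt := contr_tr cA; have sFt := solves_tr sF.
pose dU i := frob (F - sol U V E (cmask i A)) / frob (row i U).
pose dV j := frob (F^T - sol V U E^T (cmask j A^T)) / frob (row j V).
(* One maximum over rows and columns, since each family is estimated through the other. *)
pose T := Num.max (\big[Num.max/0]_i dU i) (\big[Num.max/0]_j dV j).
have T0 : 0 <= T by rewrite le_max bigmax_ge_id.
have dUT i : frob (F - sol U V E (cmask i A)) <= T * frob (row i U).
  rewrite -ler_pdivrMr// le_max; apply/orP; left; exact: (le_bigmax _ dU i).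
have dVT j : frob (F^T - sol V U E^T (cmask j A^T)) <= T * frob (row j V).
  rewrite -ler_pdivrMr// le_max; apply/orP; right; exact: (le_bigmax _ dV j).
have sU i : solves U V E (cmask i A) (sol U V E (cmask i A)).
  by have [h _ _] := gU i; exact: sol_solves.
have sV j : solves V U E^T (cmask j A^T) (sol V U E^T (cmask j A^T)).
  by have [h _ _] := gV j; exact: sol_solves.
have FU j : frob (U^T *m col j F) <= (K + T) * frob (row j V).
  exact: (loo_transfer UU VV (sV j)).
have FV i : frob (V^T *m col i F^T) <= (K + T) * frob (row i U).
  apply: (loo_transfer VV UU (E := E^T) (A := A^T)); rewrite ?trmxK.
  - exact: sU.
  - by rewrite -tr_row frob_tr.
  - exact: dUT.
have Ert j : frob (row j E^T) <= K * frob (row j V) by rewrite -tr_col frob_tr.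
have Ephit : 2 * frob E^T <= phi by rewrite frob_tr.
have phiE : phi <= 1/1000 by [].
set b := 2 * (c / K) * (4 * K + 2 * T + 3 * phi).
have Tb : T <= b.
  have b0 : 0 <= b.
    by rewrite /b !mulr_ge0 ?addr_ge0 ?mulr_ge0 ?invr_ge0 ?(ltW c0) ?(ltW K0) ?divr_ge0 ?ler0n.
  rewrite ge_max; apply/andP; split; apply: bigmax_le => // i _.
    exact: (loo_contract UU VV U0 V0 EE K1 c0 Er Ephi T0 cA sF FU (dUT i) (gU i)).
  exact: (loo_contract VV UU V0 U0 EEt K1 c0 Ert Ephit T0 cAt sFt FV (dVT i) (gV i)).
(* [Tb] reads T <= 8 c + (c / K) (4 T + 6 phi); as c <= 1/100, the T on the right is absorbed. *)
have Tc : T <= 20 * c.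
  have i1 : K^-1 <= 1 by rewrite invf_le1.
  have i0 : 0 < K^-1 by rewrite invr_gt0.
  have iK : K^-1 * K = 1 by rewrite mulVf// gt_eqF.
  have e : b = 8 * c * (K^-1 * K) + K^-1 * c * (4 * T + 6 * phi) by rewrite /b; ring.
  rewrite iK mulr1 in e.
  have e2 : K^-1 * c * (4 * T + 6 * phi) <= 1 * c * (4 * T + 6 * phi).
    have c1' : K^-1 * c <= 1 * c by rewrite ler_wpM2r// ltW.
    have s0 : 0 <= 4 * T + 6 * phi by lra.
    by rewrite ler_wpM2r.
  have cT : c * T <= 1/100 * T.
    by rewrite ler_wpM2r//; apply: le_trans c7 _; rewrite !exprS expr0; lra.
  rewrite e in Tb.
  have : c * phi <= c * 1 by rewrite ler_wpM2l ?(ltW c0)//; rewrite /phi; lra.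
  lra.
have c1 : c <= 1/100 * (1/100 * (1/100 * (1/100))).
  by move: c7; rewrite !exprS expr0 mulr1.
have TK : T <= K by lra.
(* The term 50 c is the one that dictates how small c must be. *)
have rho_bound : 2 * phi ^+ 2 + 50 * c + 2 * T ^+ 2 <= (1/300) ^+ 2 :> R.
  have T2 : T ^+ 2 <= (20 * c) ^+ 2 by rewrite lerXn2r ?nnegrE// mulr_ge0// ltW.
  have c2 : c ^+ 2 <= c * 1 by rewrite expr2 ler_wpM2l ?(ltW c0)//; lra.
  rewrite exprMn in T2; rewrite /phi !expr2 in T2 c2 *; lra.
have A1U i j : (A i j + 1) * frob (row i U) ^+ 2 <= 1.
  by apply: le_trans (A1 i j); rewrite ler_wpM2l// lerDl sqr_ge0.
have A1V j i : (A^T j i + 1) * frob (row j V) ^+ 2 <= 1.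
  by rewrite mxE; apply: le_trans (A1 i j); rewrite ler_wpM2l// lerDr sqr_ge0.
have A0t j i : 0 <= A^T j i + 1 by rewrite mxE.
have hU i : \sum_j (A i j + 1) * frob (U^T *m col j F) ^+ 2 <= (1/300) ^+ 2.
  apply: le_trans rho_bound.
  exact: (loo_rowsum UU VV U0 EE K1 c0 Ephi phiE T0 FU (dUT i) (gU i) TK (A0 i) (A1U i)).
have hV j : \sum_i (A i j + 1) * frob (row i (F *m V)) ^+ 2 <= (1/300) ^+ 2.
  apply: le_trans rho_bound.
  have := loo_rowsum VV UU V0 EEt K1 c0 Ephit phiE T0 FV (dVT j) (gV j) TK (A0t j) (A1V j).
  apply: le_trans; apply: ler_sum => i _; rewrite mxE ler_wpM2l//.
  by rewrite -(frob_row_trmul V F^T i) trmxK.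
exists F; split => //.
have Fphi : frob F <= phi by exact: le_trans (contr_bound cA PF sF) Ephi.
have r0 : (0 : R) <= 1/300 by lra.
by apply: opb_le (opb_full UU VV cA A0 PF r0 hU hV Fphi); rewrite /phi; lra.
Qed.

End Certificate.

(** * Probability that the last step fails *)

Lemma leq_expn3 m : (m <= m ^ 3)%N /\ (m * m <= m ^ 3)%N.
Proof.
case: m => [//|m]; rewrite -{1}(expn1 m.+1) mulnn !leq_pexp2l//.
Qed.

(** Dimension factors of the three Bernstein bounds behind [loo_good]. *)
Lemma loo_row_count m : (m * m + ((m * m).+1 + (1 * 1).+1) <= 2 * m ^ 2 + 3)%N.
Proof. rewrite -mulnn; lia. Qed.

Lemma loo_count m : (m * m + ((2 * m ^ 2 + 3) * m + (2 * m ^ 2 + 3) * m) <= 11 * m ^ 3)%N.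
Proof.
have [n3 n2] := leq_expn3 m; rewrite mulnDl -mulnA -expnSr.
by move: (m * m)%N (m ^ 3)%N n3 n2 => a b; lia.
Qed.

Section FinalStep.
Variables (R : realType) (n r : nat).
Notation I := ('I_n * 'I_n)%type.
Implicit Types (U V : 'M[R]_(n, r)) (q : I -> R) (d : {ffun I -> bool}).

Definition certificate U V d (W : 'M[R]_n) (t : R) :=
  (exists Y : 'M[R]_n, [/\ forall i j, ~~ d (i, j) -> Y i j = 0,
      PT U V Y = W & opb (PTperp U V Y) t]) /\
  (forall Z : 'M[R]_n, PT U V Z = Z -> (forall i j, d (i, j) -> Z i j = 0) -> Z = 0).

Section Rows.
Variables (U V : 'M[R]_(n, r)).
Hypothesis UU : U^T *m U = 1%:M.
Hypothesis VV : V^T *m V = 1%:M.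
Hypothesis U_gt0 : forall i, 0 < frob (row i U).
Variable q : I -> R.
Hypothesis q01 : forall k, 0 < q k <= 1.
Variables (G K c : R) (s : nat).
Hypothesis qG : forall i j, G * (frob (row i U) ^+ 2 + frob (row j V) ^+ 2) <= q (i, j).
Hypothesis K1 : 1 <= K.
Hypothesis c01 : 0 < c <= 1/100.
Hypothesis hG : 256 * s.+1%:R * K ^+ 2 <= c ^+ 2 * G.

Let c_gt0 : 0 < c. Proof. by case/andP: c01. Qed.
Let K_gt0 : 0 < K. Proof. exact: lt_le_trans K1. Qed.

Lemma gain_gt0 : 0 < G.
Proof.
have : 0 < c ^+ 2 * G by apply: lt_le_trans hG; rewrite !mulr_gt0 ?exprn_gt0 ?ltr0n.
by rewrite pmulr_rgt0 ?exprn_gt0.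
Qed.

Let Gi0 : 0 < G^-1. Proof. by rewrite invr_gt0 gain_gt0. Qed.

Lemma gain_inv : 256 * (s.+1%:R * G^-1) <= (c / K) ^+ 2.
Proof.
rewrite expr_div_n ler_pdivlMr ?exprn_gt0// -(ler_pM2r gain_gt0).
rewrite [leLHS](_ : _ = 256 * s.+1%:R * K ^+ 2) //.
by field; rewrite gt_eqF ?gain_gt0.
Qed.

Lemma cK_le : (c / K) ^+ 2 <= 1/10000.
Proof.
have : (c / K) ^+ 2 <= (1/100) ^+ 2.
  rewrite lerXn2r ?nnegrE ?divr_ge0 ?(ltW c_gt0) ?(ltW K_gt0)//.
  case/andP: c01 => _; apply: le_trans; rewrite ler_pdivrMr//.
  by rewrite ler_peMr// ltW.
by rewrite !expr2; lra.
Qed.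

(** For x = (s + 1) / G the left side is 128 (x^2 + x), at most 256 x since x <= 1; this explains
    the 256 in [hG]. The ratio c / K is the relative deviation that the oversampling permits. *)
Lemma gain_quadratic : 128 * (s.+1%:R ^+ 2 * G^-1 ^+ 2 + s.+1%:R * G^-1) <= (c / K) ^+ 2.
Proof.
rewrite -exprMn; have := gain_inv; have := cK_le.
have : 0 <= s.+1%:R * G^-1 by rewrite mulr_ge0// ltW.
move: (s.+1%:R * G^-1) ((c / K) ^+ 2) => x y x0 y1 xy.
have : x * x <= x * 1 by rewrite ler_wpM2l//; lra.
by rewrite expr2; lra.
Qed.

Lemma contr_prob (S : pred I) : Pr q (fun d => ~ contr U V (maskmx S (xi q d)))
  <= (n * n)%:R * 2 ^- s.+1.
Proof.
apply: (PT_isometry_prob UU VV q01 gain_gt0 qG) => //.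
apply: le_trans gain_quadratic _; apply: le_trans cK_le _.
by rewrite expr2; lra.
Qed.

Lemma hent_ge (F : 'M[R]_n) i : 0 < hent U V K i F.
Proof.
rewrite /hent ltr_wpDr ?divr_ge0 ?frob_ge0// ltr_wpDr//; exact: bigmax_ge_id.
Qed.

Lemma hent_entry (F : 'M[R]_n) i j : `|F i j| <= hent U V K i F * (frob (row i U) * pairlev U V i j).
Proof.
have w0 : 0 < frob (row i U) * pairlev U V i j.
  by rewrite mulr_gt0//; exact: lt_le_trans (U_gt0 i) (leU_pairlev _ _ _ _).
rewrite -ler_pdivrMr//.
apply: le_trans (le_bigmax 0 (fun j => `|F i j| / (frob (row i U) * pairlev U V i j)) j) _.
by rewrite /hent addrAC lerDr addr_ge0 ?divr_ge0 ?frob_ge0// ltW.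
Qed.

Lemma hent_row (F : 'M[R]_n) i : frob (row i F) <= hent U V K i F * frob (row i U).
Proof.
rewrite -ler_pdivrMr// /hent lerDr addr_ge0 ?(ltW K_gt0)//; exact: bigmax_ge_id.
Qed.

Lemma pairlev_sqr i j : pairlev U V i j ^+ 2 = frob (row i U) ^+ 2 + frob (row j V) ^+ 2.
Proof. by rewrite sqr_sqrtr// addr_ge0 ?sqr_ge0. Qed.

Lemma pairlev_q i j : pairlev U V i j ^+ 2 <= G^-1 * q (i, j).
Proof. by rewrite pairlev_sqr lev_le_q// gain_gt0. Qed.

(** Bernstein for the matrices F_ij P_T(e_i e_j^T) of row i: the entry part of [hent] bounds their
    size by h u q / G, its row part bounds the variance by (h u)^2 / G. *)
Lemma loo_ent_prob i (F : 'M[R]_n) : Pr q (fun d => ~ (frob (PT U V (had (rmask i (xi q d)) F)) <=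
    c / K * hent U V K i F * frob (row i U))) <= (n * n).+1%:R * 2 ^- s.+1.
Proof.
set h := hent U V K i F; set u := frob (row i U).
have h0 : 0 < h by exact: hent_ge. have u0 : 0 < u by exact: U_gt0.
have q0 k : 0 < q k by have /andP[] := q01 k.
pose x (k : I) := (if k.1 == i then F k.1 k.2 else 0) *: PT U V (delta_mx k.1 k.2).
have dW k l : frob (PT U V (delta_mx k l)) <= pairlev U V k l.
  rewrite -ler_sqr ?nnegrE ?frob_ge0 ?sqrtr_ge0// pairlev_sqr.
  exact: frob_PT_delta.
have B0 : 0 < h * u * G^-1 by rewrite !mulr_gt0.
apply: le_trans (@bernstein_frob _ _ _ q01 _ _ x _ (G^-1 * (h * u) ^+ 2) s (c / K * h * u) B0 _ _ _ _).
- apply: le_Pr => [|d hd ho]; first exact: p01_isprob.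
  apply: hd; apply: le_trans ho; rewrite linear_had.
  rewrite le_eqVlt; apply/orP; left; apply/eqP; congr frob; apply: eq_bigr => -[k l] _ /=.
  rewrite /x /= [rmask _ _ _ _]mxE [xi _ _ _ _]mxE /=.
  by case: ifP => _; rewrite ?mul0r ?scale0r ?scaler0// scalerA.
- move=> -[k l]; rewrite /x /= frobZ; case: eqP => [->|_]; last first.
    by rewrite normr0 mul0r mulr_ge0// ltW.
  apply: le_trans (ler_pM (normr_ge0 _) (frob_ge0 _) (hent_entry F i l) (dW i l)) _.
  rewrite -/h -/u -!mulrA -(expr2 (pairlev _ _ _ _)) !ler_wpM2l ?(ltW h0) ?(ltW u0)//.
  exact: pairlev_q.
- rewrite sum_pair /= (bigD1 i)//= [X in _ + X]big1 ?addr0; last first.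
    move=> k /negPf ki; rewrite big1// => l _.
    by rewrite /x /= ki scale0r frob0 expr0n mul0r.
  apply: le_trans (_ : \sum_j F i j ^+ 2 * G^-1 <= _).
    apply: ler_sum => j _; rewrite /x /= eqxx frobZ exprMn real_normK ?num_real// -mulrA.
    rewrite ler_wpM2l ?sqr_ge0// ler_pdivrMr//; apply: le_trans (pairlev_q i j).
    by rewrite ler_sqr ?nnegrE ?frob_ge0 ?sqrtr_ge0.
  rewrite -mulr_suml mulrC ler_wpM2l ?(ltW Gi0)// -frob_rowE.
  by rewrite ler_sqr ?nnegrE ?frob_ge0 ?hent_row// mulr_ge0 ?ltW.
- by rewrite !mulr_gt0 ?invr_gt0.
rewrite [leLHS](_ : _ = 128 * (s.+1%:R ^+ 2 * G^-1 ^+ 2 + s.+1%:R * G^-1) * (h * u) ^+ 2); last by ring.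
rewrite [leRHS](_ : _ = (c / K) ^+ 2 * (h * u) ^+ 2); last by ring.
by rewrite ler_wpM2r ?sqr_ge0 ?gain_quadratic.
Qed.

(** Scalar Bernstein for the sum of (d/q - 1) a_j^2. The maximum in [hcol] gives a_j^2 <= h^2 q / G;
    the variance is at most (h^2 / G) |F|^2, and the summand K |F| of [hcol] turns |F| into h /
    K. *)
Lemma loo_sum_prob i (F : 'M[R]_n) : Pr q (fun d => ~ (\sum_j (xi q d i j + 1) * frob (U^T *m col j F) ^+ 2 <=
        frob F ^+ 2 + c * (hcol U V K i F / K) ^+ 2)) <= (1 * 1).+1%:R * 2 ^- s.+1.
Proof.
set h := hcol U V K i F; pose a j := frob (U^T *m col j F).
have q0 k : 0 < q k by have /andP[] := q01 k.
have M0 : 0 <= \big[Num.max/0]_j (a j / pairlev U V i j) by exact: bigmax_ge_id.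
have KF : 0 <= K * frob F by rewrite mulr_ge0 ?frob_ge0// ltW.
have h0 : 0 < h by rewrite /h /hcol -addrA ltr_wpDr// addr_ge0.
have w0 j : 0 < pairlev U V i j by exact: lt_le_trans (U_gt0 i) (leU_pairlev _ _ _ _).
have ah j : a j ^+ 2 <= h ^+ 2 * G^-1 * q (i, j).
  apply: le_trans (_ : (h * pairlev U V i j) ^+ 2 <= _).
    rewrite ler_sqr ?nnegrE ?frob_ge0// ?mulr_ge0 ?(ltW h0) ?(ltW (w0 _))//.
    rewrite -ler_pdivrMr//; apply: le_trans (le_bigmax 0 (fun j => a j / pairlev U V i j) j) _.
    by rewrite /h /hcol lerDr addr_ge0// ltW.
  by rewrite exprMn -mulrA ler_wpM2l ?sqr_ge0// pairlev_q.
have sa : \sum_j a j ^+ 2 <= frob F ^+ 2.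
  rewrite (eq_bigr (fun j => frob (col j (U^T *m F)) ^+ 2)) -?frob_col; last first.
    by move=> j _; rewrite /a !colE mulmxA.
  by rewrite ler_sqr ?nnegrE ?frob_ge0// frob_UTmul.
have KFh : frob F <= h / K.
  by rewrite ler_pdivlMr// mulrC /h /hcol addrAC lerDr addr_ge0// ltW.
pose x (k : I) : 'M[R]_1 := (if k.1 == i then a k.2 ^+ 2 else 0)%:M.
have fx y : frob (y%:M : 'M[R]_1) = `|y|.
  by rewrite frobE /dot !big_ord1 !mxE mulr1n -expr2 sqrtr_sqr.
have B0 : 0 < h ^+ 2 * G^-1 by rewrite mulr_gt0 ?exprn_gt0.
apply: le_trans (@bernstein_frob _ _ _ q01 _ _ x _ (h ^+ 2 * G^-1 * frob F ^+ 2) s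
   (c * (h / K) ^+ 2) B0 _ _ _ _).
- apply: le_Pr => [|d hd ho]; first exact: p01_isprob.
  apply: hd.
  have e : bsum q x d = (\sum_j xi q d i j * a j ^+ 2)%:M.
    rewrite /bsum sum_pair (bigD1 i)//= [X in _ + X]big1 ?addr0; last first.
      move=> k /negPf ki; rewrite big1// => l _.
      by rewrite /x /= ki raddf0 scaler0.
    rewrite raddf_sum; apply: eq_bigr => j _.
    by rewrite /x /= eqxx mxE scale_scalar_mx.
  rewrite e fx in ho; have := le_trans (ler_norm _) ho => {}ho.
  under eq_bigr do rewrite mulrDl mul1r.
  by rewrite big_split /= addrC lerD.
- move=> -[k l]; rewrite /x fx /=; case: eqP => [->|_].
    by rewrite ger0_norm ?sqr_ge0.
  by rewrite normr0 mulr_ge0// ltW.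
- rewrite sum_pair /= (bigD1 i)//= [X in _ + X]big1 ?addr0; last first.
    move=> k /negPf ki; rewrite big1// => l _.
    by rewrite /x fx /= ki normr0 expr0n mul0r.
  apply: le_trans (_ : \sum_j a j ^+ 2 * (h ^+ 2 * G^-1) <= _).
    apply: ler_sum => j _; rewrite /x fx /= eqxx ger0_norm ?sqr_ge0// (expr2 (a j ^+ 2)) -mulrA.
    by rewrite ler_wpM2l ?sqr_ge0// ler_pdivrMr.
  by rewrite -mulr_suml mulrC ler_wpM2l// ltW.
- by rewrite mulr_gt0 ?exprn_gt0 ?divr_gt0.
have hq := gain_quadratic; have Fh : frob F ^+ 2 <= (h / K) ^+ 2.
  by rewrite ler_sqr ?nnegrE ?frob_ge0// divr_ge0 ?ltW.
have G0 : 0 <= s.+1%:R * G^-1 by rewrite mulr_ge0// ltW.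
set y := h / K in Fh *; have hy : h = y * K by rewrite /y divfK// gt_eqF.
apply: (@le_trans _ _ (128 * (s.+1%:R ^+ 2 * (h ^+ 2 * G^-1) ^+ 2 + s.+1%:R * (h ^+ 2 * G^-1 * y ^+ 2)))).
  rewrite ler_wpM2l ?ler0n// lerD2l ler_wpM2l ?ler0n// ler_wpM2l//.
  by rewrite mulr_ge0 ?sqr_ge0 ?ltW.
have gi := gain_inv; rewrite expr_div_n ler_pdivlMr ?exprn_gt0// in gi.
rewrite hy; set g := s.+1%:R * G^-1 in gi G0 hq *.
rewrite [leLHS](_ : _ = 128 * ((g * K ^+ 2) ^+ 2 + g * K ^+ 2) * (y ^+ 2) ^+ 2); last by rewrite /g; ring.
rewrite [leRHS](_ : _ = c ^+ 2 * (y ^+ 2) ^+ 2); last by ring.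
rewrite ler_wpM2r ?sqr_ge0//.
have z0 : 0 <= g * K ^+ 2 by rewrite mulr_ge0 ?sqr_ge0.
rewrite -mulrA in gi; move: (g * K ^+ 2) gi z0 => z gi z0.
have c2 : c ^+ 2 <= 1 by rewrite expr_le1 ?(ltW c_gt0)//; case/andP: c01 => _; lra.
have : z * z <= z * 1 by rewrite ler_wpM2l//; lra.
by rewrite (expr2 z); lra.
Qed.

Lemma loo_good_prob (E : 'M[R]_n) i : Pr q (fun d => ~ loo_good U V E (xi q d) K c i) <=
  (2 * n ^ 2 + 3)%:R * 2 ^- s.+1.
Proof.
have qP := p01_isprob q01.
pose phi d := sol U V E (cmask i (xi q d)).
(* The masked weights, hence the chosen solution, do not read row i. *)
have hphi d d' : (forall k : I, ~~ (k.1 == i) -> d k = d' k) -> phi d = phi d'.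
  move=> dd; rewrite /phi (_ : cmask i (xi q d) = cmask i (xi q d'))//.
  apply/matrixP => k l; rewrite !mxE /=; case: eqP => //= /eqP ki.
  by rewrite dd.
have P1 : Pr q (fun d => ~ (frob (PT U V (had (rmask i (xi q d)) (phi d))) <=
    c / K * hent U V K i (phi d) * frob (row i U))) <= (n * n).+1%:R * 2 ^- s.+1.
  apply: (@Pr_indep _ _ _ _ (fun k => k.1 == i) phi (fun F d =>
     ~ (frob (PT U V (had (rmask i (xi q d)) F)) <=
    c / K * hent U V K i F * frob (row i U))) _ qP hphi) => [F d d' dd|F]; last exact: loo_ent_prob.
  rewrite (_ : rmask i (xi q d) = rmask i (xi q d'))//.
  apply/matrixP => k l; rewrite !mxE /=; case: eqP => //= ki.
  by rewrite dd//= ki.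
have P2 : Pr q (fun d => ~ (\sum_j (xi q d i j + 1) * frob (U^T *m col j (phi d)) ^+ 2 <=
        frob (phi d) ^+ 2 + c * (hcol U V K i (phi d) / K) ^+ 2)) <= (1 * 1).+1%:R * 2 ^- s.+1.
  apply: (@Pr_indep _ _ _ _ (fun k => k.1 == i) phi (fun F d =>
     ~ (\sum_j (xi q d i j + 1) * frob (U^T *m col j F) ^+ 2 <=
        frob F ^+ 2 + c * (hcol U V K i F / K) ^+ 2)) _ qP hphi) => [F d d' dd|F];
    last exact: loo_sum_prob.
  rewrite (eq_bigr (fun j => (xi q d' i j + 1) * frob (U^T *m col j F) ^+ 2))// => j _.
  by rewrite !mxE dd.
have P3 := contr_prob (fun k => k.1 != i).
apply: le_trans (_ : Pr q (fun d => ~ contr U V (cmask i (xi q d)) \/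
   (~ (frob (PT U V (had (rmask i (xi q d)) (phi d))) <=
    c / K * hent U V K i (phi d) * frob (row i U)) \/
    ~ (\sum_j (xi q d i j + 1) * frob (U^T *m col j (phi d)) ^+ 2 <=
        frob (phi d) ^+ 2 + c * (hcol U V K i (phi d) / K) ^+ 2))) <= _).
  apply: le_Pr => // d hd.
  case: (pselect (contr U V (cmask i (xi q d)))) => h1; last by left.
  right; apply: contrapT => /not_orP[/contrapT h2 /contrapT h3]; exact: hd.
apply: le_trans (Pr_or _ _ qP) _; apply: le_trans (lerD P3 (le_trans (Pr_or _ _ qP) (lerD P1 P2))) _.
have e0 : (0 : R) <= 2 ^- s.+1 by rewrite invr_ge0 exprn_ge0.
rewrite -!mulrDl -!natrD; apply: (ler_wpM2r e0); rewrite ler_nat.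
exact: loo_row_count.
Qed.

End Rows.

Lemma xi_swap q d : (xi q d)^T =
  xi (fun k => q (k.2, k.1)) [ffun k : I => d (k.2, k.1)].
Proof. by apply/matrixP => i j; rewrite !mxE ffunE. Qed.

Lemma final_step U V q (G K c : R) s (E : 'M[R]_n) : U^T *m U = 1%:M -> V^T *m V = 1%:M ->
  (forall i, 0 < frob (row i U)) -> (forall j, 0 < frob (row j V)) ->
  (forall k, 0 < q k <= 1) ->
  (forall i j, G * (frob (row i U) ^+ 2 + frob (row j V) ^+ 2) <= q (i, j)) ->
  PT U V E = E -> 1 <= K -> 0 < c <= (1/100) ^+ 4 ->
  256 * s.+1%:R * K ^+ 2 <= c ^+ 2 * G ->
  (forall i, frob (row i E) <= K * frob (row i U)) ->
  (forall j, frob (col j E) <= K * frob (row j V)) ->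
  2 * frob E <= 1/1000 ->
  Pr q (fun d => ~ certificate U V d E (1/32)) <= (11 * n ^ 3)%:R * 2 ^- s.+1.
Proof.
move=> UU VV U0 V0 q01 qG EE K1 c7 hG Er Ec Ephi.
have qP := p01_isprob q01.
have c01 : 0 < c <= 1/100.
  case/andP: c7 => -> /= h; apply: le_trans h _; rewrite !exprS expr0; lra.
have G0 := gain_gt0 K1 c01 hG.
have G1 : 1 <= G.
  have c2 : c ^+ 2 <= 1.
    by rewrite expr_le1//; case/andP: c01 => ? ?; lra.
  have K2 : 1 <= K ^+ 2 by rewrite -[leLHS](expr1n _ 2) lerXn2r ?nnegrE// (le_trans ler01).
  have s1 : 1 <= s.+1%:R :> R by rewrite ler1n.
  have h1 : 1 * 1 <= s.+1%:R * K ^+ 2 by apply: ler_pM.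
  have h2 : c ^+ 2 * G <= 1 * G by rewrite ler_wpM2r// ltW.
  by rewrite -mulrA in hG; lra.
pose qt (k : I) := q (k.2, k.1).
have qt01 k : 0 < qt k <= 1 by exact: q01.
have qtG j i : G * (frob (row j V) ^+ 2 + frob (row i U) ^+ 2) <= qt (j, i).
  by rewrite addrC; exact: qG.
have Prow := fun i => loo_good_prob UU VV U0 q01 qG K1 c01 hG E i.
have Pcol j : Pr q (fun d => ~ loo_good V U E^T (xi q d)^T K c j) <= (2 * n ^ 2 + 3)%:R * 2 ^- s.+1.
  have := loo_good_prob VV UU V0 qt01 qtG K1 c01 hG E^T j; apply: le_trans.
  have bij : bijective (fun k : I => (k.2, k.1)) by exists (fun k => (k.2, k.1)); case.
  rewrite -(Pr_reindex q (fun d => ~ loo_good V U E^T (xi qt d) K c j) bij).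
  apply: le_Pr; first exact: qP.
  by move=> d; rewrite xi_swap.
have P0 := contr_prob UU VV q01 qG K1 c01 hG predT.
apply: le_trans (_ : Pr q (fun d => ~ contr U V (maskmx predT (xi q d)) \/
   ((exists i, ~ loo_good U V E (xi q d) K c i) \/
    (exists j, ~ loo_good V U E^T (xi q d)^T K c j))) <= _); last first.
  apply: le_trans (Pr_or _ _ qP) _.
  apply: le_trans (lerD P0 (le_trans (Pr_or _ _ qP) (lerD
     (le_trans (Pr_exists _ qP) (ler_sum _ (fun i _ => Prow i)))
     (le_trans (Pr_exists _ qP) (ler_sum _ (fun j _ => Pcol j)))))) _.
  rewrite !sumr_const !card_ord -!mulrnAl -!mulrDl -!mulrnA -!natrD.
  have e0 : (0 : R) <= 2 ^- s.+1 by rewrite invr_ge0 exprn_ge0.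
  apply: (ler_wpM2r e0); rewrite ler_nat.
  exact: loo_count.
apply: le_Pr => // d hd; apply: contrapT => /not_orP[/contrapT h1 /not_orP[h2 h3]].
apply: hd; set A := xi q d in h1 h2 h3.
have cA : contr U V A.
  by rewrite (_ : A = maskmx predT A)//; apply/matrixP => i j; rewrite [RHS]mxE.
have gU i : loo_good U V E A K c i by apply: contrapT => h; apply: h2; exists i.
have gV j : loo_good V U E^T A^T K c j by apply: contrapT => h; apply: h3; exists j.
have q0 k : 0 < q k by have /andP[] := q01 k.
have AE i j : A i j + 1 = (d (i, j))%:R / q (i, j) by rewrite mxE subrK.
have A0 i j : 0 <= A i j + 1 by rewrite AE divr_ge0// ltW.
have A1 i j : (A i j + 1) * (frob (row i U) ^+ 2 + frob (row j V) ^+ 2) <= 1.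
  rewrite AE mulrAC ler_pdivrMr// mul1r; apply: le_trans (qG i j).
  rewrite ler_wpM2r ?addr_ge0 ?sqr_ge0//; apply: le_trans G1.
  by case: (d _); rewrite ?ler01 ?lexx.
split.
  have [F [PF sF oF]] := loo_certificate UU VV U0 V0 EE K1 c7 Er Ec Ephi cA gU gV A0 A1.
  exists (F + had A F); split.
  - move=> i j /negPf dij; rewrite mxE [had _ _ _ _]mxE -{1}[F i j]mul1r -mulrDl addrC AE dij.
    by rewrite !mul0r.
  - by rewrite raddfD /= PF.
  - by apply: opb_PTperp => //; rewrite divr_ge0.
(* If Z vanishes on the observed entries, the centred weights act on it as -1, so contraction gives
   |Z| <= |Z| / 2 for Z in T. *)
move=> Z PZ hZ; have := cA Z; rewrite PZ.
have -> : had A Z = - Z.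
  apply/matrixP => i j; rewrite [LHS]mxE [RHS]mxE.
  case: (boolP (d (i, j))) => dij; first by rewrite hZ// mulr0 oppr0.
  by rewrite /A mxE (negPf dij) mul0r sub0r mulN1r.
rewrite raddfN /= frobN PZ => h; apply: frob_eq0.
by have := frob_ge0 Z; lra.
Qed.

End FinalStep.

(** Dimension factors for contraction, spectral norm, columns, rows and entries, in this order. *)
Lemma golf_count m :
  (m * m + (m + m + ((m * 1).+1 * m + ((m * 1).+1 * m + 2 * (m * m)))) <= 11 * m ^ 3)%N.
Proof.
have [n3 n2] := leq_expn3 m; rewrite muln1 mulSn.
by move: (m * m)%N (m ^ 3)%N n3 n2 => a b; lia.
Qed.

(** * Golfing *)

Section Golfing.
Variables (R : realType) (n r : nat).
Notation I := ('I_n * 'I_n)%type.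
Implicit Types (U V : 'M[R]_(n, r)) (q : I -> R) (d : {ffun I -> bool}).

(** The bounds by [kap] on the two weighted norms of W, with the leverage weights moved to the
    right. *)
Definition incoherent U V (W : 'M[R]_n) (kap : R) :=
  [/\ forall i j, `|W i j| <= kap * (frob (row i U) * frob (row j V)),
      forall i, frob (row i W) <= kap * frob (row i U) &
      forall j, frob (col j W) <= kap * frob (row j V)].

Lemma incoherent_tr U V W kap : incoherent U V W kap -> incoherent V U W^T kap.
Proof.
move=> [h1 h2 h3]; split=> [i j|i|j].
- by rewrite mxE (mulrC (frob _)).
- by rewrite -tr_col frob_tr.
- by rewrite -tr_row frob_tr.
Qed.

Section Step.
Variables (U V : 'M[R]_(n, r)).
Hypothesis UU : U^T *m U = 1%:M.
Hypothesis VV : V^T *m V = 1%:M.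
Hypothesis U_gt0 : forall i, 0 < frob (row i U).
Hypothesis V_gt0 : forall j, 0 < frob (row j V).
Variable q : I -> R.
Hypothesis q01 : forall k, 0 < q k <= 1.
Variables (G K c : R) (s : nat).
Hypothesis qG : forall i j, G * (frob (row i U) ^+ 2 + frob (row j V) ^+ 2) <= q (i, j).
Hypothesis K1 : 1 <= K.
Hypothesis c01 : 0 < c <= 1/100.
Hypothesis hG : 256 * s.+1%:R * K ^+ 2 <= c ^+ 2 * G.
Variables (W : 'M[R]_n) (kap : R).
Hypothesis kap0 : 0 < kap.
Hypothesis incW : incoherent U V W kap.

Let c_gt0 : 0 < c. Proof. by case/andP: c01. Qed.
Let K_gt0 : 0 < K. Proof. exact: lt_le_trans K1. Qed.
Let G_gt0 : 0 < G. Proof. exact: gain_gt0 K1 c01 hG. Qed.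
Let Gi0 : 0 < G^-1. Proof. by rewrite invr_gt0. Qed.

Lemma scaled_gain (m x y : R) : 0 <= x -> 1 <= m -> m * x ^+ 2 * (1/10000) <= y ->
  128 * (s.+1%:R ^+ 2 * (m * (x * G^-1) ^+ 2) + s.+1%:R * (m * (G^-1 * x ^+ 2))) <= y.
Proof.
move=> x0 m1; apply: le_trans.
have h := le_trans (gain_quadratic K1 c01 hG) (cK_le K1 c01).
have m0 : 0 <= m * x ^+ 2 by rewrite mulr_ge0 ?sqr_ge0// (le_trans ler01).
apply: le_trans (ler_wpM2l m0 h).
by rewrite le_eqVlt; apply/orP; left; apply/eqP; ring.
Qed.

Lemma golf_spectral_prob : Pr q (fun d => ~ opb (had (xi q d) W) (kap * (c / K))) <=
  (n + n)%:R * 2 ^- s.+1.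
Proof.
have [We Wr Wc] := incW.
apply: (spectral_prob q01 G_gt0 qG kap0 We Wc).
- exact: Wr.
- by rewrite mulr_gt0// divr_gt0.
- rewrite [leRHS]exprMn.
  rewrite [leLHS](_ : _ = kap ^+ 2 * (128 * (s.+1%:R ^+ 2 * G^-1 ^+ 2 + s.+1%:R * G^-1))).
    by rewrite ler_wpM2l ?sqr_ge0 ?(gain_quadratic K1 c01 hG).
  by ring.
move=> i.
pose qt (k : I) := q (k.2, k.1).
have qt01 k : 0 < qt k <= 1 by exact: q01.
have qtG j l : G * (frob (row j V) ^+ 2 + frob (row l U) ^+ 2) <= qt (j, l).
  by rewrite addrC; exact: qG.
have [We' Wr' Wc'] := incoherent_tr incW.
have := col_var qt01 G_gt0 qtG kap0 We' Wc' i.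
by apply: le_trans; apply: ler_sum => j _; rewrite mxE.
Qed.

Lemma golf_col_prob j : Pr q (fun d => ~ (frob (col j (PT U V (had (xi q d) W))) <=
  kap / 2 * frob (row j V))) <= (n * 1).+1%:R * 2 ^- s.+1.
Proof.
have [We Wr Wc] := incW.
apply: (col_prob UU VV q01 G_gt0 qG kap0 We Wc) => //.
  by rewrite !mulr_gt0 ?invr_gt0.
have x0 : 0 <= kap * frob (row j V) by rewrite mulr_ge0 ?frob_ge0 ?ltW.
have := @scaled_gain 4 (kap * frob (row j V)) ((kap / 2 * frob (row j V)) ^+ 2) x0 _ _.
have e : (kap / 2 * frob (row j V)) ^+ 2 = 1/4 * (kap * frob (row j V)) ^+ 2 by field.
have z0 := sqr_ge0 (kap * frob (row j V)).
move=> /(_ ltac:(lra) ltac:(rewrite e; lra)); apply: le_trans.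
set v := frob (row j V) in z0 *.
rewrite -subr_ge0 [leRHS](_ : _ = 128 * 3 * s.+1%:R ^+ 2 * (kap * v * G^-1) ^+ 2); last by ring.
by nonneg.
Qed.

Lemma golf_entry_prob i j : Pr q (fun d => ~ (`|PT U V (had (xi q d) W) i j| <=
  kap / 2 * (frob (row i U) * frob (row j V)))) <= 2 * 2 ^- s.+1.
Proof.
have [We Wr Wc] := incW.
apply: (entry_prob UU VV q01 G_gt0 qG kap0 We) => //.
  by rewrite !mulr_gt0 ?invr_gt0.
set x := kap * (frob (row i U) * frob (row j V)).
have x0 : 0 <= x by rewrite /x !mulr_ge0 ?frob_ge0 ?ltW.
have z0 := sqr_ge0 x.
have e : (kap / 2 * (frob (row i U) * frob (row j V))) ^+ 2 = 1/4 * x ^+ 2 by rewrite /x; field.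
rewrite e.
have := @scaled_gain 9 x (1/4 * x ^+ 2) x0 _ _.
move=> /(_ ltac:(lra) ltac:(lra)); apply: le_trans.
rewrite -subr_ge0 [leRHS](_ : _ = 128 * 5 * s.+1%:R ^+ 2 * (x * G^-1) ^+ 2); last by ring.
by nonneg.
Qed.

End Step.

(* One step replaces the residual [W] by [- P_T (R_q - id) W], halving its bounds. *)
Definition golf_good U V q (c K : R) (W : 'M[R]_n) (kap : R) d :=
  [/\ contr U V (xi q d), opb (had (xi q d) W) (kap * (c / K)) &
      incoherent U V (PT U V (had (xi q d) W)) (kap / 2)].

Lemma golf_good_prob U V q (G K c : R) s (W : 'M[R]_n) kap :
  U^T *m U = 1%:M -> V^T *m V = 1%:M ->
  (forall i, 0 < frob (row i U)) -> (forall j, 0 < frob (row j V)) ->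
  (forall k, 0 < q k <= 1) ->
  (forall i j, G * (frob (row i U) ^+ 2 + frob (row j V) ^+ 2) <= q (i, j)) ->
  1 <= K -> 0 < c <= 1/100 -> 256 * s.+1%:R * K ^+ 2 <= c ^+ 2 * G ->
  0 < kap -> incoherent U V W kap ->
  Pr q (fun d => ~ golf_good U V q c K W kap d) <= (11 * n ^ 3)%:R * 2 ^- s.+1.
Proof.
move=> UU VV U0 V0 q01 qG K1 c01 hG kap0 incW.
have qP := p01_isprob q01.
pose qt (k : I) := q (k.2, k.1).
have qt01 k : 0 < qt k <= 1 by exact: q01.
have qtG j i : G * (frob (row j V) ^+ 2 + frob (row i U) ^+ 2) <= qt (j, i).
  by rewrite addrC; exact: qG.
have P1 := contr_prob UU VV q01 qG K1 c01 hG predT.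
have P2 := golf_spectral_prob q01 qG K1 c01 hG kap0 incW.
have P3 := golf_col_prob UU VV V0 q01 qG K1 c01 hG kap0 incW.
have P4 := golf_entry_prob UU VV U0 V0 q01 qG K1 c01 hG kap0 incW.
have P5 i : Pr q (fun d => ~ (frob (row i (PT U V (had (xi q d) W))) <= kap / 2 * frob (row i U)))
    <= (n * 1).+1%:R * 2 ^- s.+1.
  have := golf_col_prob VV UU U0 qt01 qtG K1 c01 hG kap0 (incoherent_tr incW) i; apply: le_trans.
  have bij : bijective (fun k : I => (k.2, k.1)) by exists (fun k => (k.2, k.1)); case.
  rewrite -(Pr_reindex q (fun d => ~ (frob (col i (PT V U (had (xi qt d) W^T))) <=
    kap / 2 * frob (row i U))) bij).
  apply: le_Pr; first exact: qP.
  by move=> d; rewrite -xi_swap had_tr PT_tr -tr_row frob_tr.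
apply: le_trans (_ : Pr q (fun d => ~ contr U V (maskmx predT (xi q d)) \/
   (~ opb (had (xi q d) W) (kap * (c / K)) \/
   ((exists j, ~ (frob (col j (PT U V (had (xi q d) W))) <= kap / 2 * frob (row j V))) \/
   ((exists i, ~ (frob (row i (PT U V (had (xi q d) W))) <= kap / 2 * frob (row i U))) \/
    (exists k : I, ~ (`|PT U V (had (xi q d) W) k.1 k.2| <=
  kap / 2 * (frob (row k.1 U) * frob (row k.2 V)))))))) <= _).
  apply: le_Pr => [//|d hd]; apply: contrapT => /not_orP[/contrapT h1 /not_orP[/contrapT h2]].
  move=> /not_orP[h3 /not_orP[h4 h5]]; apply: hd; split => //.
    by rewrite (_ : xi q d = maskmx predT (xi q d))//; apply/matrixP => i j; rewrite [RHS]mxE.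
  split=> [i j|i|j]; apply: contrapT => h.
  - by apply: h5; exists (i, j).
  - by apply: h4; exists i.
  - by apply: h3; exists j.
apply: le_trans (Pr_or _ _ qP) _.
apply: le_trans (lerD P1 (le_trans (Pr_or _ _ qP) (lerD P2
  (le_trans (Pr_or _ _ qP) (lerD (le_trans (Pr_exists _ qP) (ler_sum _ (fun j _ => P3 j)))
  (le_trans (Pr_or _ _ qP) (lerD (le_trans (Pr_exists _ qP) (ler_sum _ (fun i _ => P5 i)))
    (le_trans (Pr_exists _ qP) (ler_sum _ (fun (k : I) _ => P4 k.1 k.2)))))))))) _.
have e0 : (0 : R) <= 2 ^- s.+1 by rewrite invr_ge0 exprn_ge0.
rewrite !sumr_const card_prod !card_ord -!mulrnAl -!mulrDl -!mulrnA -!natrD.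
apply: (ler_wpM2r e0); rewrite ler_nat; exact: golf_count.
Qed.

(** W + had xi W is R_q(W), supported on [d1]. Its tangent part misses W by P_T(had xi W), which the
    certificate on [d2] corrects, and its normal part is that of the noise since W lies in T. *)
Lemma certificate_golf U V q (c K : R) (W : 'M[R]_n) kap t d1 d2 :
  U^T *m U = 1%:M -> V^T *m V = 1%:M -> 0 < c -> 1 <= K -> 0 < kap ->
  PT U V W = W -> opb (had (xi q d1) W) (kap * (c / K)) ->
  certificate U V d2 (- PT U V (had (xi q d1) W)) t ->
  certificate U V (unionf d1 d2) W (kap * (c / K) + t).
Proof.
move=> UU VV c0 K1 kap0 PW oW [[Y [Yd PY oY]] inj]; split; last first.
  move=> Z PZ hZ; apply: inj => // i j dij; apply: hZ.
  by rewrite ffunE dij orbT.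
have PTD X Z : PT U V (X + Z) = PT U V X + PT U V Z by exact: raddfD.
exists (W + had (xi q d1) W + Y); split.
- move=> i j; rewrite ffunE negb_or => /andP[/negPf d1ij d2ij].
  rewrite [LHS]mxE (Yd _ _ d2ij) addr0 mxE [had _ _ _ _]mxE [xi _ _ _ _]mxE d1ij.
  by rewrite mul0r; ring.
- by rewrite !PTD PY PW addrK.
have -> : PTperp U V (W + had (xi q d1) W + Y) = PTperp U V (had (xi q d1) W) + PTperp U V Y.
  rewrite /PTperp !PTD PW.
  move: (had _ _) (PT _ _ _) (PT _ _ _) => a b e.
  by apply/matrixP => i j; rewrite !mxE; ring.
apply: opbD => //; apply: opb_PTperp => //.
by rewrite mulr_ge0 ?divr_ge0 ?ltW// (lt_le_trans ltr01).
Qed.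

Lemma golfing U V (G K c eps : R) s : U^T *m U = 1%:M -> V^T *m V = 1%:M ->
  (forall i, 0 < frob (row i U)) -> (forall j, 0 < frob (row j V)) ->
  1 <= K -> 0 < c <= (1/100) ^+ 4 -> 256 * s.+1%:R * K ^+ 2 <= c ^+ 2 * G ->
  2 * eps <= 1/1000 ->
  forall k (kap : R) (W : 'M[R]_n) (p : I -> R),
  0 < kap <= K -> incoherent U V W kap -> PT U V W = W -> frob W <= 2 ^+ k * eps ->
  (forall ij, 0 < p ij <= 1) ->
  (forall i j, k.+1%:R * (G * (frob (row i U) ^+ 2 + frob (row j V) ^+ 2)) <= p (i, j)) ->
  Pr p (fun d => ~ certificate U V d W (2 * (kap * (c / K)) + 1/32)) <=
    k.+1%:R * ((11 * n ^ 3)%:R * 2 ^- s.+1).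
Proof.
move=> UU VV U0 V0 K1 c7 hG heps.
have c01 : 0 < c <= 1/100.
  case/andP: c7 => -> /= h; apply: le_trans h _; rewrite !exprS expr0; lra.
have c0 : 0 < c by case/andP: c7.
have K0 : 0 < K by exact: lt_le_trans K1.
have G0 := gain_gt0 K1 c01 hG.
have cert_le d W t t' : t <= t' -> certificate U V d W t -> certificate U V d W t'.
  by move=> tt [[Y [h1 h2 h3]] h4]; split => //; exists Y; split => //; exact: opb_le h3.
elim=> [|k IH] kap W p /andP[kap0 kapK] incW PW Weps p01 hp.
  rewrite [leRHS]mul1r; have [We Wr Wc] := incW.
  have qG i j : G * (frob (row i U) ^+ 2 + frob (row j V) ^+ 2) <= p (i, j).
    by rewrite -[leLHS]mul1r.
  have Wr' i : frob (row i W) <= K * frob (row i U).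
    by apply: le_trans (Wr i) _; rewrite ler_wpM2r ?frob_ge0.
  have Wc' j : frob (col j W) <= K * frob (row j V).
    by apply: le_trans (Wc j) _; rewrite ler_wpM2r ?frob_ge0.
  have We' : 2 * frob W <= 1/1000.
    by apply: le_trans heps; rewrite ler_wpM2l ?ler0n//; rewrite expr0 mul1r in Weps.
  apply: le_trans (final_step UU VV U0 V0 p01 qG PW K1 c7 hG Wr' Wc' We').
  apply: le_Pr => [|d]; first exact: p01_isprob.
  apply: contra_not; apply: cert_le; rewrite lerDr.
  by rewrite !mulr_ge0 ?invr_ge0 ?ltW.
(* Each step takes one share G w of the rate, w being the leverage sum; p' is what remains so that
   the union of both subsamples has rate p, and p' >= p - q leaves the other k + 1 shares. *)
pose q (ij : I) := G * (frob (row ij.1 U) ^+ 2 + frob (row ij.2 V) ^+ 2).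
have q0 ij : 0 < q ij by rewrite mulr_gt0// addr_gt0 ?exprn_gt0.
have qp ij : k.+2%:R * q ij <= p ij by case: ij => i j; exact: hp.
have q2 ij : 2 * q ij <= p ij.
  by apply: le_trans (qp ij); rewrite ler_wpM2r ?(ltW (q0 _))// ler_nat.
have q1 ij : q ij <= 1/2 by have := q2 ij; have /andP[_] := p01 ij; lra.
have q01 ij : 0 < q ij <= 1 by rewrite q0 /=; have := q1 ij; lra.
have qc ij : 0 < 1 - q ij by have := q1 ij; lra.
pose p' ij := (p ij - q ij) / (1 - q ij).
have pp' ij : p ij - q ij <= p' ij.
  rewrite /p' ler_pdivlMr// ler_piMr//; first by have := q2 ij; have := q0 ij; lra.
  by have := q0 ij; lra.
have p'01 ij : 0 < p' ij <= 1.
  apply/andP; split.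
    by apply: lt_le_trans (pp' ij); have := q2 ij; have := q0 ij; lra.
  by rewrite /p' ler_pdivrMr//; have /andP[_] := p01 ij; lra.
have hunion ij : 1 - p ij = (1 - q ij) * (1 - p' ij).
  by rewrite /p'; field; rewrite gt_eqF.
have hp' i j : k.+1%:R * (G * (frob (row i U) ^+ 2 + frob (row j V) ^+ 2)) <= p' (i, j).
  apply: le_trans (pp' (i, j)); rewrite lerBrDr -/(q (i, j)).
  have := qp (i, j); rewrite -[k.+2]addn1 natrD mulrDl mul1r.
  by rewrite /q /=; lra.
have n0 : 0 <= (11 * n ^ 3)%:R * 2 ^- s.+1 :> R by rewrite mulr_ge0 ?invr_ge0 ?exprn_ge0 ?ler0n.
have -> : k.+2%:R * ((11 * n ^ 3)%:R * 2 ^- s.+1) =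
    (11 * n ^ 3)%:R * 2 ^- s.+1 + k.+1%:R * ((11 * n ^ 3)%:R * 2 ^- s.+1) :> R.
  by rewrite -[k.+2]addn1 natrD mulrDl mul1r addrC.
apply: (Pr_union (p1 := q) (p2 := p') (A := fun d => ~ golf_good U V q c K W kap d)).
- exact: p01_isprob.
- exact: p01_isprob.
- by rewrite mulr_ge0 ?ler0n.
- exact: hunion.
- by apply: golf_good_prob hG kap0 incW.
move=> d1 /contrapT[cA oW incW'].
set W' := - PT U V (had (xi q d1) W).
have incW'' : incoherent U V W' (kap / 2).
  case: incW' => h1 h2 h3; split => [i j|i|j].
  - by rewrite mxE normrN.
  - by rewrite /W' (_ : row i _ = - row i (PT U V (had (xi q d1) W))) ?frobN//;
      apply/rowP => j; rewrite !mxE.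
  - by rewrite /W' (_ : col j _ = - col j (PT U V (had (xi q d1) W))) ?frobN//;
      apply/colP => i; rewrite !mxE.
have PW' : PT U V W' = W' by rewrite /W' raddfN /= PT_idem.
have W'eps : frob W' <= 2 ^+ k * eps.
  rewrite /W' frobN; have := cA W; rewrite PW; rewrite exprS in Weps; lra.
have kap2 : 0 < kap / 2 <= K by apply/andP; split; lra.
apply: le_trans (IH _ _ _ kap2 incW'' PW' W'eps p'01 hp').
apply: le_Pr => [|d2]; first exact: p01_isprob.
apply: contra_not => hcert.
(* Geometric series: this step costs kap c / K, and the later ones 2 (kap / 2) c / K. *)
have := certificate_golf UU VV c0 K1 kap0 PW oW hcert; apply: cert_le.
by lra.
Qed.

End Golfing.

(** * Recovery from a dual certificate *)

Section Recovery.
Variables (R : realType) (n r : nat).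
Implicit Types (X Y Z W : 'M[R]_n).

Lemma opb_spec_norm X : opb X (spec_norm X).
Proof.
move=> v; have [/frob_eq0 ->|v0] := eqVneq (frob v) 0.
  by rewrite mulmx0 !frob0 mulr0.
have v1 : 0 < frob v by rewrite lt_neqAle eq_sym v0 frob_ge0.
rewrite -ler_pdivrMr// /spec_norm; apply: ub_le_sup.
  exists (frob X) => _ [w /= hw <-]; rewrite !vnorm2E in hw *.
  by apply: le_trans (frobM _ _) _; rewrite hw mulr1.
exists ((frob v)^-1 *: v) => /=; rewrite vnorm2E.
  by rewrite frobZ ger0_norm ?invr_ge0 ?frob_ge0// mulVf.
by rewrite -scalemxAr frobZ ger0_norm ?invr_ge0 ?frob_ge0// mulrC.
Qed.

Variables (U V : 'M[R]_(n, r)).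
Hypothesis UU : U^T *m U = 1%:M.
Hypothesis VV : V^T *m V = 1%:M.
Notation P := (PT U V).
Notation N := (PTperp U V).

Lemma UT_PTperp Z : U^T *m N Z = 0.
Proof. by rewrite /PTperp mulmxBr UPT// subrr. Qed.

Lemma PTperp_V Z : N Z *m V = 0.
Proof. by rewrite /PTperp mulmxBl PTV// subrr. Qed.

Lemma PT_eq0 W : U^T *m W = 0 -> W *m V = 0 -> P W = 0.
Proof. by move=> h1 h2; rewrite /PT -(mulmxA U) h1 h2 !(mul0mx, mulmx0) addr0 subr0. Qed.

Lemma PTperp_id Z : N (N Z) = N Z.
Proof. by rewrite {1}/PTperp PT_eq0 ?UT_PTperp ?PTperp_V// subr0. Qed.

Lemma dot_PTperp X Y : dot (N X) Y = dot X (N Y).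
Proof. by rewrite /PTperp dotBl dotBr dot_PT. Qed.

(** The components of v in the range of V and in its complement are mapped by U V^T and W
    respectively, into orthogonal subspaces. *)
Lemma opb_subgradient W : opb W 1 -> U^T *m W = 0 -> W *m V = 0 ->
  opb (U *m V^T + W) 1.
Proof.
move=> W1 UW WV v; rewrite mul1r -ler_sqr ?nnegrE ?frob_ge0//.
have -> : (U *m V^T + W) *m v = U *m (V^T *m v) + W *m ((1%:M - V *m V^T) *m v).
  by rewrite mulmxDl mulmxA mulmxA mulmxBr mulmx1 (mulmxA W) WV mul0mx subr0.
set a := V^T *m v; set b := (1%:M - V *m V^T) *m v.
have e : frob (U *m a + W *m b) ^+ 2 = frob a ^+ 2 + frob (W *m b) ^+ 2.
  rewrite frob_sqr dotDl !dotDr [dot (W *m b) (U *m a)]dot_mull mulmxA UW mul0mx dot0l.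
  rewrite [dot (U *m a) (W *m b)]dotC [dot (W *m b) (U *m a)]dot_mull mulmxA UW mul0mx dot0l.
  by rewrite addr0 add0r -!frob_sqr frob_orth.
have f : frob v ^+ 2 = frob a ^+ 2 + frob b ^+ 2.
  have {1}-> : v = V *m a + b by rewrite /b mulmxBl mul1mx /a mulmxA addrC subrK.
  have Vb : V^T *m b = 0 by rewrite /b mulmxA mulmxBr mulmx1 mulmxA VV mul1mx subrr mul0mx.
  rewrite frob_sqr dotDl !dotDr [dot b (V *m a)]dot_mull Vb dot0l.
  rewrite [dot (V *m a) b]dotC [dot b (V *m a)]dot_mull Vb dot0l.
  by rewrite addr0 add0r -!frob_sqr frob_orth.
rewrite e f lerD2l ler_sqr ?nnegrE ?frob_ge0//.
by have := W1 b; rewrite mul1r.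
Qed.

(** Pairing with the dual witness W leaves the diagonal of U^T W V against that of S; these entries
    are at most 1 because the columns of U and V are unit vectors. *)
Lemma nuc_norm_svd (S : 'M[R]_r) : is_diag_mx S -> (forall k, 0 < S k k) ->
  nuc_norm (U *m S *m V^T) <= \tr S.
Proof.
move=> /is_diag_mxP Sd S0; have [W [W1 <- _ _]] := nuc_norm_attained (U *m S *m V^T).
rewrite dot_mulr trmxK dot_mull mulmxA.
rewrite /dot /mxtrace; apply: ler_sum => k _; rewrite (bigD1 k)//= big1 ?addr0; last first.
  by move=> l lk; rewrite (Sd k l) ?mulr0// eq_sym.
rewrite -[leRHS]mul1r ler_wpM2r ?(ltW (S0 _))//.
apply: le_trans (ler_norm _) _; apply: le_trans (entry_mul _ _ _ _) _.
have hV : frob (col k V) = 1.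
  apply/eqP; rewrite -(@eqrXn2 _ 2) ?frob_ge0// expr1n frob_colE.
  move/matrixP/(_ k k): VV; rewrite !mxE eqxx mulr1n => <-.
  by apply/eqP; apply: eq_bigr => i _; rewrite mxE expr2.
have hU : frob (col k U) = 1.
  apply/eqP; rewrite -(@eqrXn2 _ 2) ?frob_ge0// expr1n frob_colE.
  move/matrixP/(_ k k): UU; rewrite !mxE eqxx mulr1n => <-.
  by apply/eqP; apply: eq_bigr => i _; rewrite mxE expr2.
rewrite hV mulr1 row_mul -frob_tr trmx_mul -tr_col trmxK.
have := opb_tr ler01 W1 (col k U); by rewrite mul1r hU.
Qed.

(** Testing |X|_* with the subgradient U V^T + W, where W attains the nuclear norm of N Z, gains |N
    Z|_*. The certificate and the normal part of lam Phi give back at most t and alpha2 times this,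
    so the objective increases strictly unless N Z = 0; then Z lies in T and vanishes by
    injectivity. *)
Lemma recovery (S : 'M[R]_r) (Phi : 'M[R]_n) (lam t : R) (p : 'I_n -> 'I_n -> R)
    (d : outcome n) :
  is_diag_mx S -> (forall k, 0 < S k k) -> (forall i j, 0 < p i j) ->
  let Xs := U *m S *m V^T in
  let M := U *m V^T - lam *: P Phi in
  spec_norm (lam *: N Phi) + t < 1 -> 0 <= t < 1 ->
  certificate U V d M t ->
  unique_solution lam Phi (fun X => Rp p d X = Rp p d Xs) Xs.
Proof.
move=> Sd S0 p0 Xs M at1 /andP[t0 t1] [[Y [Yd PY oY]] inj]; split=> // X feas XXs.
pose Z := X - Xs.
have Zd i j : d (i, j) -> Z i j = 0.
  move=> dij; move/matrixP/(_ i j): feas; rewrite [LHS]mxE [RHS]mxE dij.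
  move=> /(mulfI (_ : 1 / p i j != 0)) h; rewrite [LHS]mxE [X in _ + X]mxE h ?subrr//.
  by rewrite mul1r invr_eq0 gt_eqF.
have [W [W1 WN WL WR]] := nuc_norm_attained (N Z).
have UW := WL _ _ (UT_PTperp Z); have WV := WR _ _ (PTperp_V Z).
have h1 := dot_nuc_norm X ler01 (opb_subgradient W1 UW WV).
have h2 := nuc_norm_svd Sd S0; rewrite -/Xs in h2.
have XE : X = Xs + Z by rewrite /Z addrC subrK.
have e1 : dot (U *m V^T + W) Xs = \tr S.
  rewrite dotDl [dot W _](_ : _ = 0) ?addr0.
    rewrite /Xs -mulmxA dot_mull mulmxA UU mul1mx dot_mulr trmxK VV.
    by rewrite dotE trmx1 mul1mx.
  by rewrite /Xs -mulmxA dot_mull UW dot0l.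
have e2 : dot W Z = nuc_norm (N Z).
  rewrite -WN /PTperp dotBr -dot_PT PT_eq0// dot0l subr0 //.
have al := opb_spec_norm (lam *: N Phi); set al2 := spec_norm _ in al at1.
have hn := nuc_norm_ge0 (N Z).
(* [dot_nuc_norm] asks for a nonnegative bound. *)
pose a := Num.max al2 0.
have a0 : 0 <= a by rewrite le_max lexx orbT.
have at2 : a + t < 1 by rewrite /a; case: (leP al2 0) => _; lra.
have ao : opb (lam *: N Phi) a by apply: opb_le al; rewrite le_max lexx.
have h3 : dot (lam *: N Phi) Z <= a * nuc_norm (N Z).
  rewrite dotZl -(PTperp_id Phi) dot_PTperp -dotZl; exact: dot_nuc_norm.
have YZ : dot Y Z = 0.
  rewrite /dot big1// => i _; rewrite big1// => j _.
  by case: (boolP (d (i, j))) => dij; [rewrite Zd// mulr0|rewrite Yd// mul0r].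
have YN : dot Y (N Z) = dot (N Y) (N Z) by rewrite dot_PTperp PTperp_id.
(* Y and Z have disjoint supports, so <Y, Z> = 0 and the tangent part of the pairing is minus the
   normal part. *)
have MZ : dot M Z = - dot (N Y) (N Z).
  have -> : dot M Z = dot Y (P Z) by rewrite -PY dot_PT.
  have -> : P Z = Z - N Z by rewrite /PTperp opprB addrC subrK.
  by rewrite dotBr YZ sub0r YN.
have h4 := dot_nuc_norm (N Z) t0 oY.
have e3 : dot (U *m V^T) Z = dot M Z + dot (lam *: PT U V Phi) Z by rewrite /M dotBl subrK.
have e4 : lam * inner Phi X = lam * inner Phi Xs + (dot (lam *: PT U V Phi) Z + dot (lam *: N Phi) Z).
  rewrite /inner -!dotE XE dotDr mulrDr; congr (_ + _).
  by rewrite -dotDl -scalerDr dotZl /PTperp addrC subrK.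
have e5 : dot (U *m V^T + W) X = \tr S + dot (U *m V^T) Z + nuc_norm (N Z).
  by rewrite XE dotDr e1 dotDl e2 addrA.
rewrite e5 mul1r in h1.
have hN : 0 < nuc_norm (N Z).
  rewrite lt_neqAle hn andbT; apply/eqP => /esym/nuc_norm_eq0 NZ; apply: XXs.
  apply/eqP; rewrite -subr_eq0; apply/eqP; apply: (inj Z) => //.
  by move/eqP: NZ; rewrite /PTperp subr_eq0 => /eqP.
have : 0 < (1 - a - t) * nuc_norm (N Z) by rewrite mulr_gt0//; lra.
by rewrite e4; lra.
Qed.

End Recovery.

(** * Weighted norms and constants *)

Section WeightedNorms.
Variables (R : realType) (n r : nat).
Hypotheses (n_gt0 : (0 < n)%N) (r_gt0 : (0 < r)%N).
Implicit Types (U V : 'M[R]_(n, r)) (X : 'M[R]_n).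

Let nN0 : n%:R != 0 :> R. Proof. by rewrite pnatr_eq0 -lt0n. Qed.
Let rN0 : r%:R != 0 :> R. Proof. by rewrite pnatr_eq0 -lt0n. Qed.

Lemma levE U i : lev U i = n%:R / r%:R * frob (row i U) ^+ 2.
Proof. by rewrite frob_rowE. Qed.

Lemma lev_gt0 U i : 0 < lev U i -> 0 < frob (row i U).
Proof.
rewrite levE lt_neqAle eq_sym mulf_eq0 negb_or sqrf_eq0 => /andP[/andP[_ h] _].
by rewrite lt_neqAle eq_sym h frob_ge0.
Qed.

Lemma sqrt_lev U i : 0 < frob (row i U) ->
  Num.sqrt (n%:R / (lev U i * r%:R)) = (frob (row i U))^-1.
Proof.
move=> u0; have uN0 : frob (row i U) != 0 by rewrite gt_eqF.
rewrite levE (_ : _ / _ = (frob (row i U))^-1 ^+ 2).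
  by rewrite sqrtr_sqr ger0_norm// invr_ge0 ltW.
by field; rewrite uN0 nN0 rN0.
Qed.

Lemma incoherent_norms U V X (K : R) :
  (forall i, 0 < frob (row i U)) -> (forall j, 0 < frob (row j V)) ->
  mu_inf_norm U V X <= K -> mu_inf2_norm U V X <= K -> incoherent U V X K.
Proof.
move=> U0 V0; rewrite /mu_inf_norm /mu_inf2_norm => h1; rewrite ge_max => /andP[h2 h3].
split=> [i j|i|j].
- have := le_trans (le_trans (le_bigmax 0 (fun j => Num.sqrt (n%:R / (lev U i * r%:R)) * `|X i j| *
     Num.sqrt (n%:R / (lev V j * r%:R))) j) (le_bigmax 0 (fun i => \big[Num.max/0]_(j < n)
    (Num.sqrt (n%:R / (lev U i * r%:R)) * `|X i j| *
     Num.sqrt (n%:R / (lev V j * r%:R)))) i)) h1.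
  by rewrite !sqrt_lev// ler_pdivrMr// mulrC ler_pdivrMr// -mulrA (mulrC (frob (row j V))).
- have := le_trans (le_bigmax 0 (fun i =>
       Num.sqrt (n%:R / (lev U i * r%:R)) * vnorm2 (col i X^T)) i) h2.
  by rewrite sqrt_lev// mulrC ler_pdivrMr// vnorm2E -tr_row frob_tr.
- have := le_trans (le_bigmax 0 (fun j =>
       Num.sqrt (n%:R / (lev V j * r%:R)) * vnorm2 (col j X)) j) h3.
  by rewrite sqrt_lev// mulrC ler_pdivrMr// vnorm2E.
Qed.

Lemma mu_inf_norm_ge0 U V X : 0 <= mu_inf_norm U V X.
Proof. exact: bigmax_ge_id. Qed.

Lemma mu_inf2_norm_ge0 U V X : 0 <= mu_inf2_norm U V X.
Proof. by rewrite le_max bigmax_ge_id. Qed.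

End WeightedNorms.

Section Constants.
Variable R : realType.

Lemma ln2_gt0 : 0 < ln (2 : R).
Proof. by rewrite ln_gt0// ltr1n. Qed.

(** The integer logarithm is at most log_2 n + 1, hence at most 2 log_2 n for n >= 2. *)
Lemma up_log_le_ln n : (2 <= n)%N -> (up_log 2 n)%:R <= 2 / ln 2 * ln (n%:R : R).
Proof.
move=> n2; have n1 : (1 < n)%N by [].
have /andP[lo _] := up_log_bounds (isT : (1 < 2)%N) n1.
have npos : 0 < n%:R :> R by rewrite ltr0n (ltn_trans _ n1).
have h1 : (up_log 2 n).-1%:R * ln (2 : R) <= ln n%:R.
  have -> : (up_log 2 n).-1%:R * ln (2 : R) = ln ((2 ^ (up_log 2 n).-1)%N%:R).
    by rewrite natrX lnXn// mulr_natl.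
  have P : 0 < (2 ^ (up_log 2 n).-1)%N%:R :> R by rewrite ltr0n expn_gt0.
  by rewrite ler_ln ?posrE//; rewrite ler_nat ltnW.
have h2 : ln (2 : R) <= ln n%:R by rewrite ler_ln ?posrE// ler_nat.
have h3 : (up_log 2 n)%:R <= (up_log 2 n).-1%:R + 1 :> R.
  by rewrite natr1 ler_nat leqSpred.
have l2 := ln2_gt0; rewrite mulrAC ler_pdivlMr//.
have := ler_wpM2r (ltW l2) h3; lra.
Qed.

Lemma expR_le_pow2 (m0 k : nat) (L : R) :
  @expR R 1 <= 2 ^+ m0 -> L <= k%:R ->
  expR L <= 2 ^+ (m0 * k).
Proof.
move=> e1 Lk; apply: (@le_trans _ _ (expR k%:R)); first by rewrite ler_expR.
have -> : @expR R k%:R = expR 1 ^+ k by rewrite -expRM_natl mulr1.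
by rewrite exprM lerXn2r ?nnegrE ?expR_ge0 ?exprn_ge0.
Qed.

Lemma exists_pow2_ge (x : R) : exists m : nat, x <= 2 ^+ m.
Proof.
exists (Num.truncn `|x|).+1; apply: le_trans (ler_norm x) _.
apply: ltW; apply: (@lt_le_trans _ _ (Num.truncn `|x|).+1%:R).
  exact: truncnS_gt.
by rewrite -natrX ler_nat ltnW// ltn_expl.
Qed.

Lemma le_pow2_of_sqr (x : R) m : 0 <= x -> x ^+ 2 <= 2 ^+ m ->
  x <= 2 ^+ (m + 11) * (1/2000).
Proof.
move=> x0 h; rewrite exprD -mulrA; set B := 2 ^+ m in h *.
have B1 : 1 <= B by rewrite exprn_ege1// ler1n.
have xB : x <= B.
  rewrite leNgt; apply/negP => hB.
  have : B * 1 < x * x by apply: ltr_pM => //; [lra | exact: le_lt_trans hB].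
  by rewrite mulr1 -expr2 ltNge h.
apply: le_trans xB _; rewrite ler_peMr//; first lra.
by rewrite !exprS expr0; lra.
Qed.

Lemma truncn_degree_le (L : R) m : 1 <= L ->
  (m * (Num.truncn L).+1 + 11).+1%:R <= (2 * m + 12)%:R * L.
Proof.
move=> L1; have /andP[h _] := truncn_itv (le_trans ler01 L1).
have h2 : (Num.truncn L).+1%:R <= 2 * L by rewrite -natr1; lra.
have := ler_wpM2l (ler0n R m) h2.
by rewrite -(addn1 (_ + 11)) !natrD !natrM; lra.
Qed.

End Constants.

Lemma PT_subgradient (R : realType) (n r : nat) (U V : 'M[R]_(n, r)) (lam : R) Phi :
  U^T *m U = 1%:M -> V^T *m V = 1%:M ->
  PT U V (U *m V^T - lam *: PT U V Phi) = U *m V^T - lam *: PT U V Phi.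
Proof.
move=> UU VV; rewrite linearB linearZ /= (PT_idem UU VV); congr (_ - _).
rewrite /PT !mulmxA -(mulmxA U U^T U) UU mulmx1 -(mulmxA U V^T V) VV mulmx1.
by rewrite addrK.
Qed.

(** * Choice of constants and conclusion *)

Theorem theorem1 (R : realType) :
  exists (C c : R) (beta : nat), 0 < C /\ (0 < beta)%N /\
  forall (n r : nat) (Xs : 'M[R]_n) (U V : 'M[R]_(n, r)) (S : 'M[R]_r)
         (Phi : 'M[R]_n) (lam : R) (p : 'I_n -> 'I_n -> R),
    (2 <= n)%N ->
    \rank Xs = r ->
    U^T *m U = 1%:M -> V^T *m V = 1%:M ->
    is_diag_mx S -> (forall k, 0 < S k k) ->
    Xs = U *m S *m V^T ->
    (forall i, 0 < lev U i) -> (forall j, 0 < lev V j) ->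
    0 <= lam ->
    let M := U *m V^T - lam *: PT U V Phi in
    let alpha1 := frob M in
    let alpha2 := spec_norm (lam *: PTperp U V Phi) in
    let xi1 := mu_inf_norm U V M in
    let xi2 := mu_inf2_norm U V M in
    (forall i j, 0 < p i j <= 1) ->
    (forall i j,
        C * Num.max (ln (alpha1 ^+ 2 * n%:R / (r%:R * ln n%:R))) 1
          * ((lev U i + lev V j) * r%:R * ln n%:R / n%:R)
          * Num.max ((2 * xi1 + xi2) ^+ 2) 1
        <= p i j) ->
    alpha2 < 15 / 16 ->
    Prob p (fun d =>
      ~ unique_solution lam Phi (fun X => Rp p d X = Rp p d Xs) Xs)
    <= c * n%:R ^- beta.
Proof.
pose c : R := (1/100) ^+ 4.
have c0 : 0 < c by rewrite exprn_gt0// divr_gt0.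
have c1 : c <= 1/100 by rewrite /c !exprS expr0; lra.
have heps : 2 * (1/2000) <= 1/1000 :> R by lra.
have tc x : x < 15/16 -> x + (2 * c + 1/32) < 1 by lra.
have t01 : 0 <= 2 * c + 1/32 < 1 by apply/andP; split; lra.
have c7 : 0 < c <= (1/100) ^+ 4 by rewrite c0 lexx.
have [m0 em0] := exists_pow2_ge (expR (1 : R)).
have l2 := @ln2_gt0 R.
pose D : R := 256 / c ^+ 2.
have D1 : 1 <= D.
  rewrite ler_pdivlMr ?exprn_gt0// mul1r.
  have : c ^+ 2 <= 1 by rewrite expr_le1 ?(ltW c0)//; lra.
  lra.
pose a : R := (2 * m0 + 12)%:R.
have a1 : 1 <= a by rewrite ler1n addnS.
(* The 1 keeps C >= 1, used for r ln n <= n. The other term pays for k + 1 <= a L subsamples, each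
   of rate D (s + 1) K^2 times the leverage sum, where s + 1 <= 5 (2 / ln 2) ln n. *)
pose C := 1 + a * D * 5 * (2 / ln 2).
have C1 : 1 <= C.
  have [a0 D0] : 0 <= a /\ 0 <= D by split; exact: le_trans ler01 _.
  by rewrite lerDl; do ![apply: mulr_ge0 => //]; rewrite invr_ge0 ltW.
exists C, 11, 1%N; split; first by apply: lt_le_trans C1.
split=> // n r Xs U V S Phi lam p n2 rkX UU VV Sd S0 XsE lU lV lam0 M alpha1 alpha2 xi1 xi2.
move=> p01 hp ha2.
have n0 : (0 < n)%N by apply: leq_trans n2.
pose i0 : 'I_n := Ordinal n0.
(* For r = 0 the division in [lev] returns 0, against positivity of the scores. *)
have r0 : (0 < r)%N.
  rewrite lt0n; apply/eqP => r0; have := lU i0; rewrite /lev.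
  by rewrite (_ : r%:R = 0) ?invr0 ?mulr0 ?mul0r ?ltxx// r0.
have U0 i : 0 < frob (row i U) by exact: lev_gt0.
have V0 j : 0 < frob (row j V) by exact: lev_gt0.
have nR : 0 < n%:R :> R by rewrite ltr0n.
have rR : 0 < r%:R :> R by rewrite ltr0n.
have lnn : 0 < ln (n%:R : R) by rewrite ln_gt0// ltr1n.
pose K := Num.max (2 * xi1 + xi2) 1.
have K1 : 1 <= K by rewrite le_max lexx orbT.
have K0 : 0 < K by exact: lt_le_trans K1.
have x10 : 0 <= xi1 by exact: mu_inf_norm_ge0.
have x20 : 0 <= xi2 by exact: mu_inf2_norm_ge0.
have Kx : 2 * xi1 + xi2 <= K by rewrite le_max lexx.
have K2 : K ^+ 2 <= Num.max ((2 * xi1 + xi2) ^+ 2) 1.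
  by rewrite /K; case: (leP (2 * xi1 + xi2) 1) => h; rewrite le_max ?expr1n lexx ?orbT.
have incM : incoherent U V M K.
  apply: incoherent_norms => //; apply: le_trans Kx; rewrite -/xi1 -/xi2.
    by rewrite -[leLHS]addr0 lerD// ler_peMl// ler1n.
  by rewrite lerDr mulr_ge0.
pose L := Num.max (ln (alpha1 ^+ 2 * n%:R / (r%:R * ln n%:R))) 1.
have L1 : 1 <= L by rewrite le_max lexx orbT.
pose w i j := frob (row i U) ^+ 2 + frob (row j V) ^+ 2.
have w0 i j : 0 < w i j by rewrite addr_gt0 ?exprn_gt0.
have hpw i j : C * L * (w i j * ln n%:R) * K ^+ 2 <= p i j.
  apply: le_trans (hp i j).
  have -> : (lev U i + lev V j) * r%:R * ln n%:R / n%:R = w i j * ln n%:R.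
    by rewrite !levE /w; field; rewrite !gt_eqF.
  rewrite -/L ler_wpM2l//; apply: mulr_ge0; last exact: mulr_ge0 (ltW (w0 _ _)) (ltW lnn).
  by apply: mulr_ge0; apply: le_trans ler01 _.
(* The squared row norms of U add up to r, so summing over i gives x r <= n. This is used for x = ln
   n and for x = k + 1: the constraint p <= 1 bounds both. *)
have sum_w (x : R) : 0 <= x -> (forall i, x * w i i0 <= 1) -> x * r%:R <= n%:R.
  move=> x0 hx; apply: le_trans (_ : \sum_i x * w i i0 <= _).
    rewrite -mulr_sumr ler_wpM2l// -(sum_frob_row UU); apply: ler_sum => i _.
    by rewrite lerDl sqr_ge0.
  apply: le_trans (ler_sum _ (fun i _ => hx i)) _.
  by rewrite sumr_const card_ord.
have rln : r%:R * ln n%:R <= n%:R :> R.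
  rewrite mulrC; apply: sum_w => [|i]; first exact: ltW.
  have /andP[_ hp1] := p01 i i0; apply: le_trans hp1; apply: le_trans (hpw i i0).
  have K21 : 1 <= K ^+ 2 by rewrite -[leLHS](expr1n _ 2) lerXn2r ?nnegrE// ltW.
  have CL : 1 <= C * L by rewrite -[leLHS]mulr1; apply: ler_pM.
  have z0 : 0 <= w i i0 * ln n%:R by rewrite mulr_ge0 ?ltW.
  rewrite mulrC -[leLHS]mulr1; apply: ler_pM => //.
  by rewrite -[leLHS]mul1r ler_wpM2r.
(* Since r ln n <= n, the factor n / (r ln n) inside the logarithm only enlarges it. The case A <= 0
   is separate because [lnK] needs a positive argument. *)
have alphaL : alpha1 ^+ 2 <= expR L.
  have rl0 : 0 < r%:R * ln n%:R :> R by rewrite mulr_gt0.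
  have hA : alpha1 ^+ 2 <= alpha1 ^+ 2 * n%:R / (r%:R * ln n%:R).
    by rewrite ler_pdivlMr// ler_wpM2l ?sqr_ge0.
  apply: le_trans hA _; set A := _ / _; have [A0|A0] := leP A 0.
    by apply: le_trans A0 (expR_ge0 _).
  by rewrite -[A]lnK ?posrE// ler_expR le_max lexx.
(* Enough halvings to pass from e^L to 1, and 11 more since 2^11 >= 2000. *)
pose k := (m0 * (Num.truncn L).+1 + 11)%N.
have trL : L <= (Num.truncn L).+1%:R by apply: ltW; exact: truncnS_gt.
have ka : k.+1%:R <= a * L by exact: truncn_degree_le.
have Meps : frob M <= 2 ^+ k * (1/2000).
  rewrite -/alpha1; have h := le_trans alphaL (expR_le_pow2 em0 trL).
  exact: le_pow2_of_sqr (frob_ge0 _) h.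
(* [2 ^+ s.+1 >= n ^ 5] absorbs the [11 n ^ 3] events of each of the at most [n] steps. *)
pose s := (5 * up_log 2 n).-1.
have ul : (0 < up_log 2 n)%N by rewrite up_log_gt0.
have sE : s.+1 = (5 * up_log 2 n)%N by rewrite prednK// muln_gt0.
have sL : s.+1%:R <= 5 * (2 / ln 2) * ln n%:R :> R.
  by rewrite sE natrM -mulrA ler_wpM2l ?ler0n// up_log_le_ln.
(* D = 256 / c^2 makes the gain condition [hG] an equality. *)
pose G := D * s.+1%:R * K ^+ 2.
have hG : 256 * s.+1%:R * K ^+ 2 <= c ^+ 2 * G.
  rewrite /G /D le_eqVlt; apply/orP; left; apply/eqP.
  by field; rewrite gt_eqF.
have G1 : 1 <= G.
  have K21 : 1 <= K ^+ 2 by rewrite -[leLHS](expr1n _ 2) lerXn2r ?nnegrE// ltW.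
  have s1 : 1 <= s.+1%:R :> R by rewrite ler1n.
  have h1 : 1 * 1 <= D * s.+1%:R by apply: ler_pM.
  rewrite mulr1 in h1.
  by rewrite -[leLHS]mulr1 /G; apply: ler_pM.
have hpG i j : k.+1%:R * (G * w i j) <= p i j.
  apply: le_trans (hpw i j).
  have h1 : k.+1%:R * s.+1%:R <= (a * L) * (5 * (2 / ln 2) * ln n%:R) by apply: ler_pM.
  have z0 : 0 <= D * K ^+ 2 * w i j.
    apply: mulr_ge0 (ltW (w0 _ _)); apply: mulr_ge0 (sqr_ge0 K).
    exact: le_trans ler01 D1.
  have h2 := ler_wpM2l z0 h1.
  have z1 : 0 <= L * (w i j * ln n%:R) * K ^+ 2.
    apply: mulr_ge0 (sqr_ge0 K); apply: mulr_ge0 (mulr_ge0 (ltW (w0 _ _)) (ltW lnn)).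
    exact: le_trans ler01 L1.
  rewrite /G; apply: le_trans (_ : D * K ^+ 2 * w i j * (a * L * (5 * (2 / ln 2) * ln n%:R)) <= _).
    by apply: le_trans h2; rewrite le_eqVlt; apply/orP; left; apply/eqP; ring.
  rewrite -subr_ge0 [leRHS](_ : _ = L * (w i j * ln n%:R) * K ^+ 2)//.
  by rewrite /C; ring.
have kn : (k.+1 <= n)%N.
  rewrite -(ler_nat R); apply: le_trans (_ : k.+1%:R * r%:R <= _).
    by rewrite -[leLHS]mulr1 ler_wpM2l ?ler0n// ler1n.
  apply: sum_w => // i; have /andP[_ hp1] := p01 i i0.
  apply: le_trans hp1; apply: le_trans (hpG i i0).
  by rewrite ler_wpM2l ?ler0n// ler_peMl// ltW.
have PM : PT U V M = M by exact: PT_subgradient.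
pose P (ij : 'I_n * 'I_n) := p ij.1 ij.2.
have P01 ij : 0 < P ij <= 1 by exact: p01.
have kK : 0 < K <= K by rewrite K0 lexx.
have main := golfing UU VV U0 V0 K1 c7 hG heps kK incM PM Meps P01 hpG.
apply: le_trans (_ : Pr P (fun d => ~ certificate U V d M (2 * (K * (c / K)) + 1 / 32)) <= _).
  (* [Prob p] is convertible to [Pr P]. *)
  apply: le_Pr => [|d]; first exact: p01_isprob.
  apply: contra_not => cert; rewrite XsE.
  have KcK : K * (c / K) = c by rewrite mulrC divfK// gt_eqF.
  rewrite KcK in cert.
  apply: (recovery UU VV (t := 2 * c + 1/32)) cert => //.
    by move=> i j; have /andP[] := p01 i j.
  exact: tc.
apply: le_trans main _.
have n5 : n%:R ^+ 5 <= 2 ^+ s.+1 :> R.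
  rewrite sE mulnC exprM lerXn2r ?nnegrE ?exprn_ge0 ?ler0n//.
  by rewrite -natrX ler_nat; have /andP[] := up_log_bounds (isT : (1 < 2)%N) n2.
have np5 : 0 < n%:R ^+ 5 :> R by rewrite exprn_gt0.
have t0 : 0 < 2 ^+ s.+1 :> R by rewrite exprn_gt0.
rewrite expr1 mulrA ler_pdivrMr// mulrAC ler_pdivlMr//.
apply: le_trans (_ : 11 * n%:R ^+ 5 <= _); last by rewrite ler_wpM2l// ler0n.
rewrite -!natrX -!natrM ler_nat.
have h : (k.+1 * (11 * n ^ 3) * n <= n * (11 * n ^ 3) * n)%N by rewrite !leq_mul2r kn !orbT.
by apply: leq_trans h _; rewrite mulnCA -expnS -mulnA -expnSr.
Qed.
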